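(* Let $I\subseteq\mathbb{R}$ be an interval, let $c_1<0<c_2$ with $c_1-c_2>-1/\theta$ be the constants fixed in the definition of $\widehat{L}_{H,\Phi}$, and let $v\in L^\infty(\mathbb{R}^+;C(I))$, with $t\mapsto v(x,t)$ Lipschitz for each $x\in I$, satisfy at least one of the following properties (with $X=C(I)$): (a) $v:[0,+\infty)\to X$ is Lipschitz and $y\in\mathbb{R}\mapsto\mathcal{L}[v](c_2+iy)$ belongs to $L^1(\mathbb{R})$ (as an $X$-valued function); (b) $v$ belongs to $L^2(\mathbb{R}^+)$ and $y\in\mathbb{R}\mapsto\mathcal{L}[v](c_2+iy)$ belongs to $L^2(\mathbb{R})$ (as $X$-valued functions). Let $v_\Phi=S_\Phi v$ be a mild solution of $$\partial_t^\Phi u(x,t)=\tfrac12\mathcal{F}_{H,\Phi}u(x,t),\qquad (x,t)\in I\times(0,+\infty).\qquad (\ast)$$ Suppose that for each fixed $t>0$ one has $v(\cdot,t)\in C^2(I)$, and that for each fixed $x\in I$ $$V'_{2,H}(\cdot)\frac{\partial^2}{\partial x^2}v(x,\cdot)\in L^\infty(0,+\infty).$$ Then $v_\Phi$ is a classical solution of $(\ast)$.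
   Context: **Subordinator.** $\Phi(\lambda)=\int_0^{+\infty}(1-e^{-s\lambda})\,\nu_\Phi(ds)$ is a Bernstein function (no killing, no drift), with Lévy measure $\nu_\Phi$ on $(0,\infty)$ satisfying $\int_0^\infty(t\wedge1)\nu_\Phi(dt)<\infty$ and $\nu_\Phi(0,\infty)=\infty$; it extends holomorphically to $\Phi:\mathbb{H}\to\mathbb{H}$, $\mathbb{H}=\{\lambda\in\mathbb{C}:\Re\lambda>0\}$. $\sigma_\Phi$ is the subordinator with $\mathbb{E}[e^{-\lambda\sigma_\Phi(t)}]=e^{-t\Phi(\lambda)}$, $E_\Phi(t)=\inf\{y>0:\sigma_\Phi(y)>t\}$ its inverse, and $f_\Phi(s,t)$ the probability density (in $s>0$) of $E_\Phi(t)$, $t>0$; one has $\int_0^\infty e^{-\lambda t}f_\Phi(s,t)dt=\frac{\Phi(\lambda)}{\lambda}e^{-s\Phi(\lambda)}$. Put $\bar\nu_\Phi(t)=\nu_\Phi(t,+\infty)$. **Non-local derivative.** $\partial^\Phi u(t)=\frac{d}{dt}\int_0^t\bar\nu_\Phi(t-\tau)(u(\tau)-u(0))d\tau$; $\partial_t^\Phi$ is this operator acting in the variable $t$. **Variance function.** $H\in(1/2,1)$, $\theta>0$, $B^H$ is a fractional Brownian motion with Hurst index $H$, $U_H(t)=e^{-t/\theta}\int_0^te^{s/\theta}dB^H(s)$, and $V_{2,H}(t)=\mathbb{E}[U_H(t)^2]=H(2H-1)e^{-2t/\theta}\int_0^t\int_0^te^{(u+v)/\theta}|u-v|^{2H-2}du\,dv$.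 $V'_{2,H}$ is its derivative. **Operators.** $L^\infty(\mathbb{R}^+;X)$, for a real Banach space $X$, is the space of measurable essentially bounded $v:[0,\infty)\to X$; $C(I)$ (continuous functions on $I$) carries the sup norm; one writes $v(x,t)=v(t)(x)$. $S_\Phi v(t)=\int_0^{\infty}v(s)f_\Phi(s,t)ds$ (Bochner integral, pointwise in $x$), with $S_\Phi v(x,0)=v(x,0)$. $\mathcal{L}$ is the Laplace transform in $t$ and $L_Hu(\lambda)=\mathcal{L}[V'_{2,H}u](\lambda)$, $\lambda\in\mathbb{H}$. Fix $c_1<0<c_2$ with $c_1-c_2>-1/\theta$ such that the inverse of $\Phi$ is well defined on the line $r_{c_2}=\{c_2+iz:z\in\mathbb{R}\}$. Define $$\widehat{L}_{H,\Phi}\bar v(x,\lambda)=\frac{1}{4\pi^2}\int_0^{\infty}e^{-\Phi(\lambda)t}\lim_{R\to\infty}\int_{-\infty}^{\infty}e^{(c_1+iw)t}\int_{-R}^{R}\mathcal{L}[V'_{2,H}](c_1-c_2+i(w-z))\frac{\Phi^{-1}(c_2+iz)}{c_2+iz}\bar v(x,\Phi^{-1}(c_2+iz))\,dz\,dw\,dt,$$ whose domain consists of those $\bar v$ for which this is well defined and $z\mapsto\frac{\Phi^{-1}(c_2+iz)}{c_2+iz}\bar v(x,\Phi^{-1}(c_2+iz))$ does not depend on the choice of local inverse of $\Phi$ on $r_{c_2}$. The Fokker-Planck operator is $$\mathcal{F}_{H,\Phi}v(x,t)=\mathcal{L}^{-1}_{\lambda\to t}\Big[\frac{\Phi(\lambda)}{\lambda}\frac{\partial^2}{\partial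 x^2}\widehat{L}_{H,\Phi}(\mathcal{L}[v])(x,\lambda)\Big](t),$$ with domain the set of functions $v$ for which the right-hand side is well defined. **Solutions of $(\ast)$.** $u:I\times[0,\infty)\to\mathbb{R}$ is a *classical solution* if $u$ is in the domain of $\mathcal{F}_{H,\Phi}$, $\partial_t^\Phi u(x,\cdot)$ is well defined for every $x\in I$, and $(\ast)$ holds pointwise for every $x\in I$ and almost every $t>0$. It is a *mild solution* if $u(x,\cdot)$ is Laplace transformable for every $x\in I$ with transform $\bar u(x,\cdot)$, $\bar u$ belongs to the domain of $\widehat{L}_{H,\Phi}$ for every $x\in I$, $\bar u(\cdot,\lambda)\in C(I)$ for every $\lambda\in\mathbb{H}$, and $$\Phi(\lambda)\bar u(x,\lambda)-\frac{\Phi(\lambda)}{\lambda}u(x,0)=\frac{\Phi(\lambda)}{2\lambda}\frac{\partial^2}{\partial x^2}\widehat{L}_{H,\Phi}\bar u(x,\lambda),\qquad x\in I,\ \lambda\in\mathbb{H}.$$ *)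

(* Defs.v *)
From HB Require Import structures.
From mathcomp Require Import all_boot all_order all_algebra.
From mathcomp Require Import all_classical all_reals all_analysis.
From mathcomp Require Import complex.

Set Implicit Arguments.
Unset Strict Implicit.
Unset Printing Implicit Defensive.

Import Order.TTheory GRing.Theory Num.Theory.
Import numFieldNormedType.Exports.

(* Not the homonyms Num.Re and Num.Im, which are valued in R[i]. *)
Local Notation Re := complex.Re.
Local Notation Im := complex.Im.

Local Open Scope classical_set_scope.
Local Open Scope complex_scope.
Local Open Scope ring_scope.

Section complex_functions.
Context {R : realType}.

Definition cexp (z : R[i]) : R[i] :=
  (expR (Re z) * cos (Im z)) +i* (expR (Re z) * sin (Im z)).

Definition cintegrable d (T : measurableType d) (mu : {measure set T -> \bar R})
    (D : set T) (f : T -> R[i]) : Prop :=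
  mu.-integrable D (EFin \o (fun s => Re (f s))) /\
  mu.-integrable D (EFin \o (fun s => Im (f s))).

Definition cintegral d (T : measurableType d) (mu : {measure set T -> \bar R})
    (D : set T) (f : T -> R[i]) : R[i] :=
  (\int[mu]_(s in D) Re (f s)) +i* (\int[mu]_(s in D) Im (f s)).

Definition ccvg (F : set_system R) (f : R -> R[i]) : Prop :=
  cvg ((fun r => Re (f r)) @ F) /\ cvg ((fun r => Im (f r)) @ F).

Definition clim (F : set_system R) (f : R -> R[i]) : R[i] :=
  lim ((fun r => Re (f r)) @ F) +i* lim ((fun r => Im (f r)) @ F).

End complex_functions.

Section laplace.
Context {R : realType}.
Local Notation leb := (@lebesgue_measure R).

Definition laplace (g : R -> R) (lam : R[i]) : R[i] :=
  cintegral leb `]0, +oo[ (fun t => cexp (- lam * t%:C) * (g t)%:C).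

Definition laplace_transformable (g : R -> R) : Prop :=
  forall lam : R[i], 0 < Re lam ->
    cintegrable leb `]0, +oo[ (fun t => cexp (- lam * t%:C) * (g t)%:C).

Definition is_inv_laplace (G : R[i] -> R[i]) (g : R -> R) : Prop :=
  laplace_transformable g /\
  forall lam : R[i], 0 < Re lam -> laplace g lam = G lam.

(* Some function on [0, +oo[ with Laplace transform G; it is determined only
   up to a Lebesgue-null set. *)
Definition inv_laplace (G : R[i] -> R[i]) : R -> R :=
  xget (fun=> 0) [set g | is_inv_laplace G g].

End laplace.

Section subordinator.
Context {R : realType}.
Implicit Types nu : {measure set (measurableTypeR R) -> \bar R}.

(* Only the restriction of nu to ]0, +oo[ matters. *)
Definition levy_measure nu : Prop :=
  (\int[nu]_(t in `]0%R, +oo[) (Num.min t 1)%:E < +oo)%E /\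
  nu `]0%R, +oo[%classic = +oo%E.

Definition bernstein nu (l : R) : R :=
  \int[nu]_(s in `]0, +oo[) (1 - expR (- (s * l))).

(* The holomorphic extension of [bernstein nu] to the right half-plane. *)
Definition Phi nu (lam : R[i]) : R[i] :=
  cintegral nu `]0, +oo[ (fun s => 1 - cexp (- (s%:C * lam))).

Definition nu_bar nu (t : R) : R := fine (nu `]t, +oo[%classic).

Definition is_subordinator d (T : measurableType d) (P : probability T R)
    nu (sigma : R -> T -> R) : Prop :=
  [/\ forall t, 0 <= t -> measurable_fun setT (sigma t),
      forall w, [/\ sigma 0 w = 0,
        forall s t, 0 <= s -> s <= t -> sigma s w <= sigma t w &
        forall t, 0 <= t -> (fun s => sigma s w) @ t^'+ --> sigma t w],
      forall (n : nat) (t : nat -> R) (A : nat -> set R),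
        0 <= t 0%N -> (forall i, (i < n)%N -> t i <= t i.+1) ->
        (forall i, (i < n)%N -> measurable (A i)) ->
        P [set w | forall i, (i < n)%N -> A i (sigma (t i.+1) w - sigma (t i) w)]
        = (\prod_(i < n) P [set w | A i (sigma (t i.+1) w - sigma (t i) w)%R])%E,
      forall (s t : R) (A : set R), 0 <= s -> 0 <= t -> measurable A ->
        P [set w | A (sigma (s + t) w - sigma s w)] = P [set w | A (sigma t w)] &
      forall t l : R, 0 <= t -> 0 < l ->
        ('E_P[fun w => expR (- (l * sigma t w)%R)]
         = (expR (- (t * bernstein nu l)))%:E)%E].

Definition inverse_subordinator (T : Type) (sigma : R -> T -> R) (t : R) (w : T)
    : R :=
  inf [set y | 0 < y /\ t < sigma y w].

(* [f ^~ t] is a density on ]0, +oo[ of the law of the inverse at time t > 0. *)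
Definition is_inverse_density d (T : measurableType d) (P : probability T R)
    (sigma : R -> T -> R) (f : R -> R -> R) : Prop :=
  forall t : R, 0 < t ->
    [/\ measurable_fun (`]0, +oo[ : set R) (fun s => f s t),
        forall s, 0 < s -> 0 <= f s t &
        forall A : set R, measurable A ->
          (P [set w | A (inverse_subordinator sigma t w)]
           = \int[@lebesgue_measure R]_(s in A `&` `]0%R, +oo[) (f s t)%:E)%E].

Definition S_Phi (f : R -> R -> R) (v : R -> R -> R) (x t : R) : R :=
  if t == 0 then v x 0
  else \int[@lebesgue_measure R]_(s in `]0, +oo[) (v x s * f s t).

Definition phi_kernel nu (u : R -> R) (t tau : R) : R :=
  nu_bar nu (t - tau) * (u tau - u 0).

Definition phi_integral nu (u : R -> R) (t : R) : R :=
  \int[@lebesgue_measure R]_(tau in `[0, t]) phi_kernel nu u t tau.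

Definition phi_derivative nu (u : R -> R) : R -> R := derive1 (phi_integral nu u).

(* The derivative exists almost everywhere in time. *)
Definition phi_derivative_defined nu (u : R -> R) : Prop :=
  (forall t : R, 0 < t ->
    (@lebesgue_measure R).-integrable `[0, t] (EFin \o phi_kernel nu u t)) /\
  {ae @lebesgue_measure R, forall t : R, 0 < t ->
    derivable (phi_integral nu u) t 1}.

End subordinator.

Section space.
Context {R : realType}.
Variable I : set R.

(* Derivatives relative to I: one-sided at an endpoint that belongs to I.  The
   limit-point condition excludes a one-point I, where they are undetermined. *)
Definition quotient_in (f : R -> R) (x y : R) : R := (f y - f x) / (y - x).

Definition derivable_in (f : R -> R) (x : R) : Prop :=
  limit_point I x /\ cvg (quotient_in f x @ within I x^').

Definition deriv_in (f : R -> R) (x : R) : R :=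
  lim (quotient_in f x @ within I x^').

Definition deriv2_in (f : R -> R) : R -> R := deriv_in (deriv_in f).

Definition twice_derivable_in (f : R -> R) : Prop :=
  forall x, I x -> derivable_in f x /\ derivable_in (deriv_in f) x.

Definition C2_in (f : R -> R) : Prop :=
  twice_derivable_in f /\ {within I, continuous (deriv2_in f)}.

Definition ctwice_derivable_in (g : R -> R[i]) : Prop :=
  twice_derivable_in (fun x => Re (g x)) /\
  twice_derivable_in (fun x => Im (g x)).

Definition cderiv2_in (g : R -> R[i]) (x : R) : R[i] :=
  deriv2_in (fun x => Re (g x)) x +i* deriv2_in (fun x => Im (g x)) x.

(* X = C(I) with the sup norm, for V = R, or V = Rcomplex R, that is R[i] with
   its modulus seen as a real number.  When I is not compact the elements of
   C(I) have to be bounded. *)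
Definition supnorm (V : normedZmodType R) (g : R -> V) : \bar R :=
  ereal_sup [set `|g x|%:E | x in I].

Definition CI (V : normedZmodType R) (g : R -> V) : Prop :=
  (forall x, I x -> (fun y => `|g y - g x|) @ within I (nbhs x) --> (0 : R)) /\
  (supnorm g < +oo)%E.

(* X-valued functions are written g t x = g(t)(x). *)
Definition simple_X (V : normedZmodType R) (s : R -> R -> V) : Prop :=
  exists (n : nat) (A : 'I_n -> set R) (a : 'I_n -> R -> V),
    (forall k, measurable (A k) /\ CI (a k)) /\
    (forall t x, s t x = \sum_(k < n) a k x *+ (t \in A k)).

Definition strongly_measurable_X (V : normedZmodType R) (D : set R)
    (g : R -> R -> V) : Prop :=
  exists s : nat -> R -> R -> V,
    (forall n, simple_X (s n)) /\
    {ae @lebesgue_measure R, forall t, D t ->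
      (fun n => supnorm (fun x => s n t x - g t x)) @ \oo --> 0%E}.

Definition Linfty_X (V : normedZmodType R) (D : set R) (g : R -> R -> V) : Prop :=
  [/\ forall t, D t -> CI (g t),
      strongly_measurable_X D g &
      exists M : R,
        {ae @lebesgue_measure R, forall t, D t -> (supnorm (g t) <= M%:E)%E}].

Definition Lp_X (V : normedZmodType R) (p : nat) (D : set R) (g : R -> R -> V)
    : Prop :=
  strongly_measurable_X D g /\
  (\int[@lebesgue_measure R]_(t in D) (supnorm (g t) ^+ p) < +oo)%E.

Definition Lipschitz_X (V : normedZmodType R) (D : set R) (g : R -> R -> V)
    : Prop :=
  exists k : R, forall s t, D s -> D t ->
    (supnorm (fun x => (g s x - g t x)%R) <= (k * `|s - t|)%:E)%E.

End space.

Definition Linfty {R : realType} (D : set R) (g : R -> R) : Prop :=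
  measurable_fun D g /\
  exists M : R, {ae @lebesgue_measure R, forall t, D t -> `|g t| <= M}.

(* The variance at time t of U(t) = e^(-t/theta) \int_0^t e^(s/theta) dB^H(s), by
   the isometry of the Wiener integral for a Hurst index H > 1/2. *)
Definition V2 {R : realType} (H theta t : R) : R :=
  H * (2 * H - 1) * expR (- (2 * t / theta)) *
  \int[@lebesgue_measure R]_(r in `[0, t])
    \int[@lebesgue_measure R]_(s in `[0, t])
      (expR ((s + r) / theta) * `|s - r| `^ (2 * H - 2)).

Section operators.
Context {R : realType}.
Variable nu : {measure set (measurableTypeR R) -> \bar R}.
Variables H theta c1 c2 : R.
Local Notation leb := (@lebesgue_measure R).

(* The inverse of Phi on the line c2 + i R: phi z is the value at c2 + i z of a
   branch psi of the inverse of Phi, with values in the right half-plane,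
   defined and continuous (hence holomorphic) around c2 + i z. *)
Definition local_inverse_on_line (phi : R -> R[i]) : Prop :=
  forall z : R, exists psi : (R[i])^o -> (R[i])^o,
    psi (c2 +i* z) = phi z /\
    \forall zeta \near ((c2 +i* z) : (R[i])^o),
      [/\ 0 < Re (psi zeta), Phi nu (psi zeta) = zeta & {for zeta, continuous psi}].

Definition inverse_well_defined_on_line : Prop :=
  exists phi, local_inverse_on_line phi.

Definition Phi_inv : R -> R[i] := xget (fun=> 0) [set phi | local_inverse_on_line phi].

(* Below, vb is a function of the Laplace variable alone, the space variable
   being fixed. *)
Definition line_fun (phi : R -> R[i]) (vb : R[i] -> R[i]) (z : R) : R[i] :=
  phi z / (c2 +i* z) * vb (phi z).

Definition Lhat_dz (vb : R[i] -> R[i]) (w z : R) : R[i] :=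
  laplace (derive1 (V2 H theta)) ((c1 - c2) +i* (w - z)) * line_fun Phi_inv vb z.

Definition Lhat_dw (vb : R[i] -> R[i]) (t r w : R) : R[i] :=
  cexp ((c1 +i* w) * t%:C) * cintegral leb `[- r, r] (Lhat_dz vb w).

Definition Lhat_dt (vb : R[i] -> R[i]) (lam : R[i]) (t : R) : R[i] :=
  cexp (- (Phi nu lam * t%:C)) *
  clim +oo (fun r => cintegral leb setT (Lhat_dw vb t r)).

Definition Lhat (vb : R[i] -> R[i]) (lam : R[i]) : R[i] :=
  (4 * pi ^+ 2)^-1%:C * cintegral leb `]0, +oo[ (Lhat_dt vb lam).

Definition Lhat_domain (vb : R[i] -> R[i]) : Prop :=
  [/\ forall phi1 phi2, local_inverse_on_line phi1 -> local_inverse_on_line phi2 ->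
        line_fun phi1 vb = line_fun phi2 vb,
      forall r, 0 < r ->
        {ae leb, forall w, cintegrable leb `[- r, r] (Lhat_dz vb w)},
      {ae leb, forall t, 0 < t ->
        (forall r, 0 < r -> cintegrable leb setT (Lhat_dw vb t r)) /\
        ccvg +oo (fun r => cintegral leb setT (Lhat_dw vb t r))} &
      forall lam : R[i], 0 < Re lam -> cintegrable leb `]0, +oo[ (Lhat_dt vb lam)].

Variable I : set R.

Definition FP_symbol (v : R -> R -> R) (x : R) (lam : R[i]) : R[i] :=
  Phi nu lam / lam * cderiv2_in I (fun y => Lhat (laplace (v y)) lam) x.

Definition FP (v : R -> R -> R) (x : R) : R -> R := inv_laplace (FP_symbol v x).

Definition FP_domain (v : R -> R -> R) : Prop :=
  [/\ forall x, I x -> laplace_transformable (v x),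
      forall x, I x -> Lhat_domain (laplace (v x)),
      forall lam : R[i], 0 < Re lam ->
        ctwice_derivable_in I (fun y => Lhat (laplace (v y)) lam) &
      forall x, I x -> exists g, is_inv_laplace (FP_symbol v x) g].

Definition classical_solution (u : R -> R -> R) : Prop :=
  [/\ FP_domain u,
      forall x, I x -> phi_derivative_defined nu (u x) &
      forall x, I x -> {ae leb, forall t, 0 < t ->
        phi_derivative nu (u x) t = 2^-1 * FP u x t}].

Definition mild_solution (u : R -> R -> R) : Prop :=
  [/\ forall x, I x -> laplace_transformable (u x),
      forall x, I x -> Lhat_domain (laplace (u x)),
      forall lam : R[i], 0 < Re lam ->
        CI I ((fun x => laplace (u x) lam) : R -> Rcomplex R),
      forall lam : R[i], 0 < Re lam ->
        ctwice_derivable_in I (fun y => Lhat (laplace (u y)) lam) &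
      forall x (lam : R[i]), I x -> 0 < Re lam ->
        Phi nu lam * laplace (u x) lam - Phi nu lam / lam * (u x 0)%:C =
        Phi nu lam / (2 * lam) *
          cderiv2_in I (fun y => Lhat (laplace (u y)) lam) x].

End operators.

(* Main.v *)
From HB Require Import structures.
Require Import Defs.
From mathcomp Require Import all_boot all_order all_algebra.
From mathcomp Require Import all_classical all_reals all_analysis.
From mathcomp Require Import measurable_realfun.
From mathcomp Require Import complex.
From mathcomp Require Import ring lra.
Import Order.TTheory GRing.Theory Num.Theory.
Import numFieldNormedType.Exports.
Local Open Scope classical_set_scope.
Local Open Scope ring_scope.
Set Implicit Arguments.
Unset Strict Implicit.
Unset Printing Implicit Defensive.

(** The functional [FP] is defined through its Laplace transform, and the equation
  of a mild solution [u = S_Phi f v] says what this transform is: at each [x],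
  [[
    FP_symbol u x lam = 2 * (Phi lam * L[u x] lam - Phi lam / lam * u x 0).
  ]]
  Thus [x] can be kept fixed: it has to be shown that [phi_derivative nu (u x)]
  exists almost everywhere and has the Laplace transform in parentheses.

  Let [U t = u x t - u x 0] and let [p] be the tail of the Levy measure, so that
  [phi_integral nu (u x)] is the convolution [K] of [p] and [U] on the half-line.  The
  key point is that [K] is Lipschitz if [t |-> v x t] is.  Let [m t] be the mean
  of the inverse subordinator at time [t].  The inverse increases with time, so
  that the mean of a nondecreasing function under its law increases with time
  ([density_mean_nondecreasing]).  If [v x] is [k]-Lipschitz, this applies to the
  functions [k * s + (v x s - v x 0)] and [k * s - (v x s - v x 0)] of [s], whose
  means are [k * m + U] and [k * m - U].  Convolution with the nonnegative kernel
  [p] preserves monotonicity ([econvol_nondecreasing]), and it maps [m] to the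
  identity ([sonine_identity]) since the transforms of [p] and [m] are [Phi lam / lam] and
  [1 / (lam * Phi lam)].  Hence [k * t + K t] and [k * t - K t] are nondecreasing
  ([increment_convol_lipschitz]).

  A Lipschitz function is the primitive of a bounded function [g]
  ([lipschitz_primitive], from the Radon-Nikodym theorem), and [g] is almost
  everywhere its derivative.  Finally
  [[
    L[g] = lam * L[K] = lam * L[p] * L[U] = Phi lam * L[U],
  ]]
  which is [laplace_derivative]: the transform of a convolution is the product of
  the transforms ([laplace_convol]) and [lam * L[p] lam = Phi lam]
  ([Phi_laplace]).  Since a function is determined almost everywhere by its
  Laplace transform ([laplace_ae_unique]), [FP] is [2 * g] almost everywhere. *)

(** * Translations and convolutions *)
Section translation.
Context {R : realType}.
Local Notation mu := (@lebesgue_measure R).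

(** The Borel sets of [R] and the domain of the Lebesgue measure carry different
  displays; this converts measurability from the second to the first. *)
Lemma integrable_measurable (D : set R) (f : R -> \bar R) :
  mu.-integrable D f -> measurable_fun D f.
Proof. exact: measurable_int. Qed.

Lemma measurable_shift (c : R) :
  measurable_fun [set: measurableTypeR R] ((fun x => x + c) : _ -> measurableTypeR R).
Proof. by apply: measurable_funD. Qed.

(** The Lebesgue measure is characterized by its values on half-open intervals,
  and these are not changed by a translation. *)
Lemma lebesgue_measure_shift (c : R) (A : set R) : measurable A ->
  pushforward mu ((fun x => x + c) : measurableTypeR R -> measurableTypeR R) A = mu A.
Proof.
move=> mA.
pose f : measurableTypeR R -> measurableTypeR R := fun x => x + c.
have mf : measurable_fun setT f := measurable_shift c.
pose g : {mfun measurableTypeR R >-> measurableTypeR R} :=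
  HB.pack f (isMeasurableFun.Build _ _ _ _ _ mf).
apply/esym/(@lebesgue_measure_unique R (pushforward mu g)) => //= _ [[a b]] _ <-.
rewrite /pushforward [X in _ = mu X](_ : _ = `]a - c, b - c]%classic); last first.
  by apply/seteqP; split => x; rewrite /= !in_itv /= /f ltrBlDr lerBrDr.
rewrite !lebesgue_measure_itv/= !lte_fin ltrD2r; case: ifP => // _.
by rewrite -!EFinD; congr EFin; ring.
Qed.

Lemma ge0_integral_shift (c : R) (f : R -> \bar R) : measurable_fun setT f ->
  (forall x, (0 <= f x)%E) -> (\int[mu]_x f (x + c)%R = \int[mu]_x f x)%E.
Proof.
move=> mf f0.
rewrite -(@ge0_integral_pushforward _ _ _ _ R _ (measurable_shift c) mu setT f)//.
apply: eq_measure_integral => [|? A mA _]; [exact: measurable_shift|exact: lebesgue_measure_shift].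
Qed.

Lemma integrable_shift (c : R) (f : R -> \bar R) :
  mu.-integrable setT f -> mu.-integrable setT (fun x => f (x + c)).
Proof.
move=> fi0; have mf := integrable_measurable fi0.
move: fi0 => /integrableP[_ fi]; apply/integrableP; split.
  exact: (measurableT_comp mf (measurable_shift c)).
rewrite (@ge0_integral_shift c (abse \o f))//; last by move=> x /=.
exact: (measurableT_comp (@abse_measurable R setT) mf).
Qed.

Lemma integral_shift (c : R) (f : R -> \bar R) :
  mu.-integrable setT f -> (\int[mu]_x f (x + c)%R = \int[mu]_x f x)%E.
Proof.
move=> fi; have mf := integrable_measurable fi.
have := @integral_pushforward _ _ _ _ R _ (measurable_shift c) mu setT f mf
  (integrable_shift c fi) measurableT.
rewrite preimage_setT => <-; apply/esym.
by apply: eq_measure_integral => [|? A mA _]; [exact: measurable_shift|exact/esym/lebesgue_measure_shift].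
Qed.

Lemma measurable_expRN (c : R) (D : set R) :
  measurable_fun D (fun t : R => expR (- (c * t))).
Proof.
apply: measurable_funTS; apply: (measurableT_comp (@measurable_expR R)).
apply: (measurableT_comp (@oppr_measurable R setT)).
exact: mulrl_measurable.
Qed.

Lemma ae_neq (b : R) : {ae mu, forall t : R, t != b}.
Proof.
rewrite /almost_everywhere; exists [set b]; split.
- exact: measurable_set1.
- exact: lebesgue_measure_set1.
- by move=> t /= /negP/negbNE/eqP.
Qed.

Section real_integrands.
Variable D : set R.
Hypothesis mD : measurable D.
Implicit Types f g : R -> R.

Lemma Rintegrable_measurable f : mu.-integrable D (EFin \o f) -> measurable_fun D f.
Proof. by move=> fi; apply/measurable_EFinP; exact: integrable_measurable fi. Qed.

Lemma RintegrableB f g : mu.-integrable D (EFin \o f) -> mu.-integrable D (EFin \o g) ->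
  mu.-integrable D (EFin \o (fun t => f t - g t)).
Proof.
by move=> fi gi; apply: eq_integrable (integrableB _ fi gi) => // t _ /=; rewrite EFinB.
Qed.

Lemma RintegrableD f g : mu.-integrable D (EFin \o f) -> mu.-integrable D (EFin \o g) ->
  mu.-integrable D (EFin \o (fun t => f t + g t)).
Proof.
by move=> fi gi; apply: eq_integrable (integrableD _ fi gi) => // t _ /=; rewrite EFinD.
Qed.

Lemma RintegrableZ (k : R) f : mu.-integrable D (EFin \o f) ->
  mu.-integrable D (EFin \o (fun t => k * f t)).
Proof.
by move=> fi; apply: eq_integrable (integrableZl _ k fi) => // t _ /=; rewrite EFinM.
Qed.

Lemma Rintegrable_le f g : measurable_fun D f -> mu.-integrable D (EFin \o g) ->
  (forall t, D t -> `|f t| <= `|g t|) -> mu.-integrable D (EFin \o f).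
Proof.
move=> mf gi fg; apply: le_integrable gi => //. exact/measurable_EFinP.
Qed.

Lemma RintegralE f : mu.-integrable D (EFin \o f) ->
  ((\int[mu]_(t in D) f t)%:E = \int[mu]_(t in D) (f t)%:E)%E.
Proof. by move=> fi; rewrite /Rintegral fineK//; exact: (integrable_fin_num _ fi). Qed.

Lemma ge0_Rintegrable f : (forall t, D t -> 0 <= f t) -> measurable_fun D f ->
  (\int[mu]_(t in D) (f t)%:E < +oo)%E -> mu.-integrable D (EFin \o f).
Proof.
move=> f0 mf fy; apply/integrableP; split; first exact/measurable_EFinP.
apply: le_lt_trans fy; rewrite le_eqVlt; apply/orP; left; apply/eqP.
by apply: eq_integral => t /set_mem Dt /=; rewrite ger0_norm// f0.
Qed.

Lemma Rintegrable_mkcond f :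
  mu.-integrable D (EFin \o f) <-> mu.-integrable setT (EFin \o (f \_ D)).
Proof. by rewrite -restrict_EFin; apply: integrable_mkcond. Qed.

End real_integrands.

End translation.

Section convolution.
Context {R : realType}.
Local Notation mu := (@lebesgue_measure R).
Implicit Types (p q w : R -> R) (a t : R).

Lemma measurable_gtr (b : R) (A : set R) :
  measurable_fun A (fun t : R => (b < t)%R%:R : R).
Proof.
rewrite (_ : (fun t : R => _) = \1_(`]b, +oo[)); last first.
  by apply/funext => t; rewrite indicE mem_setE in_itv/= andbT.
by apply: measurable_funTS; apply: measurable_indic; exact: measurable_itv.
Qed.

Definition heaviside t : R := (0 < t)%R%:R.

Lemma measurable_heaviside : measurable_fun setT heaviside.
Proof. exact: measurable_gtr. Qed.

Lemma heaviside_ge0 t : 0 <= heaviside t.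
Proof. by rewrite /heaviside; case: (0 < t). Qed.

Lemma heaviside_gt0 t : 0 < t -> heaviside t = 1.
Proof. by rewrite /heaviside => ->. Qed.

Lemma heaviside_le0 t : t <= 0 -> heaviside t = 0.
Proof. by rewrite /heaviside leNgt => /negbTE ->. Qed.

(** [econvol] can be [+oo]: it serves for nonnegative kernels, before they are
  known to be integrable. *)
Definition convol p q (t : R) : R := \int[mu]_tau (p (t - tau) * q tau).
Definition econvol p q (t : R) : \bar R := (\int[mu]_tau (p (t - tau) * q tau)%:E)%E.

Lemma measurable_diff : measurable_fun [set: measurableTypeR R * measurableTypeR R]
  ((fun z => z.1 - z.2) : _ -> measurableTypeR R).
Proof. by apply: measurable_funB. Qed.

Lemma measurable_convol_kernel p q : measurable_fun setT p -> measurable_fun setT q ->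
  measurable_fun [set: measurableTypeR R * measurableTypeR R]
    (fun z => p (z.1 - z.2) * q z.2).
Proof.
move=> mp mq; apply: measurable_funM.
  exact: (measurableT_comp mp measurable_diff).
exact: (measurableT_comp mq measurable_snd).
Qed.

Section nonneg.
Variables p q : R -> R.
Hypotheses (mp : measurable_fun setT p) (mq : measurable_fun setT q).
Hypotheses (p0 : forall x, 0 <= p x) (q0 : forall x, 0 <= q x).

Lemma measurable_econvol : measurable_fun setT (econvol p q).
Proof.
apply: (@measurable_fun_fubini_tonelli_F _ _ (measurableTypeR R) (measurableTypeR R) R mu
   (fun z => (p (z.1 - z.2) * q z.2)%:E)) => //.
- by apply/measurable_EFinP; exact: measurable_convol_kernel.
- by move=> z; rewrite lee_fin mulr_ge0.
Qed.

Lemma econvol_ge0 t : (0 <= econvol p q t)%E.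
Proof. by apply: integral_ge0 => x _; rewrite lee_fin mulr_ge0. Qed.

(** Tonelli's theorem, followed by the translation [t = r + tau] in the inner
  integral. *)
Lemma ge0_integral_econvol w : measurable_fun setT w -> (forall x, 0 <= w x) ->
  (\int[mu]_t ((w t)%:E * econvol p q t) =
   \int[mu]_tau \int[mu]_r (w (r + tau) * p r * q tau)%:E)%E.
Proof.
move=> mw w0.
have mk := measurable_convol_kernel mp mq.
transitivity (\int[mu]_t \int[mu]_tau (w t * (p (t - tau) * q tau))%:E)%E.
  apply: eq_integral => t _; rewrite /econvol -ge0_integralZl//.
  - apply/measurable_EFinP; apply: measurable_funM => //.
    by apply: (measurableT_comp mp); apply: measurable_funB.
  - by move=> x _; rewrite lee_fin mulr_ge0.
  - by rewrite lee_fin.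
rewrite (@fubini_tonelli _ _ _ _ R mu mu
   (fun z => (w z.1 * (p (z.1 - z.2) * q z.2))%:E)); first last.
- by move=> z; rewrite lee_fin !mulr_ge0.
- apply/measurable_EFinP; apply: measurable_funM => //.
  exact: (measurableT_comp mw measurable_fst).
apply: eq_integral => tau _ /=.
rewrite -(ge0_integral_shift tau); first last.
- by move=> x; rewrite lee_fin !mulr_ge0.
- apply/measurable_EFinP; apply: measurable_funM => //.
  apply: measurable_funM => //.
  by apply: (measurableT_comp mp); apply: measurable_funB.
by apply: eq_integral => r _; rewrite addrK mulrA.
Qed.

End nonneg.

(** Convolving with a nonnegative kernel preserves monotonicity because
  translating the variable turns an increase of the time into an increase of the
  argument of the second factor. *)
Lemma econvol_nondecreasing p q : measurable_fun setT p -> measurable_fun setT q ->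
  (forall x, 0 <= p x) -> (forall x, 0 <= q x) -> {homo q : x y / x <= y} ->
  {homo econvol p q : s t / s <= t >-> (s <= t)%E}.
Proof.
move=> mp mq p0 q0 qnd s t st.
have m1 (u : R) : measurable_fun setT (fun x : R => (p (u - x) * q x)%:E).
  apply/measurable_EFinP; apply: measurable_funM => //.
  by apply: (measurableT_comp mp); apply: measurable_funB.
rewrite /econvol -(ge0_integral_shift (s - t)); first last.
- by move=> x; rewrite lee_fin !mulr_ge0.
- exact: m1.
apply: ge0_le_integral => //.
- by move=> x _; rewrite lee_fin !mulr_ge0.
- exact: (measurableT_comp (m1 s) (measurable_shift (s - t))).
- exact: m1.
- move=> x _; rewrite lee_fin (_ : s - (x + (s - t)) = t - x); last by ring.
  by rewrite ler_wpM2l// qnd// gerDl subr_le0.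
Qed.

Lemma econvol_integrable p q t : measurable_fun setT p -> measurable_fun setT q ->
  (forall x, 0 <= p x) -> (forall x, 0 <= q x) -> (econvol p q t < +oo)%E ->
  mu.-integrable setT (EFin \o (fun tau => p (t - tau) * q tau)).
Proof.
move=> mp mq p0 q0 cf; apply/integrableP; split.
  apply/measurable_EFinP; apply: measurable_funM => //.
  by apply: (measurableT_comp mp); apply: measurable_funB.
apply: le_lt_trans cf; rewrite le_eqVlt; apply/orP; left; apply/eqP.
by apply: eq_integral => x _ /=; rewrite ger0_norm// mulr_ge0.
Qed.

(** An exponential weight turns the translation in [ge0_integral_econvol] into a
  product. *)
Lemma laplace_econvol (p q : R -> R) a : measurable_fun setT p -> measurable_fun setT q ->
  (forall x, 0 <= p x) -> (forall x, 0 <= q x) ->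
  (\int[mu]_t ((expR (- (a * t)))%:E * econvol p q t) =
   (\int[mu]_r (expR (- (a * r)) * p r)%:E) * (\int[mu]_r (expR (- (a * r)) * q r)%:E))%E.
Proof.
move=> mp mq p0 q0; have me : measurable_fun setT (fun t : R => expR (- (a * t))) by exact: measurable_expRN.
rewrite (ge0_integral_econvol mp mq p0 q0 me); last by move=> x; exact: expR_ge0.
rewrite -ge0_integralZl//.
- apply: eq_integral => tau _.
  rewrite muleC -ge0_integralZl//.
  + by apply: eq_integral => r _; rewrite -EFinM mulrDr opprD expRD; congr EFin; ring.
  + by apply/measurable_EFinP; exact: measurable_funM.
  + by move=> r _; rewrite lee_fin mulr_ge0// expR_ge0.
  + by rewrite lee_fin mulr_ge0// expR_ge0.
- by apply/measurable_EFinP; exact: measurable_funM.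
- by move=> r _; rewrite lee_fin mulr_ge0// expR_ge0.
- by apply: integral_ge0 => r _; rewrite lee_fin mulr_ge0// expR_ge0.
Qed.

Lemma econvol_eq0 (p q : R -> R) t : (forall t, t <= 0 -> p t = 0) ->
  (forall t, t <= 0 -> q t = 0) -> t <= 0 -> econvol p q t = 0%E.
Proof.
move=> p0 q0 t0; rewrite /econvol integral0_eq// => tau _.
have [h|h] := leP tau 0; first by rewrite q0// mulr0.
by rewrite p0 ?mul0r// subr_le0 (le_trans t0)// ltW.
Qed.

Lemma econvol_heaviside t : 0 < t -> econvol heaviside heaviside t = t%:E.
Proof.
move=> t0; transitivity (\int[mu]_r (\1_(`]0%R, t[%classic : set R) r)%:E)%E.
  apply: eq_integral => r _; rewrite indicE mem_setE in_itv/= /heaviside subr_gt0.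
  by case: (0 < r); case: (r < t); rewrite /= ?mulr0 ?mul0r ?mulr1.
rewrite integral_indic//.
have l : mu `]0%R, t[%classic = t%:E by rewrite lebesgue_measure_itv /= lte_fin t0 -EFinD subr0.
by rewrite setIT.
Qed.

End convolution.

Section convolution_fubini.
Context {R : realType}.
Local Notation mu := (@lebesgue_measure R).

Variables p q : R -> R.
Hypotheses (ip : mu.-integrable setT (EFin \o p)) (iq : mu.-integrable setT (EFin \o q)).

Let mp : measurable_fun setT p. Proof. by apply/measurable_EFinP; exact: (integrable_measurable ip). Qed.

Let mq : measurable_fun setT q. Proof. by apply/measurable_EFinP; exact: (integrable_measurable iq). Qed.

Lemma integrable_convol_kernel (w : R -> R) : measurable_fun setT w ->
  (forall x, `|w x| <= 1) ->
  (mu \x mu)%E.-integrable setT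
    (fun z => (w z.1 * (p (z.1 - z.2) * q z.2))%:E).
Proof.
move=> mw w1.
have mk := measurable_convol_kernel mp mq.
have mf : measurable_fun setT (fun z : measurableTypeR R * measurableTypeR R =>
    (w z.1 * (p (z.1 - z.2) * q z.2))%:E).
  apply/measurable_EFinP; apply: measurable_funM => //.
  exact: (measurableT_comp mw measurable_fst).
apply/integrable21ltyP => //=.
apply: (@le_lt_trans _ _ (\int[mu]_tau ((\int[mu]_r `|p r|%:E) * `|q tau|%:E))%E).
  apply: ge0_le_integral => //.
  - by move=> x _; apply: integral_ge0.
  - apply: (measurable_fun_fubini_tonelli_G (fun z : measurableTypeR R * measurableTypeR R =>
    `|(w z.1 * (p (z.1 - z.2) * q z.2))%:E|%E)) => //.
    exact: measurableT_comp.
  - apply: measurable_funeM; apply/measurable_EFinP; exact: measurableT_comp.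
  move=> tau _ /=.
  have -> : (\int[mu]_r `|p r|%:E = \int[mu]_r `|p (r - tau)|%:E)%E.
    rewrite -[LHS](ge0_integral_shift (- tau))//.
    by apply/measurable_EFinP; exact: measurableT_comp.
  have mpt : measurable_fun setT (fun r : R => p (r - tau)).
    by apply: (measurableT_comp mp); apply: measurable_funB.
  rewrite -ge0_integralZr//; last by apply/measurable_EFinP; exact: measurableT_comp.
  apply: ge0_le_integral => //.
  - apply/measurable_EFinP; apply: measurableT_comp => //.
    by apply: measurable_funM => //; apply: measurable_funM.
  - apply/measurable_EFinP; apply: measurable_funM => //.
    exact: measurableT_comp.
  - by move=> x _; rewrite -EFinM lee_fin !normrM ler_piMl// mulr_ge0.
rewrite ge0_integralZl//; first last.
- by apply: integral_ge0 => *; rewrite lee_fin.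
- by apply/measurable_EFinP; exact: measurableT_comp.
have fp : (\int[mu]_r `|p r|%:E < +oo)%E by case/integrableP : ip.
have fq : (\int[mu]_r `|q r|%:E < +oo)%E by case/integrableP : iq.
rewrite lte_mul_pinfty// ?ge0_fin_numE//.
- by apply: integral_ge0 => *; rewrite lee_fin.
- by apply: integral_ge0 => *; rewrite lee_fin.
Qed.

Let F := fun t : R => (\int[mu]_tau (p (t - tau) * q tau)%:E)%E.

Let iF : mu.-integrable setT F.
Proof.
have n1 : forall x : R, `|cst (1 : R) x| <= 1 by move=> x; rewrite /= normr1.
have k := integrable_convol_kernel (@measurable_cst _ _ _ _ setT (1 : R)) n1.
have := integrable_fubini_F k; apply: eq_integrable => // t _.
by apply: eq_integral => tau _; rewrite /= mul1r.
Qed.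

Lemma integrable_convol : mu.-integrable setT (EFin \o convol p q).
Proof.
have mF := integrable_measurable iF.
apply: (le_integrable measurableT _ _ iF) => [|t _].
  by apply/measurable_EFinP; exact: (measurableT_comp (@fine_measurable R setT measurableT) mF).
rewrite /= [convol p q t](_ : _ = fine (F t))//.
by case: (F t) => [r||] /=; rewrite ?normr0 ?leey.
Qed.

(** The signed version of [ge0_integral_econvol]: the weight being bounded, the
  double integral converges absolutely.  The weights of interest are the cosine
  and the sine in a complex exponential. *)
Lemma Rintegral_convol (w : R -> R) : measurable_fun setT w ->
  (forall x, `|w x| <= 1) ->
  \int[mu]_t (w t * convol p q t) = \int[mu]_tau ((\int[mu]_r (w (r + tau) * p r)) * q tau).
Proof.
move=> mw w1.
have k := integrable_convol_kernel mw w1.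
have ic := integrable_convol.
rewrite /Rintegral; congr fine.
transitivity (\int[mu]_t \int[mu]_tau (w t * (p (t - tau) * q tau))%:E)%E.
  apply: ae_eq_integral => //.
  - apply/measurable_EFinP; apply: measurable_funM => //.
    by apply/measurable_EFinP; exact: (integrable_measurable ic).
  - exact: (integrable_measurable (integrable_fubini_F k)).
  have n1 : forall x : R, `|cst (1 : R) x| <= 1 by move=> x; rewrite /= normr1.
  have k1 := integrable_convol_kernel (@measurable_cst _ _ _ _ setT (1 : R)) n1.
  have := ae_integrable1 k1; apply: filterS => t it _.
  have it' : mu.-integrable setT (EFin \o (fun tau => p (t - tau) * q tau)).
    by apply: eq_integrable it => // tau _ /=; rewrite mul1r.
  under [RHS]eq_integral do rewrite EFinM.
  rewrite integralZl// /convol /Rintegral EFinM fineK//.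
  exact: (integrable_fin_num measurableT it').
rewrite (Fubini k).
apply: eq_integral => tau _.
have ir : mu.-integrable setT (EFin \o (fun r => w (r + tau) * p r)).
  apply: (le_integrable measurableT _ _ ip) => [|r _].
    apply/measurable_EFinP; apply: measurable_funM => //.
    exact: (measurableT_comp mw (measurable_shift tau)).
  by rewrite /= lee_fin normrM ler_piMl.
rewrite /fubini_G /=.
transitivity (\int[mu]_r ((w (r + tau) * p r)%:E * (q tau)%:E))%E; last first.
  rewrite integralZr// EFinM fineK//.
  exact: (integrable_fin_num measurableT ir).
rewrite -(@integral_shift R tau (fun t : R => (w t * (p (t - tau) * q tau))%:E)).
  by apply: eq_integral => r _; rewrite addrK mulrA.
have : mu.-integrable setT (fun t : R => (q tau)%:E * (w (t - tau + tau) * p (t - tau))%:E)%E.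
  apply: integrableZl => //.
  exact: (@integrable_shift R (- tau) (EFin \o (fun r => w (r + tau) * p r)) ir).
apply: eq_integrable => // t _.
by rewrite subrK -EFinM mulrC mulrA.
Qed.

End convolution_fubini.

(** * Uniqueness of the Laplace transform *)
Section uniqueness.
Context {R : realType}.
Local Notation mu := (@lebesgue_measure R).

(** By Lebesgue's differentiation theorem [f] is almost everywhere the derivative
  of its primitive. *)
Lemma ae_eq0_of_primitive (f : R -> R) : mu.-integrable setT (EFin \o f) ->
  (forall x, \int[mu]_(t in `]-oo, x]) f t = 0) ->
  {ae mu, forall x, f x = 0}.
Proof.
move=> fi f0.
have fiy y : mu.-integrable `]-oo, y] (EFin \o f).
  by apply: integrableS fi => //; exact: measurable_itv.
have := FTC1Ny fiy (open_integrable_locally openT fi).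
apply: filterS; first exact: (ae_filter_ringOfSetsType mu).
move=> x [_ <-].
by rewrite (_ : (fun _ => _) = cst 0) ?derive1_cst//; apply/funext.
Qed.

Lemma bernoulli_lower (y : R) (m : nat) : 0 <= y <= 1 -> 1 - m%:R * y <= (1 - y) ^+ m.
Proof.
move=> /andP[y0 y1]; elim: m => [|m ih]; first by rewrite mul0r subr0 expr0.
have z0 : 0 <= 1 - y by rewrite subr_ge0.
rewrite exprS; apply: le_trans (ler_wpM2l z0 ih).
rewrite -subr_ge0 (_ : _ - _ = m%:R * y ^+ 2); last by rewrite -natr1; ring.
by rewrite mulr_ge0// sqr_ge0.
Qed.

(** One more factor [1 - y] absorbs the increase of [1 + m%:R * y], because
  [(1 - y) * (1 + y) <= 1]. *)
Lemma bernoulli_upper (y : R) (m : nat) : 0 <= y <= 1 -> (1 - y) ^+ m * (m%:R * y) <= 1.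
Proof.
move=> /andP[y0 y1].
suff : (1 - y) ^+ m * (1 + m%:R * y) <= 1.
  apply: le_trans; rewrite ler_wpM2l// ?exprn_ge0 ?subr_ge0//.
  by rewrite lerDr.
elim: m => [|m ih]; first by rewrite mul0r addr0 expr0 mulr1.
rewrite exprSr -mulrA; apply: le_trans ih.
rewrite ler_wpM2l// ?exprn_ge0 ?subr_ge0//.
rewrite -subr_ge0 (_ : _ - _ = m.+1%:R * y ^+ 2); last by rewrite -natr1; ring.
by rewrite mulr_ge0// sqr_ge0.
Qed.

(** A polynomial in [expR (- t)] which is close to the indicator function of
  [t > b]: with [x = expR (- t)] and [c = expR (- b)] it is the classical
  [(1 - x ^ n) ^ m], where [m] is about [c ^ (- n)]. *)
Definition exp_step (b : R) (n : nat) (t : R) : R :=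
  (1 - expR (- (n%:R * t))) ^+ (Num.truncn (expR (n%:R * b))).+1.

Lemma exp_step_itv b n t : 0 <= t -> 0 <= exp_step b n t <= 1.
Proof.
move=> t0; have e1 : expR (- (n%:R * t)) <= 1.
  by rewrite -[leRHS]expR0 ler_expR oppr_le0 mulr_ge0.
have e0 := expR_ge0 (- (n%:R * t)).
by rewrite /exp_step exprn_ge0 ?subr_ge0//= exprn_ile1 ?subr_ge0// gerBl.
Qed.

(** The two Bernoulli bounds at [y = expR (- n t)], with [m] the integer just above
  [expR (n b)]: the product [m * y] is about [expR (n (b - t))], which is very
  small for [t > b] and very large for [t < b]. *)
Lemma exp_step_approx b n t : 0 <= t -> 0 <= b ->
  (b < t -> 1 - 2 * expR (- (n%:R * (t - b))) <= exp_step b n t) /\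
  (t < b -> exp_step b n t <= expR (- (n%:R * (b - t)))).
Proof.
move=> t0 b0.
have e1 : expR (- (n%:R * t)) <= 1.
  by rewrite -[leRHS]expR0 ler_expR oppr_le0 mulr_ge0.
have e0 := expR_ge0 (- (n%:R * t)).
have /andP[l u] := truncn_itv (expR_ge0 (n%:R * b)).
split=> [bt|tb].
  apply: le_trans (bernoulli_lower _ _); last by rewrite e0.
  rewrite lerD2l lerN2 mulrBr opprB expRD mulrA ler_wpM2r//.
  have : 1 <= expR (n%:R * b) by rewrite -[leLHS]expR0 ler_expR mulr_ge0.
  by rewrite -natr1; lra.
have := @bernoulli_upper (expR (- (n%:R * t))) (Num.truncn (expR (n%:R * b))).+1.
rewrite e0 => /(_ e1); rewrite -/(exp_step b n t) => h.
have /andP[s0 _] := exp_step_itv b n t0.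
rewrite expRN -[leRHS]mul1r ler_pdivlMr ?expR_gt0//; apply: le_trans h.
rewrite ler_wpM2l// mulrBr expRD ler_wpM2r//.
exact: ltW.
Qed.

Lemma cvg_expR_geometric (d : R) : 0 < d -> (fun n => expR (- (n%:R * d))) @ \oo --> 0.
Proof.
move=> d0; have := @cvg_expr R (expR (- d)).
rewrite ger0_norm ?expR_ge0// -[X in _ < X]expR0 ltr_expR oppr_lt0 => /(_ d0).
by apply: cvg_trans; apply: near_eq_cvg; near=> n; rewrite -expRM_natl mulrN.
Unshelve. all: by end_near. Qed.

Lemma cvg_exp_step b t : 0 <= t -> 0 <= b -> t != b ->
  (fun n => exp_step b n t) @ \oo --> ((b < t)%R%:R : R).
Proof.
move=> t0 b0; rewrite neq_lt => /orP[tb|bt].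
- rewrite ltNge (ltW tb) /=.
  have bt0 : 0 < b - t by rewrite subr_gt0.
  apply: (squeeze_cvgr _ (cvg_cst 0) (cvg_expR_geometric bt0)).
  near=> n; have [_ /(_ tb) ->] := exp_step_approx n t0 b0.
  by have /andP[->] := exp_step_itv b n t0.
- have -> : ((b < t)%R%:R : R) = 1 by rewrite bt.
  have tb0 : 0 < t - b by rewrite subr_gt0.
  have c : (fun n => 1 - 2 * expR (- (n%:R * (t - b)))) @ \oo --> (1 - 2 * 0 : R).
    by apply: cvgB; [exact: cvg_cst|apply: cvgMr; exact: cvg_expR_geometric].
  rewrite mulr0 subr0 in c.
  apply: (@squeeze_cvgr _ _ _ R _ (cst 1) _ _ _ c (cvg_cst _)).
  near=> n; have [/(_ bt) -> _] := exp_step_approx n t0 b0.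
  by have /andP[_ ->] := exp_step_itv b n t0.
Unshelve. all: by end_near. Qed.

Local Notation D := (`]0%R, +oo[%classic : set R).

Section moments.
Variable G : R -> R.
Hypothesis iG : forall k : nat, mu.-integrable D (EFin \o (fun t => expR (- (k%:R * t)) * G t)).
Hypothesis G0 : forall k : nat, \int[mu]_(t in D) (expR (- (k%:R * t)) * G t) = 0.

(** Induction on the degree [m]: expanding a factor [1 - expR (- n t)] shifts the
  exponent [k] by [n]. *)
Lemma exp_step_moment (n m : nat) (k : nat) :
  mu.-integrable D (EFin \o (fun t => (1 - expR (- (n%:R * t))) ^+ m * expR (- (k%:R * t)) * G t)) /\
  \int[mu]_(t in D) ((1 - expR (- (n%:R * t))) ^+ m * expR (- (k%:R * t)) * G t) = 0.
Proof.
elim: m k => [|m ih] k.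
  rewrite (_ : (fun t => _) = (fun t => expR (- (k%:R * t)) * G t)) //.
  by apply/funext => t; rewrite expr0 mul1r.
have mD : measurable D by exact: measurable_itv.
have [i1 e1] := ih k; have [i2 e2] := ih (n + k)%N.
have E : (fun t => (1 - expR (- (n%:R * t))) ^+ m.+1 * expR (- (k%:R * t)) * G t) =
  (fun t => (1 - expR (- (n%:R * t))) ^+ m * expR (- (k%:R * t)) * G t -
            (1 - expR (- (n%:R * t))) ^+ m * expR (- ((n + k)%:R * t)) * G t).
  by apply/funext => t; rewrite natrD mulrDl opprD expRD exprSr; ring.
rewrite E; split; last by rewrite RintegralB// e1 e2 subr0.
exact: RintegrableB.
Qed.

(** Dominated convergence along [exp_step b]. *)
Lemma integral_tail_eq0 (b : R) : 0 <= b -> \int[mu]_(t in D) ((b < t)%R%:R * G t) = 0.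
Proof.
move=> b0.
have mD : measurable D by exact: measurable_itv.
have iG0 : mu.-integrable D (EFin \o G).
  by apply: eq_integrable (iG 0%N) => // t _ /=; rewrite mul0r oppr0 expR0 mul1r.
have mG : measurable_fun D G by apply/measurable_EFinP; exact: integrable_measurable iG0.
have me (n : nat) : measurable_fun D (fun t : R => exp_step b n t).
  apply: measurable_funX; apply: measurable_funB => //.
  exact: measurable_expRN.
have mi : measurable_fun D (fun t : R => (b < t)%R%:R : R) .
  exact: measurable_gtr.
have step0 n : (\int[mu]_(t in D) (exp_step b n t * G t)%:E = 0)%E.
  have [i e] := exp_step_moment n (Num.truncn (expR (n%:R * b))).+1 0.
  rewrite (_ : (fun t => (exp_step b n t * G t)%:E) = EFin \o (fun t =>
    (1 - expR (- (n%:R * t))) ^+ (Num.truncn (expR (n%:R * b))).+1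
      * expR (- (0%:R * t)) * G t)).
    rewrite -[LHS]fineK; last exact: (integrable_fin_num _ i).
    by move: e; rewrite /Rintegral /= => ->.
  by apply/funext => t; rewrite /= mul0r oppr0 expR0 mulr1.
have [| | | | |_ _] := @dominated_convergence _ _ _ mu D mD
  (fun n t => (exp_step b n t * G t)%:E) (fun t => ((b < t)%R%:R * G t)%:E)
  (fun t => `|G t|%:E).
- by move=> n; apply/measurable_EFinP; exact: (measurable_funM (me n) mG).
- by apply/measurable_EFinP; exact: (measurable_funM mi mG).
- have := ae_neq b; apply: filterS; first exact: (ae_filter_ringOfSetsType mu).
  move=> t tb t0.
  apply: cvg_EFin; first exact: nearW.
  apply: cvgMr_tmp; apply: cvg_exp_step => //.
  by move: t0; rewrite /= in_itv /= andbT => /ltW.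
- exact: (integrable_norm iG0).
- apply: aeW => t n t0; rewrite lee_fin normrM ler_piMl//.
  have /andP[s0 s1] : 0 <= exp_step b n t <= 1.
    by apply: exp_step_itv; move: t0; rewrite /= in_itv /= andbT => /ltW.
  by rewrite ger0_norm.
rewrite (_ : (fun n => _) = cst 0%E); last exact/funext.
move/cvg_lim => /(_ (@ereal_hausdorff _)).
by rewrite lim_cst// /Rintegral => <-.
Qed.

End moments.

(** The integrals of [F] against polynomials in [expR (- t)] vanish, hence so do its
  integrals over half-lines. *)
Lemma laplace_unique (F : R -> R) :
  (forall a, 0 < a -> mu.-integrable D (EFin \o (fun t => expR (- (a * t)) * F t))) ->
  (forall a, 0 < a -> \int[mu]_(t in D) (expR (- (a * t)) * F t) = 0) ->
  {ae mu, forall t, 0 < t -> F t = 0}.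
Proof.
move=> iF F0.
(* The factor [expR (- t)] makes the constant polynomial admissible: its
   integral against [G] is the Laplace transform of [F] at [1]. *)
pose G t := expR (- t) * F t.
have GE (k : nat) : (fun t => expR (- (k%:R * t)) * G t) = (fun t => expR (- (k.+1%:R * t)) * F t).
  by apply/funext => t; rewrite /G mulrA -expRD -natr1 mulrDl mul1r opprD.
have iG (k : nat) : mu.-integrable D (EFin \o (fun t => expR (- (k%:R * t)) * G t)).
  by rewrite GE; exact: iF.
have G0 (k : nat) : \int[mu]_(t in D) (expR (- (k%:R * t)) * G t) = 0.
  by rewrite GE; exact: F0.
have GE0 : (fun t => expR (- (0%:R * t)) * G t) = G.
  by apply/funext => t; rewrite mul0r oppr0 expR0 mul1r.
have iG0 : mu.-integrable D (EFin \o G) by rewrite -GE0; exact: iG.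
have iGT : mu.-integrable setT (EFin \o (G \_ D)).
  by apply: (proj1 (Rintegrable_mkcond _ G)) iG0; exact: measurable_itv.
have := @ae_eq0_of_primitive (G \_ D) iGT.
have z x : \int[mu]_(t in `]-oo, x]) (G \_ D) t = 0.
  transitivity (\int[mu]_(t in D) ((t <= x)%R%:R * G t)).
    rewrite Rintegral_mkcond [RHS]Rintegral_mkcond; apply: eq_Rintegral => t _.
    rewrite !patchE !mem_setE !in_itv/=.
    by case: (t <= x) => //=; case: ifPn => // _; rewrite ?mul1r ?mul0r.
  have [x0|x0] := leP 0 x; last first.
    transitivity (\int[mu]_(t in D) (0 : R)); last first.
      by rewrite Rintegral_cst ?mul0r//; exact: measurable_itv.
    apply: eq_Rintegral => t; rewrite mem_setE in_itv/= andbT => t0.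
    by rewrite leNgt (lt_trans x0 t0) mul0r.
  have h := integral_tail_eq0 iG G0 x0.
  have e := G0 0%N; rewrite GE0 in e.
  transitivity (\int[mu]_(t in D) (G t - (x < t)%R%:R * G t)).
    apply: eq_Rintegral => t _; rewrite leNgt; case: (x < t) => /=.
      by rewrite mul0r mul1r subrr.
    by rewrite mul1r mul0r subr0.
  rewrite RintegralB// ?e ?h ?subr0//.
  apply: (Rintegrable_le _ _ iG0) => //.
    apply: measurable_funM; first exact: measurable_gtr.
    exact: Rintegrable_measurable iG0.
  by move=> t _; rewrite normrM ler_piMl//; case: (x < t) => /=; rewrite ?normr1 ?normr0 ?ler01.
move=> /(_ z); apply: filterS; first exact: (ae_filter_ringOfSetsType mu).
move=> t Gt t0; move: Gt; rewrite patchE mem_setE in_itv/= t0 /= /G => /eqP.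
by rewrite mulf_eq0 gt_eqF ?expR_gt0//= => /eqP.
Qed.

End uniqueness.

(** * Lipschitz functions are primitives of bounded functions *)
Section stieltjes.
Context {R : realType}.
Local Notation mu := (@lebesgue_measure R).

Lemma lebesgue_stieltjes_itv (F : cumulative R R) (a b : R) : a <= b ->
  lebesgue_stieltjes_measure F `]a, b]%classic = (F b - F a)%:E.
Proof.
move=> ab; rewrite /lebesgue_stieltjes_measure /measure_extension/=.
by rewrite measurable_mu_extE/= ?wlength_itv_bnd//; exact: is_ocitv.
Qed.

Variable F : R -> R.
Hypothesis hF : forall s t, s <= t -> 0 <= F t - F s <= t - s.

Let cF : continuous F.
Proof.
move=> x; apply/cvgrPdist_le => e e0; near=> t.
have : `|x - t| <= e by near: t; exists e => //= y /=; exact: ltW.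
case: (leP x t) => xt.
  have /andP[h1 h2] := hF xt.
  rewrite ler0_norm ?subr_le0// => h.
  by rewrite ler0_norm; lra.
have /andP[h1 h2] := hF (ltW xt).
rewrite ger0_norm => [h|]; last by rewrite subr_ge0 ltW.
by rewrite ger0_norm; lra.
Unshelve. all: by end_near. Qed.

Let Fnd : {homo F : s t / s <= t}.
Proof. by move=> s t st; have /andP[] := hF st; rewrite subr_ge0. Qed.

Let G (t : R) : R := t - F t.

Let Gnd : {homo G : s t / s <= t}.
Proof. by move=> s t st; have /andP[h1 h2] := hF st; rewrite /G; lra. Qed.

Let cG : continuous G.
Proof. by move=> x; apply: cvgB; [exact: cvg_id|exact: cF]. Qed.

Let Fc : cumulative R R :=
  HB.pack F (isCumulative.Build R _ R F Fnd (right_continuousW cF)).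
Let Gc : cumulative R R :=
  HB.pack G (isCumulative.Build R _ R G Gnd (right_continuousW cG)).

Let muF := lebesgue_stieltjes_measure Fc.
Let muG := lebesgue_stieltjes_measure Gc.

(** Both [F] and [t - F t] are nondecreasing, and their Stieltjes measures add up to
  the Lebesgue measure. *)
Let muFG (A : set R) : measurable A -> (muF A <= mu A)%E.
Proof.
move=> mA.
have -> : mu A = measure_add muF muG A.
  apply: lebesgue_measure_unique => // _ [[a b]] _ <-.
  apply: etrans (esym (measure_addE muF muG _)) => /=.
  have [ab|ba] := leP a b; last first.
    by rewrite set_itv_ge ?measure0 ?adde0// bnd_simp -leNgt ltW.
  rewrite lebesgue_measure_itv /= lte_fin.
  rewrite [X in _ = (X + _)%E](lebesgue_stieltjes_itv Fc ab).
  rewrite [X in _ = (_ + X)%E](lebesgue_stieltjes_itv Gc ab).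
  case: ltP => ab'; first by rewrite -!EFinD /= /G; congr EFin; lra.
  rewrite -EFinD /= /G; congr EFin.
  have -> : a = b by apply/eqP; rewrite eq_le ab ab'.
  by rewrite !subrr addr0.
by rewrite (measure_addE muF muG) leeDl.
Qed.

(** The Stieltjes measure of [F] is dominated by the Lebesgue measure, so that it has
  a density (Radon-Nikodym), and this density is almost everywhere at most [1].
  The interval is bounded for the Stieltjes measure to be finite. *)
Lemma lipschitz_density (N : R) : 0 <= N -> exists g : R -> R,
  [/\ measurable_fun setT g, forall t, 0 <= g t <= 1 &
   forall t, 0 <= t <= N -> F t - F 0 = \int[mu]_(s in `]0, t]) g s].
Proof.
move=> N0.
have mD : measurable (`]0, N]%classic : set (measurableTypeR R)) by exact: measurable_itv.
have fD : (muF `]0%R, N]%classic < +oo)%E.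
  by rewrite /muF lebesgue_stieltjes_itv// ltry.
pose nu : {finite_measure set _ -> \bar R} := mfrestr mD fD.
have num : nu `<< mu.
  apply/null_content_dominatesP => A mA A0; apply/eqP.
  rewrite eq_le measure_ge0 andbT /nu /= /mfrestr /mrestr.
  apply: le_trans (muFG _) _; first exact: measurableI.
  rewrite -A0; apply: le_measure; rewrite ?inE//; exact: measurableI.
have [f [f0 ffin fi nuf]] := radon_nikodym_sigma_finite num.
have mf := integrable_measurable fi.
pose h t := fine (f t).
have fh : f = EFin \o h by apply/funext => t; rewrite /h /= fineK.
have mh : measurable_fun setT h.
  exact: (measurableT_comp (@fine_measurable R setT measurableT) mf).
have nule A : measurable A -> (nu A <= mu A)%E.
  move=> mA; rewrite /nu /= /mfrestr /mrestr.
  apply: le_trans (muFG _) _; first exact: measurableI.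
  by apply: le_measure; rewrite ?inE//; exact: measurableI.
(* On [A] the positive function [h - 1] has a nonpositive integral. *)
pose A := [set t : R | 1 < h t].
have mA : measurable A.
  rewrite (_ : A = setT `&` h @^-1` `]1, +oo[); last first.
    by rewrite setTI; apply/seteqP; split => t /=; rewrite in_itv/= andbT.
  exact: (mh measurableT _ (measurable_itv _)).
have h_le1 : {ae mu, forall t, h t <= 1}.
  have iA : mu.-integrable A (EFin \o h).
    by rewrite -fh; apply: integrableS fi.
  have Afin : (mu A < +oo)%E.
    apply: (@le_lt_trans _ _ (\int[mu]_(t in A) (h t)%:E)%E).
      rewrite -[leLHS]mul1e -integral_cst//; apply: ge0_le_integral => //.
        by apply/measurable_EFinP; exact: (measurable_funTS mh).
      by move=> t; rewrite /A /= lee_fin => /ltW.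
    by have := nuf A mA; rewrite fh => <-; rewrite ltey_eq fin_num_measure.
  have i1 : mu.-integrable A (EFin \o cst 1).
    apply/integrableP; split; first by apply/measurable_EFinP; exact: measurable_cst.
    rewrite (_ : (fun x => _) = cst 1%E); last by apply/funext => t /=; rewrite normr1.
    by rewrite integral_cst// mul1e.
  have i2 : mu.-integrable A (EFin \o (fun t => h t - 1)) := RintegrableB mA iA i1.
  have int0 : (\int[mu]_(t in A) `|(h t - 1)%:E| = 0)%E.
    apply/eqP; rewrite eq_le integral_ge0// andbT.
    apply: (@le_trans _ _ (\int[mu]_(t in A) (h t - 1)%:E)%E).
      rewrite le_eqVlt; apply/orP; left; apply/eqP; apply: eq_integral.
      by move=> t /set_mem; rewrite /A /= => h1; rewrite ger0_norm ?subr_ge0 ?ltW.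
    rewrite -(RintegralE mA i2) (RintegralB _ iA i1)// EFinB (RintegralE mA iA) (RintegralE mA i1).
    have -> : (\int[mu]_(t in A) (cst (1 : R) t)%:E = mu A)%E.
      by rewrite -[RHS]mul1e -integral_cst.
    rewrite sube_le0//.
    by have := nuf A mA; rewrite fh /= => <-; exact: nule.
  have mf1 : measurable_fun A (fun t => (h t - 1)%:E).
    exact: integrable_measurable i2.
  have := (ae_eq_integral_abs mu mA mf1).1 int0.
  apply: filterS.
  move=> t hA; rewrite leNgt; apply/negP => h1.
  by have := hA h1 => -[]/eqP; rewrite subr_eq0 => /eqP h2; rewrite h2 ltxx in h1.
exists (fun t => Num.min (h t) 1); split.
- exact: measurable_minr.
- move=> t; rewrite ge_min lexx orbT andbT le_min ler01 andbT.
  by rewrite /h fine_ge0.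
- move=> t /andP[t0 tN].
  have -> : F t - F 0 = fine (nu `]0%R, t]%classic).
    rewrite /nu /= /mfrestr /mrestr setIidl ?lebesgue_stieltjes_itv//.
    by apply: subset_itvl; rewrite bnd_simp.
  rewrite nuf; last exact: measurable_itv.
  rewrite /Rintegral fh; congr fine; apply: ae_eq_integral => //.
  + by apply/measurable_EFinP; exact: (measurable_funTS mh).
  + by apply/measurable_EFinP; apply: measurable_minr => //; exact: (measurable_funTS mh).
  + move: h_le1; apply: filterS.
    by move=> s hs _ /=; rewrite min_l.
Qed.

End stieltjes.

Section lipschitz.
Context {R : realType}.
Local Notation mu := (@lebesgue_measure R).

Lemma bounded_integrable_itv (g : R -> R) (B a b : R) : measurable_fun setT g ->
  (forall t, `|g t| <= B) -> mu.-integrable `]a, b] (EFin \o g).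
Proof.
move=> mg gB; have mD : measurable (`]a, b]%classic : set R) by exact: measurable_itv.
have iB : mu.-integrable `]a, b] (EFin \o cst B).
  apply/integrableP; split; first by apply/measurable_EFinP; exact: measurable_cst.
  rewrite (_ : (fun x => _) = cst `|B|%:E); last exact/funext.
  rewrite integral_cst//= lebesgue_measure_itv /=.
  by case: ifP => _; rewrite ?mule0 ?ltry// -EFinD -EFinM ltry.
apply: (Rintegrable_le mD _ iB); first exact: (measurable_funTS mg).
by move=> t _ /=; rewrite (le_trans (gB t))// ler_norm.
Qed.

Section coherence.
Variables (g1 g2 : R -> R) (N : R).
Hypotheses (m1 : measurable_fun setT g1) (m2 : measurable_fun setT g2).
Hypotheses (b1 : forall t, 0 <= g1 t <= 1) (b2 : forall t, 0 <= g2 t <= 1).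
Hypotheses (N0 : 0 <= N).
Hypothesis e12 : forall t, 0 <= t <= N ->
  \int[mu]_(s in `]0, t]) g1 s = \int[mu]_(s in `]0, t]) g2 s.

Lemma density_unique : {ae mu, forall t, 0 < t <= N -> g1 t = g2 t}.
Proof.
have n1 t : `|g1 t| <= 1 by have /andP[h ?] := b1 t; rewrite ger0_norm.
have n2 t : `|g2 t| <= 1 by have /andP[h ?] := b2 t; rewrite ger0_norm.
have mD : measurable (`]0, N]%classic : set R) by exact: measurable_itv.
have i1 x := bounded_integrable_itv 0 x m1 n1.
have i2 x := bounded_integrable_itv 0 x m2 n2.
have iD : mu.-integrable `]0, N] (EFin \o (fun t => g1 t - g2 t)) := RintegrableB mD (i1 N) (i2 N).
have iT := proj1 (Rintegrable_mkcond mD _) iD.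
have := ae_eq0_of_primitive iT.
have z x : \int[mu]_(t in `]-oo, x]) ((fun t => g1 t - g2 t) \_ `]0, N]) t = 0.
  pose y := Num.max 0 (Num.min x N).
  have y0 : 0 <= y <= N.
    by rewrite /y le_max lexx /= ge_max N0 /= ge_min lexx orbT.
  transitivity (\int[mu]_(t in `]0, y]) (g1 t - g2 t)).
    rewrite Rintegral_mkcond [RHS]Rintegral_mkcond; apply: eq_Rintegral => t _.
    rewrite !patchE !mem_setE !in_itv/= /y le_max le_min.
    by case: (ltP 0 t) => t0 /=; case: (t <= x); rewrite //= ?andbF//=; case: (t <= N).
  by rewrite (RintegralB _ (i1 y) (i2 y))// e12// subrr.
move=> /(_ z); apply: filterS; first exact: (ae_filter_ringOfSetsType mu).
by move=> t + tN; rewrite patchE mem_setE in_itv/= tN => /eqP; rewrite subr_eq0 => /eqP.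
Qed.

End coherence.

Lemma measurable_truncn_eq (k : nat) : measurable [set t : R | Num.truncn t = k].
Proof.
have mle (n : nat) : measurable [set t : R | (Num.truncn t <= n)%N].
  rewrite (_ : [set _ | _] = `]-oo, n.+1%:R[%classic); first exact: measurable_itv.
  by apply/seteqP; split => t /=; rewrite in_itv /= truncn_le_nat.
case: k => [|n].
  rewrite (_ : [set _ | _] = [set t : R | (Num.truncn t <= 0)%N])//.
  by apply/seteqP; split => t; rewrite /= leqn0 => /eqP.
rewrite (_ : [set _ | _] =
  [set t : R | (Num.truncn t <= n.+1)%N] `\` [set t : R | (Num.truncn t <= n)%N]).
  exact: measurableD.
apply/seteqP; split => t; rewrite /=; first by move=> ->; rewrite leqnn ltnn.
by move=> [h1 /negP]; rewrite -ltnNge => h2; apply/eqP; rewrite eqn_leq h1.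
Qed.

(** The densities on the intervals from [0] to [n] agree almost everywhere; at [t]
  one takes the density on the shortest of these intervals that contains a
  right neighbourhood of [t]. *)
Lemma lipschitz_density_global (F : R -> R) :
  (forall s t, s <= t -> 0 <= F t - F s <= t - s) ->
  exists g : R -> R, [/\ measurable_fun setT g, forall t, 0 <= g t <= 1 &
   forall t, 0 <= t -> F t - F 0 = \int[mu]_(s in `]0, t]) g s].
Proof.
move=> hF.
have /choice[gs gsP] : forall n : nat, exists g : R -> R,
    [/\ measurable_fun setT g, forall t, 0 <= g t <= 1 &
     forall t, 0 <= t <= n%:R -> F t - F 0 = \int[mu]_(s in `]0, t]) g s].
  by move=> n; apply: lipschitz_density.
pose g t := gs (Num.truncn t).+1 t.
have mg : measurable_fun setT g.
  pose E n := [set t : R | Num.truncn t = n].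
  have -> : setT = \bigcup_n E n by apply/esym/seteqP; split => // t _; exists (Num.truncn t).
  have mE n : measurable (E n) := measurable_truncn_eq n.
  apply/(measurable_fun_bigcup _ _).2 => // n.
  have [mn _ _] := gsP n.+1.
  apply: (@eq_measurable_fun _ _ _ _ (E n) (gs n.+1)); last exact: (measurable_funTS mn).
  by move=> t /set_mem; rewrite /E /g /= => ->.
exists g; split => //; first by move=> t; have [_ + _] := gsP (Num.truncn t).+1; apply.
move=> t t0; pose N := (Num.truncn t).+1.
have tN : t <= N%:R by have /andP[_ /ltW] := truncn_itv t0.
have [mN bN ->] := gsP N; last by rewrite t0.
have n1 s : `|gs N s| <= 1 by have /andP[h ?] := bN s; rewrite ger0_norm.
rewrite /Rintegral; congr fine; apply: ae_eq_integral => //.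
- by apply/measurable_EFinP; exact: (measurable_funTS mN).
- by apply/measurable_EFinP; exact: (measurable_funTS mg).
have : forall M, {ae mu, forall s, (M <= N)%N -> 0 < s <= M%:R -> gs M s = gs N s}.
  move=> M; have [mM bM eM] := gsP M.
  have [MN|] := boolP (M <= N)%N; last by move=> ?; exact: aeW.
  have [_ _ eN] := gsP N.
  have : {ae mu, forall s, 0 < s <= M%:R -> gs M s = gs N s}.
    apply: density_unique => // s /andP[s0 sM]; rewrite -eM ?s0// -eN// s0/=.
    by rewrite (le_trans sM)// ler_nat.
  apply: filterS; first exact: (ae_filter_ringOfSetsType mu).
  by move=> s h _.
move/ae_foralln; apply: filterS => s hs /= sN.
move: (sN); rewrite in_itv/= => /andP[s0 st].
rewrite /g hs//.
- by rewrite /N ltnS; exact: le_truncn.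
- by have /andP[_ /ltW ->] := truncn_itv (ltW s0); rewrite s0.
Qed.

(** After adding [k * t] and rescaling, the increments of [K] lie between [0] and
  those of the identity. *)
Lemma lipschitz_primitive (K : R -> R) (k : R) : 0 < k -> K 0 = 0 ->
  (forall s t, 0 <= s -> s <= t -> `|K t - K s| <= k * (t - s)) ->
  exists g : R -> R, [/\ measurable_fun setT g, forall t, `|g t| <= k &
   forall t, 0 <= t -> K t = \int[mu]_(s in `]0, t]) g s].
Proof.
move=> k0 K0 hK.
pose F t := (K (Num.max t 0) + k * t) / (2 * k).
have k20 : 0 < 2 * k by lra.
have hF s t : s <= t -> 0 <= F t - F s <= t - s.
  move=> st; rewrite /F -mulrBl ler_pdivlMr// mul0r ler_pdivrMr//.
  have /hK : 0 <= Num.max s 0 by rewrite le_max lexx orbT.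
  move=> /(_ (Num.max t 0)).
  have -> : Num.max s 0 <= Num.max t 0 by rewrite ge_max !le_max st lexx /= orbT.
  have : Num.max t 0 - Num.max s 0 <= t - s.
    by case: (leP t 0) => h1; case: (leP s 0) => h2; lra.
  move=> /(ler_wpM2l (ltW k0)) h /(_ isT); rewrite ler_norml => /andP[h1 h2].
  by apply/andP; split; lra.
have [g [mg bg gF]] := lipschitz_density_global hF.
have n1 s : `|g s| <= 1 by have /andP[h ?] := bg s; rewrite ger0_norm.
(* This undoes the affine change that defines [F]. *)
exists (fun t => 2 * k * g t - k); split.
- by apply: measurable_funB => //; apply: measurable_funM.
- by move=> t; have /andP[] := bg t; rewrite ler_norml; nra.
move=> t t0.
have mD : measurable (`]0, t]%classic : set R) by exact: measurable_itv.
have ig := bounded_integrable_itv 0 t mg n1.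
have ik : mu.-integrable `]0, t] (EFin \o (fun=> k)).
  by apply: (@bounded_integrable_itv _ k) => // s; rewrite ger0_norm// ltW.
have igk := RintegrableZ mD (2 * k) ig.
rewrite (RintegralB _ igk ik)// RintegralZl// -gF// Rintegral_cst// /F.
have -> : fine (mu (`]0%R, t]%classic : set R)) = t.
  rewrite lebesgue_measure_itv /= lte_fin; case: ltP => /= h; first by rewrite subr0.
  by apply/eqP; rewrite eq_le t0 h.
rewrite !max_l// K0 mulr0 addr0 mul0r subr0.
by field; rewrite gt_eqF.
Qed.

(** Lebesgue's differentiation theorem. *)
Lemma ae_primitive_derivable (g : R -> R) (k : R) : measurable_fun setT g ->
  (forall t, `|g t| <= k) ->
  {ae mu, forall t : R, 0 < t ->
    derivable (fun t : R => \int[mu]_(s in `]0, t]) g s) t 1 /\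
    derive1 (fun t : R => \int[mu]_(s in `]0, t]) g s) t = g t}.
Proof.
move=> mg gk.
have ig t : mu.-integrable [set` Interval (BRight 0) (BRight t)] (EFin \o g).
  exact: bounded_integrable_itv gk.
have lg : locally_integrable setT g.
  split=> // [|A _ cA]; first exact: openT.
  have mA : measurable A := compact_measurable cA.
  apply: (@le_lt_trans _ _ (\int[mu]_(x in A) k%:E)%E).
    apply: ge0_le_integral => //.
    - by apply/measurable_EFinP; apply: measurableT_comp => //; exact: measurable_funTS.
    - by move=> t _; rewrite lee_fin (le_trans _ (gk t)).
  rewrite integral_cst// lte_mul_pinfty// ?lee_fin ?(le_trans _ (gk 0))//.
  exact: compact_finite_measure.
have := FTC1 ig lg; apply: filterS; first exact: (ae_filter_ringOfSetsType mu).
by move=> t h t0; exact: (h t0).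
Qed.

End lipschitz.

(** * The Laplace transform at complex arguments *)

Section laplace.
Local Open Scope complex_scope.
Local Notation Re := complex.Re.
Local Notation Im := complex.Im.
Context {R : realType}.
Local Notation mu := (@lebesgue_measure R).
Local Notation D := (`]0%R, +oo[%classic : set R).
Implicit Types (p q g : R -> R) (a b t : R).

(** At the complex argument [a +i* b] the Laplace kernel is [expR (- (a * t))] times
  [wcos b t +i* wsin b t].  These two weights are bounded by [1], so that every
  statement at a complex argument splits into two real ones with the same
  integrability hypothesis as at [a]. *)
Definition wcos b t : R := cos (- (b * t)).
Definition wsin b t : R := sin (- (b * t)).

Lemma wcosD b r t : wcos b (r + t) = wcos b r * wcos b t - wsin b r * wsin b t.
Proof. by rewrite /wcos mulrDr opprD cosD. Qed.

Lemma wsinD b r t : wsin b (r + t) = wsin b r * wcos b t + wcos b r * wsin b t.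
Proof. by rewrite /wsin mulrDr opprD sinD. Qed.

Lemma wcos_le1 b t : `|wcos b t| <= 1.
Proof. by rewrite ler_norml cos_geN1 cos_le1. Qed.

Lemma wsin_le1 b t : `|wsin b t| <= 1.
Proof. by rewrite ler_norml sin_geN1 sin_le1. Qed.

Let measurable_angle b : measurable_fun setT (fun t : R => - (b * t)).
Proof.
apply: (measurableT_comp (@oppr_measurable R setT)); exact: mulrl_measurable.
Qed.

Lemma measurable_wcos b : measurable_fun setT (wcos b).
Proof.
apply: (measurableT_comp _ (measurable_angle b)).
by apply: continuous_measurable_fun; exact: continuous_cos.
Qed.

Lemma measurable_wsin b : measurable_fun setT (wsin b).
Proof.
apply: (measurableT_comp _ (measurable_angle b)).
by apply: continuous_measurable_fun; exact: continuous_sin.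
Qed.

Lemma laplace_kernelE g a b t : cexp (- (a +i* b) * t%:C) * (g t)%:C =
  (wcos b t * (expR (- (a * t)) * g t)) +i* (wsin b t * (expR (- (a * t)) * g t)).
Proof.
rewrite (_ : - (a +i* b) * t%:C = (- (a * t)) +i* (- (b * t))); last first.
  by simpc; rewrite ?mulNr.
rewrite /cexp /wcos /wsin; simpc.
by congr (_ +i* _); ring.
Qed.

Lemma laplaceE g a b : laplace g (a +i* b) =
  (\int[mu]_(t in D) (wcos b t * (expR (- (a * t)) * g t))) +i*
  (\int[mu]_(t in D) (wsin b t * (expR (- (a * t)) * g t))).
Proof.
rewrite /laplace /cintegral; congr (_ +i* _); apply: eq_Rintegral => t _.
  by rewrite laplace_kernelE.
by rewrite laplace_kernelE.
Qed.

Lemma laplace_realE g a : laplace g a%:C = (\int[mu]_(t in D) (expR (- (a * t)) * g t))%:C.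
Proof.
rewrite -[a%:C]/(a +i* 0) laplaceE; congr (_ +i* _).
  by apply: eq_Rintegral => t _; rewrite /wcos mul0r oppr0 cos0 mul1r.
transitivity (\int[mu]_(t in D) (0 : R)).
  by apply: eq_Rintegral => t _; rewrite /wsin mul0r oppr0 sin0 mul0r.
by rewrite Rintegral_cst ?mul0r//; exact: measurable_itv.
Qed.

Lemma Rintegrable_bounded_mul (A : set R) (w f : R -> R) : measurable A ->
  measurable_fun setT w -> (forall t, `|w t| <= 1) ->
  mu.-integrable A (EFin \o f) -> mu.-integrable A (EFin \o (fun t => w t * f t)).
Proof.
move=> mA mw w1 fi; apply: (Rintegrable_le mA _ fi).
  by apply: measurable_funM; [exact: measurable_funTS|exact: (Rintegrable_measurable fi)].
by move=> t _; rewrite normrM ler_piMl.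
Qed.

Lemma laplace_cintegrable g (lam : R[i]) :
  mu.-integrable D (EFin \o (fun t => expR (- (Re lam * t)) * g t)) ->
  cintegrable mu D (fun t => cexp (- lam * t%:C) * (g t)%:C).
Proof.
case: lam => a b /= gi; have mD : measurable D by exact: measurable_itv.
split.
  rewrite (_ : (fun s => Re _) = fun t => wcos b t * (expR (- (a * t)) * g t)).
    apply: Rintegrable_bounded_mul gi => //; [exact: measurable_wcos|exact: wcos_le1].
  by apply/funext => t; rewrite laplace_kernelE.
rewrite (_ : (fun s => Im _) = fun t => wsin b t * (expR (- (a * t)) * g t)).
  apply: Rintegrable_bounded_mul gi => //; [exact: measurable_wsin|exact: wsin_le1].
by apply/funext => t; rewrite laplace_kernelE.
Qed.

Lemma cintegrable_real g a :
  cintegrable mu D (fun t => cexp (- a%:C * t%:C) * (g t)%:C) ->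
  mu.-integrable D (EFin \o (fun t => expR (- (a * t)) * g t)).
Proof.
move=> [+ _]; congr (_.-integrable _ (EFin \o _)); apply/funext => t.
by rewrite -[a%:C]/(a +i* 0) laplace_kernelE /= /wcos mul0r oppr0 cos0 mul1r.
Qed.

Section convolution.
Variables (p q : R -> R) (a : R).
Hypotheses (p0 : forall t, t <= 0 -> p t = 0) (q0 : forall t, t <= 0 -> q t = 0).

Lemma convol_eq0 t : t <= 0 -> convol p q t = 0.
Proof.
move=> t0; rewrite /convol (_ : (fun _ => _) = cst 0).
  by rewrite Rintegral_cst ?mul0r.
apply/funext => tau /=; have [h|h] := leP tau 0; first by rewrite q0// mulr0.
by rewrite p0 ?mul0r// subr_le0 (le_trans t0)// ltW.
Qed.

Lemma Rintegral_halfline (f : R -> R) : (forall t, t <= 0 -> f t = 0) ->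
  \int[mu]_(t in D) f t = \int[mu]_t f t.
Proof.
move=> f0; rewrite Rintegral_mkcond; apply: eq_Rintegral => t _.
by rewrite patchE mem_setE in_itv/= andbT; case: ltP => // /f0 ->.
Qed.

Lemma Rintegrable_halfline (f : R -> R) : (forall t, t <= 0 -> f t = 0) ->
  mu.-integrable D (EFin \o f) <-> mu.-integrable setT (EFin \o f).
Proof.
move=> f0; have E : f \_ D = f.
  apply/funext => t.
  by rewrite patchE mem_setE in_itv/= andbT; case: ltP => // /f0 ->.
have h := @Rintegrable_mkcond R D (measurable_itv _) f.
by rewrite E in h.
Qed.

Hypotheses (ip : mu.-integrable D (EFin \o (fun t => expR (- (a * t)) * p t)))
           (iq : mu.-integrable D (EFin \o (fun t => expR (- (a * t)) * q t))).

Let P t := expR (- (a * t)) * p t.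
Let Q t := expR (- (a * t)) * q t.
Let P0 t : t <= 0 -> P t = 0. Proof. by move=> t0; rewrite /P p0 ?mulr0. Qed.

Let Q0 t : t <= 0 -> Q t = 0. Proof. by move=> t0; rewrite /Q q0 ?mulr0. Qed.

Let iP : mu.-integrable setT (EFin \o P).
Proof. exact/(Rintegrable_halfline P0). Qed.

Let iQ : mu.-integrable setT (EFin \o Q).
Proof. exact/(Rintegrable_halfline Q0). Qed.

Hypothesis ik : forall t, mu.-integrable setT (EFin \o (fun tau => p (t - tau) * q tau)).

Let convolE t : convol P Q t = expR (- (a * t)) * convol p q t.
Proof.
rewrite /convol -RintegralZl//; apply: eq_Rintegral => tau _.
rewrite /P /Q mulrACA -expRD; congr (expR _ * _); ring.
Qed.

(** Damping by [expR (- (a * t))] commutes with convolution, and the addition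
  formulas of the cosine and the sine reproduce the product of complex numbers. *)
Lemma laplace_convol b :
  laplace (convol p q) (a +i* b) = laplace p (a +i* b) * laplace q (a +i* b).
Proof.
have hl (w f : R -> R) : (forall t, t <= 0 -> f t = 0) ->
    \int[mu]_(t in D) (w t * f t) = \int[mu]_t (w t * f t).
  by move=> f0; apply: Rintegral_halfline => t /f0 ->; rewrite mulr0.
rewrite !laplaceE.
under [X in X +i* _ = _]eq_Rintegral do rewrite -convolE.
under [X in _ +i* X = _]eq_Rintegral do rewrite -convolE.
have C0 t : t <= 0 -> convol P Q t = 0.
  by move=> t0; rewrite convolE convol_eq0// mulr0.
rewrite !(hl _ _ C0) !(hl _ _ P0) !(hl _ _ Q0).
rewrite (Rintegral_convol iP iQ (measurable_wcos b) (wcos_le1 b)).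
rewrite (Rintegral_convol iP iQ (measurable_wsin b) (wsin_le1 b)).
have mT : measurable (setT : set R) by [].
have iPc := Rintegrable_bounded_mul mT (measurable_wcos b) (wcos_le1 b) iP.
have iPs := Rintegrable_bounded_mul mT (measurable_wsin b) (wsin_le1 b) iP.
have iQc := Rintegrable_bounded_mul mT (measurable_wcos b) (wcos_le1 b) iQ.
have iQs := Rintegrable_bounded_mul mT (measurable_wsin b) (wsin_le1 b) iQ.
set Pc := \int[mu]_t (wcos b t * P t); set Ps := \int[mu]_t (wsin b t * P t).
set Qc := \int[mu]_t (wcos b t * Q t); set Qs := \int[mu]_t (wsin b t * Q t).
have innerc tau : \int[mu]_r (wcos b (r + tau) * P r) = wcos b tau * Pc - wsin b tau * Ps.
  rewrite /Pc /Ps -!RintegralZl// -RintegralB//; [|exact: RintegrableZ|exact: RintegrableZ].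
  by apply: eq_Rintegral => r _; rewrite wcosD; ring.
have inners tau : \int[mu]_r (wsin b (r + tau) * P r) = wcos b tau * Ps + wsin b tau * Pc.
  rewrite /Pc /Ps -!RintegralZl// -RintegralD//; [|exact: RintegrableZ|exact: RintegrableZ].
  by apply: eq_Rintegral => r _; rewrite wsinD; ring.
rewrite [RHS]/GRing.mul /=; congr (_ +i* _).
  rewrite /Qc /Qs -!RintegralZl// -RintegralB//; [|exact: RintegrableZ|exact: RintegrableZ].
  by apply: eq_Rintegral => tau _; rewrite innerc; ring.
rewrite /Qc /Qs -!RintegralZl// -RintegralD//; [|exact: RintegrableZ|exact: RintegrableZ].
by apply: eq_Rintegral => tau _; rewrite inners; ring.
Qed.

End convolution.

Lemma eq_laplace (g h : R -> R) (lam : R[i]) : (forall t, 0 < t -> g t = h t) ->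
  laplace g lam = laplace h lam.
Proof.
move=> gh; rewrite /laplace /cintegral; congr (_ +i* _); apply: eq_Rintegral => t;
  by rewrite mem_setE in_itv/= andbT => /gh ->.
Qed.

Lemma laplaceD (g h : R -> R) (lam : R[i]) :
  mu.-integrable D (EFin \o (fun t => expR (- (Re lam * t)) * g t)) ->
  mu.-integrable D (EFin \o (fun t => expR (- (Re lam * t)) * h t)) ->
  laplace (fun t => g t + h t) lam = laplace g lam + laplace h lam.
Proof.
case: lam => a b /= ig ih; have mD : measurable D by exact: measurable_itv.
have igc := Rintegrable_bounded_mul mD (measurable_wcos b) (wcos_le1 b) ig.
have igs := Rintegrable_bounded_mul mD (measurable_wsin b) (wsin_le1 b) ig.
have ihc := Rintegrable_bounded_mul mD (measurable_wcos b) (wcos_le1 b) ih.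
have ihs := Rintegrable_bounded_mul mD (measurable_wsin b) (wsin_le1 b) ih.
rewrite !laplaceE [RHS]/GRing.add /= -!RintegralD//.
by congr (_ +i* _); apply: eq_Rintegral => t _; ring.
Qed.

Lemma laplaceZ (g : R -> R) (c : R) (lam : R[i]) :
  mu.-integrable D (EFin \o (fun t => expR (- (Re lam * t)) * g t)) ->
  laplace (fun t => c * g t) lam = c%:C * laplace g lam.
Proof.
case: lam => a b /= ig; have mD : measurable D by exact: measurable_itv.
have igc := Rintegrable_bounded_mul mD (measurable_wcos b) (wcos_le1 b) ig.
have igs := Rintegrable_bounded_mul mD (measurable_wsin b) (wsin_le1 b) ig.
rewrite !laplaceE [RHS]/GRing.mul /= !mul0r subr0 addr0 -!RintegralZl//.
by congr (_ +i* _); apply: eq_Rintegral => t _; ring.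
Qed.

(** The real arguments suffice. *)
Lemma laplace_ae_unique (g h : R -> R) :
  laplace_transformable g -> laplace_transformable h ->
  (forall lam : R[i], 0 < Re lam -> laplace g lam = laplace h lam) ->
  {ae mu, forall t, 0 < t -> g t = h t}.
Proof.
move=> tg th gh.
have ig a : 0 < a -> mu.-integrable D (EFin \o (fun t => expR (- (a * t)) * g t)).
  by move=> a0; exact: cintegrable_real (tg a%:C a0).
have ih a : 0 < a -> mu.-integrable D (EFin \o (fun t => expR (- (a * t)) * h t)).
  by move=> a0; exact: cintegrable_real (th a%:C a0).
have : {ae mu, forall t, 0 < t -> g t - h t = 0}.
  apply: laplace_unique => a a0.
    have := RintegrableB _ (ig a a0) (ih a a0); move=> /(_ (measurable_itv _)).
    by congr (_.-integrable _ (EFin \o _)); apply/funext => t; rewrite mulrBr.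
  under eq_Rintegral do rewrite mulrBr.
  rewrite (RintegralB _ (ig a a0) (ih a a0)); last exact: measurable_itv.
  by have := gh a%:C a0; rewrite !laplace_realE => -[->]; rewrite subrr.
by apply: filterS; [exact: (ae_filter_ringOfSetsType mu)|] => t e /e /eqP; rewrite subr_eq0 => /eqP.
Qed.

End laplace.

(** * Integrals of complex exponentials *)
Section exponential.
Context {R : realType}.
Local Notation mu := (@lebesgue_measure R).
Local Notation D := (`]0%R, +oo[%classic : set R).
Implicit Types (a b t s : R).

Lemma Rintegral_derive (F f : R -> R) s : 0 <= s ->
  (forall x : R, is_derive x (1 : R) F (f x)) -> continuous f ->
  \int[mu]_(t in `]0, s]) f t = F s - F 0.
Proof.
rewrite le_eqVlt => /predU1P[<- _ _|s0 dF cf].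
  by rewrite set_itv_ge ?bnd_simp// Rintegral_set0 subrr.
rewrite /Rintegral integral_itv_obnd_cbnd; last first.
  by apply/measurable_EFinP; apply: measurable_funTS; exact: continuous_measurable_fun.
have dd x : derivable F x 1 by have h := dF x; exact: ex_derive.
have cc : continuous F.
  by move=> x; apply: differentiable_continuous; apply/derivable1_diffP.
rewrite (@continuous_FTC2 _ f F 0 s)//.
- exact: continuous_subspaceT.
- split; first by move=> x _; exact: dd.
    by apply: cvg_at_right_filter; exact: cc.
  by apply: cvg_at_left_filter; exact: cc.
- by move=> x _; rewrite derive1E; have h := dF x; apply: derive_val.
Qed.

Lemma is_derive_linN (c x : R) : is_derive x (1 : R) (fun t => - (c * t)) (- c).
Proof.
rewrite (_ : (fun t => _) = ( *%R (- c))); last by apply/funext => t; rewrite mulNr.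
by apply: is_derive_eq; rewrite /GRing.scale /= mulr1.
Qed.

Definition ecos a b t : R := expR (- (a * t)) * wcos b t.
Definition esin a b t : R := expR (- (a * t)) * wsin b t.

Lemma is_derive_ecos a b x :
  is_derive x (1 : R) (ecos a b) (- (a * ecos a b x - b * esin a b x)).
Proof.
have d := is_derive_linN a x; have d' := is_derive_linN b x.
by apply: is_derive_eq; rewrite /ecos /esin /wcos /wsin /GRing.scale /=; ring.
Qed.

Lemma is_derive_esin a b x :
  is_derive x (1 : R) (esin a b) (- (a * esin a b x + b * ecos a b x)).
Proof.
have d := is_derive_linN a x; have d' := is_derive_linN b x.
by apply: is_derive_eq; rewrite /ecos /esin /wcos /wsin /GRing.scale /=; ring.
Qed.

Lemma is_derive_continuous (F f : R -> R) :
  (forall x : R, is_derive x (1 : R) F (f x)) -> continuous F.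
Proof.
move=> dF x; apply: differentiable_continuous; apply/derivable1_diffP.
by have h := dF x; exact: ex_derive.
Qed.

Lemma continuous_ecos a b : continuous (ecos a b).
Proof. exact: (is_derive_continuous (is_derive_ecos a b)). Qed.

Lemma continuous_esin a b : continuous (esin a b).
Proof. exact: (is_derive_continuous (is_derive_esin a b)). Qed.

Lemma continuous_integrable_oc (F : R -> R) u s : continuous F ->
  mu.-integrable `]u, s] (EFin \o F).
Proof.
move=> cF.
apply: (@integrableS _ _ _ mu `[u, s]); [exact: measurable_itv|exact: measurable_itv|exact: subset_itv_oc_cc|].
apply: continuous_compact_integrable; first exact: segment_compact.
exact: continuous_subspaceT.
Qed.

(** [lam * \int_0^s expR (- lam t) = 1 - expR (- lam s)], split into real and
  imaginary parts. *)
Lemma Rintegral_ecos_esin a b s : 0 <= s ->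
  a * (\int[mu]_(t in `]0, s]) ecos a b t) - b * (\int[mu]_(t in `]0, s]) esin a b t)
    = 1 - ecos a b s /\
  a * (\int[mu]_(t in `]0, s]) esin a b t) + b * (\int[mu]_(t in `]0, s]) ecos a b t)
    = - esin a b s.
Proof.
move=> s0.
have ic := continuous_integrable_oc 0 s (@continuous_ecos a b).
have is' := continuous_integrable_oc 0 s (@continuous_esin a b).
have mD : measurable (`]0, s]%classic : set R) by exact: measurable_itv.
have c1 : continuous (fun x => - (a * ecos a b x - b * esin a b x)).
  move=> x; apply: cvgN; apply: cvgB; apply: cvgMl_tmp; [exact: continuous_ecos|exact: continuous_esin].
have c2 : continuous (fun x => - (a * esin a b x + b * ecos a b x)).
  move=> x; apply: cvgN; apply: cvgD; apply: cvgMl_tmp; [exact: continuous_esin|exact: continuous_ecos].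
have e1 := Rintegral_derive s0 (is_derive_ecos a b) c1.
have e2 := Rintegral_derive s0 (is_derive_esin a b) c2.
have w0 : ecos a b 0 = 1 by rewrite /ecos /wcos !mulr0 oppr0 expR0 cos0 mulr1.
have w1 : esin a b 0 = 0 by rewrite /esin /wsin !mulr0 oppr0 sin0 mulr0.
have E1 : \int[mu]_(t in `]0, s]) (- (a * ecos a b t - b * esin a b t)) =
    b * (\int[mu]_(t in `]0, s]) esin a b t) - a * (\int[mu]_(t in `]0, s]) ecos a b t).
  rewrite -!RintegralZl// -RintegralB//; [|exact: RintegrableZ|exact: RintegrableZ].
  by apply: eq_Rintegral => t _; ring.
have E2 : \int[mu]_(t in `]0, s]) (- (a * esin a b t + b * ecos a b t)) =
    (- a) * (\int[mu]_(t in `]0, s]) esin a b t) - b * (\int[mu]_(t in `]0, s]) ecos a b t).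
  rewrite -!RintegralZl// -RintegralB//; [|exact: RintegrableZ|exact: RintegrableZ].
  by apply: eq_Rintegral => t _; ring.
by rewrite E1 w0 in e1; rewrite E2 w1 in e2; split; lra.
Qed.

(** The exponential law has total mass [1]. *)
Lemma integral_expRN a : 0 < a ->
  (\int[mu]_(t in D) (expR (- (a * t)))%:E = (a^-1)%:E)%E.
Proof.
move=> a0.
have h := integral_exponential_pdf a0.
have E : (\int[mu]_x (exponential_pdf a x)%:E = \int[mu]_(t in D) (a%:E * (expR (- (a * t)))%:E))%E.
  rewrite integral_itv_obnd_cbnd; last first.
    by apply: measurable_funeM; apply/measurable_EFinP; exact: measurable_expRN.
  rewrite [RHS]integral_mkcond; apply: eq_integral => t _.
  rewrite /exponential_pdf !patchE; case: ifP => // _.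
  by rewrite -EFinM mulNr.
have E2 : (\int[mu]_(t in D) (a%:E * (expR (- (a * t)))%:E) =
    a%:E * \int[mu]_(t in D) (expR (- (a * t)))%:E)%E.
  apply: ge0_integralZl => //.
  - by apply/measurable_EFinP; exact: measurable_expRN.
  - by rewrite lee_fin ltW.
rewrite E E2 in h.
set J := (\int[mu]_(t in D) _)%E in h *.
have J0 : (0 <= J)%E by apply: integral_ge0 => t _; rewrite lee_fin expR_ge0.
clearbody J; move: J J0 h => [J| |] //= J0.
  by rewrite -EFinM => -[h]; congr EFin; rewrite -[RHS]mulr1 -h mulKf// gt_eqF.
by rewrite gt0_muley ?lte_fin.
Qed.

Lemma integrable_expRN a : 0 < a -> mu.-integrable D (EFin \o (fun t => expR (- (a * t)))).
Proof.
move=> a0; apply: ge0_Rintegrable.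
- by move=> t _; exact: expR_ge0.
- exact: measurable_expRN.
- by rewrite integral_expRN// ltry.
Qed.

Lemma cvg_Rintegral_halfline (f : R -> R) : mu.-integrable D (EFin \o f) ->
  (fun n : nat => \int[mu]_(t in `]0, n%:R]) f t) @ \oo --> \int[mu]_(t in D) f t.
Proof.
move=> fi; have mf := Rintegrable_measurable fi.
have mD : measurable D by exact: measurable_itv.
have mn n : measurable (`]0, n%:R]%classic : set R) by exact: measurable_itv.
apply: fine_cvg; rewrite -/(Rintegral mu D f) (RintegralE mD fi).
rewrite (_ : (fun n : nat => (\int[mu]_(t in `]0%R, n%:R]) (f t)%:E)%E) =
   (fun n => \int[mu]_(t in D) ((f \_ `]0, n%:R]) t)%:E)%E); last first.
  apply/funext => n; rewrite integral_mkcond [RHS]integral_mkcond.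
  apply: eq_integral => t _; rewrite !patchE !mem_setE !in_itv/= andbT.
  by case: (0 < t) => //=; case: ifP.
apply: (@dominated_cvg _ _ _ mu D _ _ _ (fun t => `|f t|%:E)) => //.
- move=> n; apply/measurable_EFinP; apply: (measurable_funS (mD)) => //.
  by apply/measurable_restrict => //; apply: measurable_funS mf => //; exact: subIsetl.
- move=> t; rewrite /= in_itv/= andbT => t0; apply: cvg_EFin; first exact: nearW.
  apply: cvg_near_cst; near=> n; rewrite /= patchE mem_setE in_itv/= t0/= ifT//.
  by near: n; exact: nbhs_infty_ger.
- exact: (integrable_norm fi).
- by move=> n t Dt; rewrite patchE; case: ifP => _ //=; rewrite normr0 lee_fin.
Unshelve. all: by end_near. Qed.

End exponential.

(** * The Levy measure and its tail *)
Section levy.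
Local Open Scope complex_scope.
Local Notation Re := complex.Re.
Context {R : realType}.
Local Notation mu := (@lebesgue_measure R).
Local Notation D := (`]0%R, +oo[%classic : set R).
Implicit Types (a b t s : R).

(** Letting [s] tend to infinity in [Rintegral_ecos_esin]. *)
Lemma laplace_heaviside (lam : R[i]) : 0 < Re lam ->
  lam * laplace (@heaviside R) lam = 1.
Proof.
case: lam => a b /= a0; rewrite (@eq_laplace _ _ (fun=> 1)); last exact: heaviside_gt0.
rewrite laplaceE.
have E w : \int[mu]_(t in D) (w t * (expR (- (a * t)) * 1)) = \int[mu]_(t in D) (expR (- (a * t)) * w t).
  by apply: eq_Rintegral => t _; ring.
rewrite !E.
have mD : measurable D by exact: measurable_itv.
have ie := integrable_expRN a0.
have ic : mu.-integrable D (EFin \o ecos a b).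
  have := Rintegrable_bounded_mul mD (measurable_wcos b) (wcos_le1 b) ie.
  by congr (_.-integrable _ (EFin \o _)); apply/funext => t; rewrite /ecos mulrC.
have is' : mu.-integrable D (EFin \o esin a b).
  have := Rintegrable_bounded_mul mD (measurable_wsin b) (wsin_le1 b) ie.
  by congr (_.-integrable _ (EFin \o _)); apply/funext => t; rewrite /esin mulrC.
have cc := cvg_Rintegral_halfline ic; have cs := cvg_Rintegral_halfline is'.
have c0 (f : R -> R) : (forall t, `|f t| <= expR (- (a * t))) -> (fun n : nat => f n%:R) @ \oo --> 0.
  move=> fe; apply/norm_cvg0P.
  have ce : (fun n : nat => expR (- (a * n%:R))) @ \oo --> 0.
    have := @cvg_expr R (expR (- a)).
    rewrite ger0_norm ?expR_ge0// -[X in _ < X]expR0 ltr_expR oppr_lt0 => /(_ a0).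
    apply: cvg_trans; apply: near_eq_cvg; near=> n.
    by rewrite -expRM_natl mulrN mulrC.
  apply: (squeeze_cvgr _ (cvg_cst 0) ce); near=> n.
  by rewrite normr_ge0 fe.
have le w t : `|w| <= 1 -> `|expR (- (a * t)) * w| <= expR (- (a * t)).
  by move=> w1; rewrite normrM ger0_norm ?expR_ge0// ler_piMr// expR_ge0.
have e1 : a * (\int[mu]_(t in D) ecos a b t) - b * (\int[mu]_(t in D) esin a b t) = 1.
  have l1 : (fun n : nat =>
      a * (\int[mu]_(t in `]0, n%:R]) ecos a b t)
      - b * (\int[mu]_(t in `]0, n%:R]) esin a b t)) @ \oo -->
    a * (\int[mu]_(t in D) ecos a b t) - b * (\int[mu]_(t in D) esin a b t).
    by apply: cvgB; apply: cvgMl_tmp.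
  have l2 : (fun n : nat => 1 - ecos a b n%:R) @ \oo --> (1 - 0 : R).
    apply: cvgB; first exact: cvg_cst.
    by apply: c0 => t; apply: le; exact: wcos_le1.
  rewrite subr0 in l2.
  rewrite -(cvg_lim (@Rhausdorff R) l1) -[RHS](cvg_lim (@Rhausdorff R) l2).
  congr (lim (_ @ \oo)); apply/funext => n /=.
  by have [-> _] := Rintegral_ecos_esin a b (ler0n R n).
have e2 : a * (\int[mu]_(t in D) esin a b t) + b * (\int[mu]_(t in D) ecos a b t) = 0.
  have l1 : (fun n : nat =>
      a * (\int[mu]_(t in `]0, n%:R]) esin a b t)
      + b * (\int[mu]_(t in `]0, n%:R]) ecos a b t)) @ \oo -->
    a * (\int[mu]_(t in D) esin a b t) + b * (\int[mu]_(t in D) ecos a b t).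
    by apply: cvgD; apply: cvgMl_tmp.
  have l2 : (fun n : nat => - esin a b n%:R) @ \oo --> (- 0 : R).
    by apply: cvgN; apply: c0 => t; apply: le; exact: wsin_le1.
  rewrite oppr0 in l2.
  rewrite -(cvg_lim (@Rhausdorff R) l1) -[RHS](cvg_lim (@Rhausdorff R) l2).
  congr (lim (_ @ \oo)); apply/funext => n /=.
  by have [_ ->] := Rintegral_ecos_esin a b (ler0n R n).
rewrite /GRing.mul /=; congr (_ +i* _); [exact: e1|exact: e2].
Unshelve. all: by end_near. Qed.

Variable nu : {measure set (measurableTypeR R) -> \bar R}.
Hypothesis Hnu : levy_measure nu.

(** Markov's inequality for the function [Num.min s 1]. *)
Lemma levy_tail_lty t : 0 < t -> (nu `]t, +oo[%classic < +oo)%E.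
Proof.
move=> t0; have [h _] := Hnu.
have m0 : 0 < Num.min t 1 by rewrite lt_min t0 ltr01.
have le : ((Num.min t 1)%:E * nu `]t, +oo[%classic <= \int[nu]_(s in D) (Num.min s 1)%:E)%E.
  have mt : measurable (`]t, +oo[%classic : set (measurableTypeR R)) by exact: measurable_itv.
  rewrite -integral_cst//.
  apply: (@le_trans _ _ (\int[nu]_(s in `]t, +oo[) (Num.min s 1)%:E)%E).
    apply: ge0_le_integral => //.
    - by move=> s _; rewrite lee_fin ltW.
    - by apply/measurable_EFinP; apply: measurable_minr.
    - move=> s; rewrite /= in_itv/= andbT => ts; rewrite lee_fin.
      by rewrite le_min !ge_min lexx orbT andbT (ltW ts).
  apply: ge0_subset_integral => //.
  - by apply/measurable_EFinP; apply: measurable_minr.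
  - move=> s; rewrite /= in_itv/= andbT => s0; rewrite lee_fin le_min ler01 andbT.
    exact: ltW.
  - by apply: subset_itvr; rewrite bnd_simp ltW.
rewrite ltey; apply/eqP => e; move: le; rewrite e gt0_muley ?lte_fin// leye_eq => /eqP e2.
by rewrite e2 in h.
Qed.

Lemma nu_barE t : 0 < t -> nu `]t, +oo[%classic = (nu_bar nu t)%:E.
Proof. by move=> t0; rewrite /nu_bar fineK// ge0_fin_numE// levy_tail_lty. Qed.

Lemma nu_bar_ge0 t : 0 <= nu_bar nu t.
Proof. exact: fine_ge0. Qed.

(** The tail at [0] is infinite, and [fine] sends [+oo] to [0]: in the kernel of the
  non-local derivative the diagonal contributes nothing. *)
Lemma nu_bar0 : nu_bar nu 0 = 0.
Proof. by rewrite /nu_bar; have [_ ->] := Hnu. Qed.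

End levy.

Section levy_fubini.
Local Open Scope complex_scope.
Local Notation Re := complex.Re.
Context {R : realType}.
Local Notation mu := (@lebesgue_measure R).
Local Notation D := (`]0%R, +oo[%classic : set R).
Implicit Types (a b t s : R).

Variable nu : {measure set (measurableTypeR R) -> \bar R}.
Hypothesis Hnu : levy_measure nu.

Let mD : measurable (`]0%R, +oo[%classic : set (measurableTypeR R)).
Proof. exact: measurable_itv. Qed.

(** Fubini's theorem asks for a sigma-finite measure on the whole line, hence the
  restriction of [nu] to the positive half-line. *)
Let N := mrestr nu mD.

Let N_tail t : 0 < t -> N `]t, +oo[%classic = (nu_bar nu t)%:E.
Proof.
move=> t0; rewrite /N /mrestr setIidl ?nu_barE//.
by apply: subset_itvr; rewrite bnd_simp ltW.
Qed.

Let N_sigma_finite : sigma_finite setT N.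
Proof.
exists (fun n : nat => `]-oo, 0%R]%classic `|` `]n.+1%:R^-1, +oo[%classic).
  apply/esym/seteqP; split => // t _.
  have [t0|t0] := leP t 0; first by exists 0%N => //; left; rewrite /= in_itv.
  exists (Num.truncn t^-1) => //; right; rewrite /= in_itv/= andbT.
  rewrite invf_plt ?posrE//; have /andP[_ h] := truncn_itv (ltW (etrans (invr_gt0 t) t0)).
  exact: h.
move=> n; split.
  by apply: measurableU; exact: measurable_itv.
apply: (@le_lt_trans _ _ (N `]-oo, 0%R]%classic + N `](n.+1%:R^-1)%R, +oo[%classic)%E).
  by apply: measureU2; exact: measurable_itv.
rewrite N_tail ?invr_gt0// [X in (X + _)%E](_ : _ = 0%E) ?add0e ?ltry//.
rewrite /N /mrestr (_ : _ `&` _ = set0) ?measure0//.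
apply/seteqP; split => // t [] /=; rewrite !in_itv/= andbT => h1 h2.
by move: (lt_le_trans h2 h1); rewrite ltxx.
Qed.

#[local] HB.instance Definition _ := Measure.on N.
#[local] HB.instance Definition _ := Measure_isSigmaFinite.Build _ _ _ N N_sigma_finite.

Let Ns : {sigma_finite_measure set (measurableTypeR R) -> \bar R} :=
  [the {sigma_finite_measure set _ -> \bar R} of N].

Let integral_N (f : R -> \bar R) : (forall s, s <= 0 -> f s = 0%E) ->
  (\int[Ns]_s f s = \int[nu]_(s in D) f s)%E.
Proof.
move=> f0; transitivity (\int[Ns]_(s in D) f s)%E.
  rewrite [RHS]integral_mkcond; apply: eq_integral => s _.
  by rewrite patchE mem_setE in_itv/= andbT; case: ltP => // /f0.
apply: eq_measure_integral => A mA AD.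
by rewrite /Ns /= /N /mrestr setIidl.
Qed.

Section kernel.
Variables (a : R) (w : R -> R).
Hypotheses (a0 : 0 < a) (mw : measurable_fun setT w) (w1 : forall t, `|w t| <= 1).

(** The integrand [w t * expR (- (a * t))] on the domain [0 < t < s], at
  [z = (s, t)]. *)
Let f (z : measurableTypeR R * measurableTypeR R) : R :=
  heaviside (z.1 - z.2) * (heaviside z.2 * (w z.2 * expR (- (a * z.2)))).

Let mf : measurable_fun setT f.
Proof.
have m2 : measurable_fun setT (fun t : R => heaviside t * (w t * expR (- (a * t)))).
  apply: measurable_funM; first exact: measurable_heaviside.
  by apply: measurable_funM => //; exact: measurable_expRN.
apply: measurable_funM.
  exact: (measurableT_comp measurable_heaviside (@measurable_diff R)).
exact: (measurableT_comp m2 measurable_snd).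
Qed.

Let if1 s : mu.-integrable `]0, s] (EFin \o (fun t => w t * expR (- (a * t)))).
Proof.
have mDs : measurable (`]0, s]%classic : set R) by exact: measurable_itv.
apply: Rintegrable_bounded_mul => //.
apply: (@integrableS _ _ _ mu D); [exact: measurable_itv|exact: measurable_itv| |exact: integrable_expRN].
exact: subset_itvl.
Qed.

Let section1 s : 0 < s -> (\int[mu]_t (f (s, t))%:E =
  (\int[mu]_(t in `]0%R, s]) (w t * expR (- (a * t)))%R)%:E)%E.
Proof.
move=> s0; have mDs : measurable (`]0, s]%classic : set R) by exact: measurable_itv.
rewrite (RintegralE mDs (if1 s)).
rewrite -integral_itv_bndo_bndc; last first.
  apply: measurable_funS (integrable_measurable (if1 s)); first exact: measurable_itv.
  exact: subset_itv_oo_oc.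
rewrite [RHS]integral_mkcond; apply: eq_integral => t _.
rewrite patchE mem_setE in_itv/= /f /= /heaviside subr_gt0.
by case: (0 < t); case: (t < s); rewrite /= ?mul0r ?mul1r.
Qed.

Let f_le0 s t : s <= 0 -> f (s, t) = 0.
Proof.
move=> s0; rewrite /f /= /heaviside subr_gt0.
case: (ltP 0 t) => t0; last by rewrite mul0r mulr0.
by rewrite ltNge (le_trans s0 (ltW t0)) mul0r.
Qed.

(** The left-hand side is the integral of [expR (- (a * t))] over [0 < t < s]; the
  bound is what the condition on a Levy measure makes integrable in [s]. *)
Let expo_bound s : 0 < s -> (1 - expR (- (a * s))) / a <= Num.max 1 a^-1 * Num.min s 1.
Proof.
move=> s0; rewrite ler_pdivrMr//.
have e1 : 1 - expR (- (a * s)) <= a * s by have := expR_ge1Dx (- (a * s)); lra.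
have e2 : 1 - expR (- (a * s)) <= 1 by have := expR_ge0 (- (a * s)); lra.
have m1 : 1 <= Num.max 1 a^-1 by rewrite le_max lexx.
have m2 : 1 <= Num.max 1 a^-1 * a.
  rewrite -[leLHS](mulVf (lt0r_neq0 a0)) ler_wpM2r//; first exact: ltW.
  by rewrite le_max lexx orbT.
case: (leP s 1) => s1; last by rewrite mulr1; lra.
by apply: (le_trans e1); rewrite -mulrA [s * a]mulrC ler_peMl // mulr_ge0 // ltW.
Qed.

Let section1_le s : (\int[mu]_t `|(f (s, t))%:E| <=
  ((Num.max 1 a^-1) * (heaviside s * Num.min s 1))%:E)%E.
Proof.
have [s0|s0] := leP s 0.
  rewrite heaviside_le0// mul0r mulr0.
  by rewrite integral0_eq// => t _; rewrite f_le0//= normr0.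
rewrite heaviside_gt0// mul1r.
have mDs : measurable (`]0, s]%classic : set R) by exact: measurable_itv.
have ie : mu.-integrable `]0, s] (EFin \o (fun t => expR (- (a * t)))).
  apply: (@integrableS _ _ _ mu D); [exact: measurable_itv|exact: measurable_itv| |exact: integrable_expRN].
  exact: subset_itvl.
apply: (@le_trans _ _ (\int[mu]_(t in `]0%R, s]) (expR (- (a * t)))%:E)%E).
  rewrite [leRHS]integral_mkcond; apply: ge0_le_integral => //.
  - apply/measurable_EFinP; apply: measurableT_comp => //.
    exact: (measurableT_comp mf (pair1_measurable s)).
  - by apply/(measurable_restrictT _ mDs); exact: integrable_measurable ie.
  - move=> t _; rewrite patchE mem_setE in_itv/= /f /= /heaviside subr_gt0.
    case: (ltP 0 t) => t0; rewrite /= ?mul0r ?mulr0 ?normr0 ?lexx//.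
    case: (ltP t s) => ts; rewrite /= ?mul0r ?mul1r ?normr0.
      by rewrite (ltW ts) lee_fin normrM [`|expR _|]ger0_norm ?expR_ge0// ler_piMl ?expR_ge0.
    by case: ifP; rewrite // lee_fin expR_ge0.
rewrite -(RintegralE mDs ie) lee_fin.
have [h _] := Rintegral_ecos_esin a 0 (ltW s0).
have E : ecos a 0 = (fun t => expR (- (a * t))).
  by apply/funext => t; rewrite /ecos /wcos mul0r oppr0 cos0 mulr1.
rewrite mul0r subr0 !E in h.
by apply: le_trans (expo_bound s0); rewrite -h mulrAC mulfV ?mul1r// gt_eqF.
Qed.

Let integrable_min : nu.-integrable D (EFin \o (fun s => Num.min s 1)).
Proof.
have [h _] := Hnu.
apply/integrableP; split; first by apply/measurable_EFinP; apply: measurable_minr.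
apply: le_lt_trans h; rewrite le_eqVlt; apply/orP; left; apply/eqP.
apply: eq_integral => s; rewrite mem_setE in_itv/= andbT => s0.
by rewrite ger0_norm// le_min ler01 ltW.
Qed.

Let integrable_f : (Ns \x mu)%E.-integrable setT (EFin \o f).
Proof.
apply/integrable12ltyP; first exact/measurable_EFinP.
apply: (@le_lt_trans _ _ (\int[Ns]_s ((Num.max 1 a^-1) * (heaviside s * Num.min s 1))%:E)%E).
  apply: ge0_le_integral => //.
  - by move=> s _; apply: integral_ge0.
  - apply: (measurable_fun_fubini_tonelli_F (fun z => `|(f z)%:E|%E)) => //.
    by apply: measurableT_comp => //; exact/measurable_EFinP.
  - apply/measurable_EFinP; apply: measurable_funM => //.
    by apply: measurable_funM; [exact: measurable_heaviside|apply: measurable_minr].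
  - by move=> s _; exact: section1_le.
have h0 s : s <= 0 -> ((Num.max 1 a^-1) * (heaviside s * Num.min s 1))%:E = 0%E.
  by move=> s0; rewrite heaviside_le0// mul0r mulr0.
have -> : (\int[Ns]_s ((Num.max 1 a^-1) * (heaviside s * Num.min s 1))%:E =
  \int[nu]_(s in D) ((Num.max 1 a^-1)%:E * (Num.min s 1)%:E))%E.
  rewrite [LHS](integral_N h0).
  apply: eq_integral => s; rewrite mem_setE in_itv/= andbT => s0.
  by rewrite heaviside_gt0// mul1r EFinM.
rewrite integralZl//.
by have [h _] := Hnu; rewrite lte_mul_pinfty// lee_fin le_max ler01.
Qed.

Let section2 t : 0 < t -> (\int[Ns]_s (f (s, t))%:E =
  (w t * (expR (- (a * t)) * nu_bar nu t))%:E)%E.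
Proof.
move=> t0.
have mt : measurable (`]t, +oo[%classic : set (measurableTypeR R)) by exact: measurable_itv.
transitivity (\int[Ns]_s ((w t * expR (- (a * t)))%:E * (\1_(`]t, +oo[%classic : set R) s)%:E))%E.
  apply: eq_integral => s _; rewrite /f /= /heaviside subr_gt0 t0 mul1r -EFinM mulrC.
  by rewrite indicE mem_setE in_itv/= andbT.
rewrite integralZl//; last first.
  apply/integrableP; split; first by apply/measurable_EFinP; exact: measurable_indic.
  rewrite (_ : (fun s => _) = (fun s => (\1_(`]t, +oo[%classic : set R) s)%:E)).
    by rewrite integral_indic// setIT [ltLHS](N_tail t0) ltry.
  by apply/funext => s /=; rewrite ger0_norm.
by rewrite integral_indic// setIT [X in (_ * X)%E](N_tail t0) -EFinM mulrA.
Qed.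

Let section2_le0 t : t <= 0 -> (\int[Ns]_s (f (s, t))%:E = 0)%E.
Proof.
move=> t0; rewrite integral0_eq// => s _.
by rewrite /f /= (heaviside_le0 t0) mul0r mulr0.
Qed.

(** Fubini's theorem on the domain [0 < t < s]: for fixed [t] the jumps [s > t] have
  the mass [nu_bar nu t]. *)
Lemma levy_Fubini :
  [/\ nu.-integrable D (EFin \o (fun s => \int[mu]_(t in `]0, s]) (w t * expR (- (a * t))))),
   mu.-integrable D (EFin \o (fun t => w t * (expR (- (a * t)) * nu_bar nu t))) &
   \int[nu]_(s in D) (\int[mu]_(t in `]0, s]) (w t * expR (- (a * t)))) =
   \int[mu]_(t in D) (w t * (expR (- (a * t)) * nu_bar nu t))].
Proof.
have iF := integrable_fubini_F integrable_f.
have mG := measurable_fubini_G integrable_f.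
have iG : mu.-integrable setT (fubini_G Ns (EFin \o f)).
  apply/integrableP; split => //.
  have mfE : measurable_fun setT (EFin \o f) by apply/measurable_EFinP.
  apply: le_lt_trans ((@integrable21ltyP _ _ _ _ R Ns mu _ mfE).1 integrable_f).
  apply: ge0_le_integral => //.
  - exact: measurableT_comp.
  - apply: (measurable_fun_fubini_tonelli_G (fun z => `|(EFin \o f) z|%E)) => //.
    exact: measurableT_comp.
  - move=> t _; apply: le_abse_integral => //.
    exact: (measurableT_comp mfE (pair2_measurable t)).
have mDR : measurable D by exact: measurable_itv.
split.
- apply/integrableP; split.
    apply: (@eq_measurable_fun _ _ _ _ _ (fubini_F mu (EFin \o f))).
      by move=> s; rewrite mem_setE in_itv/= andbT => s0; exact: section1.
    by apply: (measurable_funS measurableT) => //; exact: measurable_int iF.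
  have /integrableP[_] := iF.
  rewrite integral_N; last first.
    by move=> s s0; rewrite /fubini_F integral0_eq ?abse0// => t _; rewrite /= f_le0.
  apply: le_lt_trans; rewrite le_eqVlt; apply/orP; left; apply/eqP.
  apply: eq_integral => s; rewrite mem_setE in_itv/= andbT => s0.
  by rewrite /fubini_F section1.
- have i1 : mu.-integrable D (fubini_G Ns (EFin \o f)).
    by apply: integrableS iG => //.
  apply: eq_integrable i1 => // t; rewrite mem_setE in_itv/= andbT => t0.
  exact: section2.
- congr fine.
  transitivity (\int[Ns]_s fubini_F mu (EFin \o f) s)%E.
    rewrite [RHS]integral_N; last first.
      by move=> s s0; rewrite /fubini_F integral0_eq// => t _; rewrite /= f_le0.
    apply: eq_integral => s; rewrite mem_setE in_itv/= andbT => s0.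
    by rewrite /fubini_F section1.
  rewrite (Fubini integrable_f) [RHS]integral_mkcond; apply: eq_integral => t _.
  rewrite patchE mem_setE in_itv/= andbT; case: (ltP 0 t) => t0.
    exact: section2.
  exact: section2_le0.
Qed.

End kernel.

Lemma integrable_nu_bar a : 0 < a ->
  mu.-integrable D (EFin \o (fun t => expR (- (a * t)) * nu_bar nu t)).
Proof.
move=> a0; have n1 (t : R) : `|cst (1 : R) t| <= 1 by rewrite /= normr1.
have [_ + _] := levy_Fubini a0 (@measurable_cst _ _ _ _ setT (1 : R)) n1.
by congr (_.-integrable _ (EFin \o _)); apply/funext => t; rewrite /= mul1r.
Qed.

(** Measurability is a part of the integrability given by Fubini's theorem. *)
Lemma measurable_nu_bar : measurable_fun D (nu_bar nu).
Proof.
have mD' : measurable D by exact: measurable_itv.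
have m1 := Rintegrable_measurable (integrable_nu_bar ltr01).
apply: (@eq_measurable_fun _ _ _ _ _ (fun t => expR t * (expR (- (1 * t)) * nu_bar nu t))).
  by move=> t _; rewrite mulrA mul1r -expRD subrr expR0 mul1r.
by apply: measurable_funM => //; apply: measurable_funTS; exact: measurable_expR.
Qed.

Let nuRintegrableZ (k : R) (g : R -> R) : nu.-integrable D (EFin \o g) ->
  nu.-integrable D (EFin \o (fun t => k * g t)).
Proof.
by move=> gi; apply: eq_integrable (integrableZl _ k gi) => // t _ /=; rewrite EFinM.
Qed.

(** [1 - exp (- lam s)] is the integral of [lam * exp (- lam t)] over [0 < t < s]. *)
Lemma Phi_laplace (lam : R[i]) : 0 < Re lam -> Phi nu lam = lam * laplace (nu_bar nu) lam.
Proof.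
case: lam => a b /= a0.
have [ic _ ec] := levy_Fubini a0 (measurable_wcos b) (wcos_le1 b).
have [is' _ es] := levy_Fubini a0 (measurable_wsin b) (wsin_le1 b).
have mD' : measurable (D : set (measurableTypeR R)) by exact: measurable_itv.
rewrite laplaceE -ec -es /Phi /cintegral.
have cM (u v x y : R) : (u +i* v) * (x +i* y) = (u * x - v * y) +i* (u * y + v * x) by [].
rewrite cM.
have cE t : wcos b t * expR (- (a * t)) = ecos a b t by rewrite mulrC.
have sE t : wsin b t * expR (- (a * t)) = esin a b t by rewrite mulrC.
have E s : 0 < s -> 1 - cexp (- (s%:C * (a +i* b))) =
  (a * (\int[mu]_(t in `]0, s]) (wcos b t * expR (- (a * t)))) -
   b * (\int[mu]_(t in `]0, s]) (wsin b t * expR (- (a * t))))) +i*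
  (a * (\int[mu]_(t in `]0, s]) (wsin b t * expR (- (a * t)))) +
   b * (\int[mu]_(t in `]0, s]) (wcos b t * expR (- (a * t))))).
  move=> s0; have [e1 e2] := Rintegral_ecos_esin a b (ltW s0).
  have -> : \int[mu]_(t in `]0, s]) (wcos b t * expR (- (a * t))) = \int[mu]_(t in `]0, s]) ecos a b t.
    by apply: eq_Rintegral => t _; rewrite cE.
  have -> : \int[mu]_(t in `]0, s]) (wsin b t * expR (- (a * t))) = \int[mu]_(t in `]0, s]) esin a b t.
    by apply: eq_Rintegral => t _; rewrite sE.
  rewrite e1 e2 (_ : - (s%:C * (a +i* b)) = (- (a * s)) +i* (- (b * s))); last first.
    by simpc; rewrite mulrC [s * b]mulrC.
  by rewrite /cexp /=; simpc.
congr (_ +i* _).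
  rewrite -!RintegralZl// -RintegralB//; [|exact: nuRintegrableZ|exact: nuRintegrableZ].
  by apply: eq_Rintegral => s /set_mem Ds; rewrite E//; move: Ds; rewrite /= in_itv/= andbT.
rewrite -!RintegralZl// -RintegralD//; [|exact: nuRintegrableZ|exact: nuRintegrableZ].
by apply: eq_Rintegral => s /set_mem Ds; rewrite E//; move: Ds; rewrite /= in_itv/= andbT.
Qed.

End levy_fubini.

(** * The subordinator and the mean of its inverse *)
Section joint_measurability.
Context {R : realType}.

(** The next point of the grid of mesh [n.+1%:R^-1], strictly to the right of
  [Num.max t 0] since limits from the right do not see the point itself. *)
Definition right_grid (n : nat) (t : R) : R :=
  (Num.truncn (Num.max t 0 * n.+1%:R)).+1%:R / n.+1%:R.

Lemma right_grid_gt n t : Num.max t 0 < right_grid n t.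
Proof. by rewrite /right_grid ltr_pdivlMr// truncnS_gt. Qed.

Lemma right_grid_le n t : right_grid n t <= Num.max t 0 + n.+1%:R^-1.
Proof.
have m0 : 0 <= Num.max t 0 * n.+1%:R by rewrite mulr_ge0// le_max lexx orbT.
rewrite /right_grid ler_pdivrMr// mulrDl mulVf// -natr1 lerD2r.
by have /andP[] := truncn_itv m0.
Qed.

Lemma cvg_right_grid t : (fun n => right_grid n t) @ \oo --> Num.max t 0.
Proof.
have c : (fun n : nat => Num.max t 0 + n.+1%:R^-1) @ \oo --> Num.max t 0 + 0.
  apply: cvgD; first exact: cvg_cst.
  exact: cvg_harmonic.
rewrite addr0 in c; apply: (squeeze_cvgr _ (cvg_cst _) c).
by near=> n; rewrite right_grid_le ltW// right_grid_gt.
Unshelve. all: by end_near. Qed.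

(** Such a function is the limit of functions which depend on their second variable
  through a countable grid only. *)
Lemma measurable_right_continuous (G : R -> R -> R) :
  (forall t, measurable_fun setT (G^~ t)) -> (forall s t, G s @ t^'+ --> G s t) ->
  measurable_fun [set: measurableTypeR R * measurableTypeR R]
    (fun z => G z.1 (Num.max z.2 0)).
Proof.
move=> mG rG.
pose h n (z : measurableTypeR R * measurableTypeR R) := G z.1 (right_grid n z.2).
apply: (@measurable_fun_cvg _ _ R setT h); last first.
  move=> z _; have /cvg_at_rightP := rG z.1 (Num.max z.2 0); apply; split.
    by move=> n; exact: right_grid_gt.
  exact: cvg_right_grid.
move=> n.
have mu2 : measurable_fun setT (fun t : R => Num.max t 0 * n.+1%:R).
  by apply: measurable_funM => //; exact: measurable_maxr.
pose A k := (snd : measurableTypeR R * measurableTypeR R -> measurableTypeR R) @^-1`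
  [set t : R | Num.truncn (Num.max t 0 * n.+1%:R) = k].
have mA k : measurable (A k).
  rewrite -[A k]setTI; apply: (@measurable_snd _ _ (measurableTypeR R) (measurableTypeR R)) => //.
  rewrite -[X in measurable X]setTI.
  exact: (mu2 measurableT _ (measurable_truncn_eq k)).
have -> : setT = \bigcup_k A k.
  by apply/esym/seteqP; split => // z _; exists (Num.truncn (Num.max z.2 0 * n.+1%:R)).
apply/(measurable_fun_bigcup _ _).2 => // k.
apply: (@eq_measurable_fun _ _ _ _ (A k) (fun z => G z.1 (k.+1%:R / n.+1%:R))).
  by move=> z /set_mem zk; rewrite /h /right_grid zk.
apply: (measurable_funS measurableT) => //.
exact: (measurableT_comp (mG _) measurable_fst).
Qed.

End joint_measurability.

Section subordinator.
Local Open Scope complex_scope.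
Local Notation Re := complex.Re.
Context {R : realType} (d : measure_display) (T : measurableType d).
Variables (P : probability T R) (nu : {measure set (measurableTypeR R) -> \bar R}).
Variable sigma : R -> T -> R.
Hypotheses (Hnu : levy_measure nu) (Hsigma : is_subordinator P nu sigma).
Local Notation mu := (@lebesgue_measure R).
Local Notation D := (`]0%R, +oo[%classic : set R).
Implicit Types (a s t : R).

Lemma measurable_sigma s : 0 <= s -> measurable_fun setT (sigma s).
Proof. by move=> s0; have [+ _ _ _ _] := Hsigma; apply. Qed.

Lemma sigma_nd s t w : 0 <= s -> s <= t -> sigma s w <= sigma t w.
Proof. by have [_ /(_ w)[_ + _] _ _ _] := Hsigma; apply. Qed.

Lemma sigma_ge0 s w : 0 <= s -> 0 <= sigma s w.
Proof.
by move=> s0; have [_ /(_ w)[<- _ _] _ _ _] := Hsigma; exact: sigma_nd.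
Qed.

Lemma sigma_laplace s a : 0 <= s -> 0 < a ->
  (\int[P]_w (expR (- (a * sigma s w)))%:E = (expR (- (s * bernstein nu a)))%:E)%E.
Proof.
move=> s0 a0; have [_ _ _ _ h] := Hsigma.
by rewrite -(h s a s0 a0) unlock.
Qed.

(** Being constant for [s <= 0] keeps it monotone in [s], hence measurable, on the
  whole line. *)
Definition sigma_cdf s t : R := fine (P [set w | sigma (Num.max s 0) w <= t]).

Let max0 s : 0 <= Num.max s 0. Proof. by rewrite le_max lexx orbT. Qed.

Lemma measurable_sigma_le s t : 0 <= s -> measurable [set w | sigma s w <= t].
Proof.
move=> s0; rewrite (_ : [set _ | _] = setT `&` sigma s @^-1` `]-oo, t]).
  by apply: (measurable_sigma s0) => //; exact: measurable_itv.
by rewrite setTI; apply/seteqP; split => w /=; rewrite in_itv.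
Qed.

Lemma sigma_cdfE s t : (sigma_cdf s t)%:E = P [set w | sigma (Num.max s 0) w <= t].
Proof. by rewrite /sigma_cdf fineK// fin_num_measure//; exact: measurable_sigma_le. Qed.

Lemma sigma_cdf_ge0 s t : 0 <= sigma_cdf s t.
Proof. exact: fine_ge0. Qed.

Lemma sigma_cdf_nondecreasing s t t' : t <= t' -> sigma_cdf s t <= sigma_cdf s t'.
Proof.
move=> tt'; rewrite -lee_fin !sigma_cdfE; apply: le_measure; rewrite ?inE; try exact: measurable_sigma_le.
by move=> w /= /le_trans; apply.
Qed.

Lemma sigma_cdf_nonincreasing s s' t : s <= s' -> sigma_cdf s' t <= sigma_cdf s t.
Proof.
move=> ss'; rewrite -lee_fin !sigma_cdfE; apply: le_measure; rewrite ?inE; try exact: measurable_sigma_le.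
by move=> w /=; apply: le_trans; apply: sigma_nd => //; rewrite ge_max !le_max ss' lexx /= orbT.
Qed.

Lemma sigma_cdf_right_continuous s t : sigma_cdf s @ t^'+ --> sigma_cdf s t.
Proof.
pose X : {RV P >-> R} := HB.pack (sigma (Num.max s 0))
  (isMeasurableFun.Build _ _ _ _ _ (measurable_sigma (max0 s))).
have h := @cdf_right_continuous _ _ _ P X t.
have E u : cdf X u = (sigma_cdf s u)%:E.
  rewrite sigma_cdfE (_ : [set w | _] = sigma (Num.max s 0) @^-1` `]-oo, u])//.
have EX : cdf X = EFin \o sigma_cdf s by apply/funext.
rewrite EX in h.
exact: (fine_cvg h).
Qed.

Lemma measurable_sigma_cdf :
  measurable_fun [set: measurableTypeR R * measurableTypeR R]
    (fun z => sigma_cdf z.1 (Num.max z.2 0)).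
Proof.
apply: measurable_right_continuous; last exact: sigma_cdf_right_continuous.
by move=> t; apply: nonincreasing_measurable => // s s'; exact: sigma_cdf_nonincreasing.
Qed.

Lemma integral_expRN_tail a c : 0 < a -> 0 <= c ->
  (\int[mu]_(t in D) (expR (- (a * t)) * (c <= t)%R%:R)%:E = (expR (- (a * c)) / a)%:E)%E.
Proof.
move=> a0 c0.
have mDR : measurable D by exact: measurable_itv.
have me : measurable_fun setT (fun t : R => expR (- (a * t))) by exact: measurable_expRN.
have mle : measurable_fun setT (fun t : R => (c <= t)%R%:R : R).
  rewrite (_ : (fun t => _) = \1_(`[c, +oo[%classic : set R)).
    by apply: measurable_indic; exact: measurable_itv.
  by apply/funext => t; rewrite indicE mem_setE in_itv/= andbT.
have mh : measurable_fun setT (fun t : R => heaviside (t - c)).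
  exact: (measurableT_comp measurable_heaviside (measurable_shift (- c))).
transitivity (\int[mu]_t (expR (- (a * t)) * heaviside (t - c))%:E)%E.
  rewrite integral_mkcond; apply: ge0_ae_eq_integral => //.
  - apply/(measurable_restrictT _ mDR).
    apply: measurable_funTS; apply/measurable_EFinP; exact: measurable_funM.
  - by apply/measurable_EFinP; exact: measurable_funM.
  - move=> t _; rewrite patchE; case: ifP => // _.
  - by move=> t _; rewrite lee_fin mulr_ge0// ?expR_ge0// heaviside_ge0.
  - have := ae_neq c; apply: filterS; first exact: (ae_filter_ringOfSetsType mu).
    move=> t tc _.
    have ct' : (c < t) = (c <= t) by rewrite lt_neqAle eq_sym tc.
    rewrite patchE mem_setE in_itv/= andbT /heaviside subr_gt0 ct'.
    case: (ltP 0 t) => // t0; case: leP => ct; rewrite ?mulr0//.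
    by move: tc; rewrite eq_le ct (le_trans t0 c0).
rewrite -(ge0_integral_shift c); first last.
- by move=> t; rewrite lee_fin mulr_ge0// ?expR_ge0// heaviside_ge0.
- by apply/measurable_EFinP; exact: measurable_funM.
transitivity (\int[mu]_(t in D) ((expR (- (a * c)))%:E * (expR (- (a * t)))%:E))%E.
  rewrite [RHS]integral_mkcond; apply: eq_integral => t _.
  rewrite patchE mem_setE in_itv/= andbT addrK /heaviside; case: (0 < t) => /=.
    by rewrite mulr1 -EFinM -expRD mulrDr opprD addrC.
  by rewrite mulr0.
rewrite ge0_integralZl//.
- by rewrite integral_expRN// -EFinM.
- by apply/measurable_EFinP; exact: measurable_expRN.
Qed.

(** Tonelli's theorem on the event [sigma s w <= t], which for fixed [w] is a
  half-line in [t]. *)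
Lemma laplace_sigma_cdf a s : 0 < a -> 0 <= s ->
  (\int[mu]_(t in D) (expR (- (a * t)) * sigma_cdf s t)%:E =
   (expR (- (s * bernstein nu a)) / a)%:E)%E.
Proof.
move=> a0 s0.
have mDR : measurable D by exact: measurable_itv.
have mD' : measurable (`]0%R, +oo[%classic : set (measurableTypeR R)) by exact: measurable_itv.
pose F (z : measurableTypeR R * T) : R := heaviside z.1 * (expR (- (a * z.1)) * (sigma s z.2 <= z.1)%R%:R).
have mF : measurable_fun setT F.
  apply: measurable_funM; first exact: (measurableT_comp measurable_heaviside measurable_fst).
  apply: measurable_funM.
    exact: (measurableT_comp (@measurable_expRN R a setT) measurable_fst).
  have mdiff : measurable_fun setT (fun z : measurableTypeR R * T => z.1 - sigma s z.2).
    apply: measurable_funB => //.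
    exact: (measurableT_comp (measurable_sigma s0) measurable_snd).
  have m1 : measurable_fun setT (fun u : R => (0 <= u)%R%:R : R).
    rewrite (_ : (fun t => _) = \1_(`[0, +oo[%classic : set R)).
      by apply: measurable_indic; exact: measurable_itv.
    by apply/funext => t; rewrite indicE mem_setE in_itv/= andbT.
  rewrite (_ : (fun z => _) = (fun u : R => (0 <= u)%R%:R : R) \o
    (fun z : measurableTypeR R * T => z.1 - sigma s z.2)).
    exact: (measurableT_comp m1 mdiff).
  by apply/funext => z /=; rewrite subr_ge0.
have F0 z : 0 <= F z by rewrite /F !mulr_ge0// ?heaviside_ge0// expR_ge0.
transitivity (\int[mu]_t \int[P]_w (F (t, w))%:E)%E.
  rewrite integral_mkcond; apply: eq_integral => t _.
  rewrite patchE mem_setE in_itv/= andbT; case: (ltP 0 t) => t0; last first.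
    by rewrite integral0_eq// => w _; rewrite /F /= (heaviside_le0 t0) mul0r.
  rewrite EFinM sigma_cdfE max_l//.
  transitivity (\int[P]_w ((expR (- (a * t)))%:E * (\1_[set w | sigma s w <= t] w)%:E))%E; last first.
    apply: eq_integral => w _; rewrite /F /= heaviside_gt0// mul1r EFinM.
    by rewrite indicE mem_setE.
  have ms : measurable [set w | sigma s w <= t] by exact: measurable_sigma_le.
  rewrite ge0_integralZl//.
  - by rewrite integral_indic// setIT.
  - by apply/measurable_EFinP; exact: measurable_indic.
rewrite (@fubini_tonelli _ _ _ _ R mu P (EFin \o F)); first last.
- by move=> z; rewrite lee_fin.
- exact/measurable_EFinP.
transitivity (\int[P]_w ((expR (- (a * sigma s w)))%:E * (a^-1)%:E))%E.
  apply: eq_integral => w _; rewrite -EFinM -integral_expRN_tail//; last exact: sigma_ge0.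
  rewrite [RHS]integral_mkcond; apply: eq_integral => t _.
  rewrite patchE mem_setE in_itv/= andbT /F /= /heaviside.
  by case: (0 < t); rewrite ?mul1r ?mul0r.
rewrite ge0_integralZr//.
- by rewrite sigma_laplace// -EFinM.
- apply/measurable_EFinP; exact: (measurableT_comp (@measurable_expRN R a setT) (measurable_sigma s0)).
- by rewrite lee_fin invr_ge0 ltW.
Qed.

(** The mean of the inverse at time [t] by the layer-cake formula, since up to null
  events the inverse exceeds [s] when [sigma s <= t]. *)
Definition mean_inverse t : \bar R := (\int[mu]_(s in D) (sigma_cdf s t)%:E)%E.

Lemma bernstein_laplace a : 0 < a ->
  bernstein nu a = a * \int[mu]_(t in D) (expR (- (a * t)) * nu_bar nu t).
Proof.
move=> a0; have := @Phi_laplace R nu Hnu a%:C a0.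
rewrite laplace_realE => /(congr1 (@complex.Re R)).
rewrite /= mul0r subr0 => <-; apply: eq_Rintegral => s _ /=.
by rewrite !mulr0 !mul0r ?subr0 ?addr0 ?oppr0 cos0 mulr1.
Qed.

Lemma Rintegral_expRN a s : 0 < a -> 0 <= s ->
  \int[mu]_(t in `]0, s]) expR (- (a * t)) = (1 - expR (- (a * s))) / a.
Proof.
move=> a0 s0; have [h _] := Rintegral_ecos_esin a 0 s0.
have E : ecos a 0 = (fun t => expR (- (a * t))).
  by apply/funext => t; rewrite /ecos /wcos mul0r oppr0 cos0 mulr1.
rewrite mul0r subr0 !E in h.
by rewrite -h mulrAC mulfV ?mul1r// gt_eqF.
Qed.

(** [bernstein nu a] is the integral of a positive function against a measure which
  is not zero. *)
Lemma bernstein_gt0 a : 0 < a -> 0 < bernstein nu a.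
Proof.
move=> a0.
have mD' : measurable (`]0%R, +oo[%classic : set (measurableTypeR R)) by exact: measurable_itv.
have n1 (t : R) : `|cst (1 : R) t| <= 1 by rewrite /= normr1.
have [i _ e] := levy_Fubini Hnu a0 (@measurable_cst _ _ _ _ setT (1 : R)) n1.
pose h s := \int[mu]_(t in `]0, s]) (cst (1 : R) t * expR (- (a * t))).
have h0 s : D s -> 0 < h s.
  rewrite /= in_itv/= andbT => s0; rewrite /h.
  under eq_Rintegral do rewrite mul1r.
  rewrite Rintegral_expRN// ?ltW// divr_gt0// subr_gt0 -[ltRHS]expR0 ltr_expR oppr_lt0.
  exact: mulr_gt0.
rewrite bernstein_laplace// mulr_gt0//.
have -> : \int[mu]_(t in D) (expR (- (a * t)) * nu_bar nu t) = \int[nu]_(s in D) h s.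
  by rewrite /h e; apply: eq_Rintegral => t _; rewrite mul1r.
rewrite lt_neqAle Rintegral_ge0 ?andbT; last by move=> s /h0/ltW.
apply/negP => /eqP/esym b0.
have b1 : (\int[nu]_(s in D) `|(h s)%:E| = 0)%E.
  rewrite (_ : integral _ _ _ = \int[nu]_(s in D) (h s)%:E)%E; last first.
    by apply: eq_integral => s /set_mem Ds; rewrite gee0_abs// lee_fin ltW// h0.
  rewrite -[LHS]fineK; last exact: (integrable_fin_num mD' i).
  by move: b0; rewrite /Rintegral => ->.
have mh : measurable_fun (D : set (measurableTypeR R)) (fun s => (h s)%:E) := measurable_int nu i.
have [N [mN N0 DN]] := (ae_eq_integral_abs nu mD' mh).1 b1.
have : (nu D <= nu N)%E.
  apply: le_measure; rewrite ?inE// => s Ds; apply: DN => /= /(_ Ds)[hs].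
  by have := h0 s Ds; rewrite hs ltxx.
by have [_ ->] := Hnu; rewrite N0.
Qed.

Lemma mean_inverse_ge0 t : (0 <= mean_inverse t)%E.
Proof. by apply: integral_ge0 => s _; rewrite lee_fin sigma_cdf_ge0. Qed.

Lemma measurable_sigma_cdf1 t : measurable_fun setT (sigma_cdf^~ t).
Proof. by apply: nonincreasing_measurable => // s s'; exact: sigma_cdf_nonincreasing. Qed.

Lemma mean_inverse_nondecreasing t t' : t <= t' -> (mean_inverse t <= mean_inverse t')%E.
Proof.
move=> tt'; apply: ge0_le_integral => //.
- by move=> s _; rewrite lee_fin sigma_cdf_ge0.
- by apply/measurable_EFinP; apply: measurable_funTS; exact: measurable_sigma_cdf1.
- by apply/measurable_EFinP; apply: measurable_funTS; exact: measurable_sigma_cdf1.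
- by move=> s _; rewrite lee_fin sigma_cdf_nondecreasing.
Qed.

Lemma measurable_mean_inverse : measurable_fun D mean_inverse.
Proof.
pose F (z : measurableTypeR R * measurableTypeR R) : R :=
  heaviside z.1 * sigma_cdf z.1 (Num.max z.2 0).
have mF : measurable_fun setT F.
  apply: measurable_funM; first exact: (measurableT_comp measurable_heaviside measurable_fst).
  exact: measurable_sigma_cdf.
have mG : measurable_fun setT (fun t => \int[mu]_s (F (s, t))%:E)%E.
  apply: (@measurable_fun_fubini_tonelli_G _ _ (measurableTypeR R) (measurableTypeR R) R mu (EFin \o F)).
    exact/measurable_EFinP.
  by move=> z; rewrite lee_fin mulr_ge0 ?heaviside_ge0 ?sigma_cdf_ge0.
apply: (@eq_measurable_fun _ _ _ _ _ (fun t => \int[mu]_s (F (s, t))%:E)%E); last exact: measurable_funTS.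
move=> t; rewrite mem_setE in_itv/= andbT => t0.
rewrite [RHS]integral_mkcond; apply: eq_integral => s _.
rewrite patchE mem_setE in_itv/= andbT /F /= max_l ?ltW// /heaviside.
by case: (0 < s); rewrite ?mul1r ?mul0r.
Qed.

(** Integrating [laplace_sigma_cdf] over [s] gives the integral of
  [expR (- (s * bernstein nu a)) / a]. *)
Lemma laplace_mean_inverse a : 0 < a ->
  (\int[mu]_(t in D) ((expR (- (a * t)))%:E * mean_inverse t) =
   ((a * bernstein nu a)^-1)%:E)%E.
Proof.
move=> a0; have b0 := bernstein_gt0 a0.
have mDR : measurable D by exact: measurable_itv.
pose F (z : measurableTypeR R * measurableTypeR R) : R :=
  heaviside z.1 * (heaviside z.2 * (expR (- (a * z.2)) * sigma_cdf z.1 (Num.max z.2 0))).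
have mF : measurable_fun setT F.
  apply: measurable_funM; first exact: (measurableT_comp measurable_heaviside measurable_fst).
  apply: measurable_funM; first exact: (measurableT_comp measurable_heaviside measurable_snd).
  apply: measurable_funM; last exact: measurable_sigma_cdf.
  exact: (measurableT_comp (@measurable_expRN R a setT) measurable_snd).
have F0 z : 0 <= F z by rewrite /F !mulr_ge0// ?heaviside_ge0// ?expR_ge0// sigma_cdf_ge0.
transitivity (\int[mu]_t \int[mu]_s (F (s, t))%:E)%E.
  rewrite integral_mkcond; apply: eq_integral => t _.
  rewrite patchE mem_setE in_itv/= andbT; case: (ltP 0 t) => t0; last first.
    by rewrite integral0_eq// => s _; rewrite /F /= (heaviside_le0 t0) mul0r mulr0.
  rewrite /mean_inverse -ge0_integralZl//; last first.
  - by move=> s _; rewrite lee_fin sigma_cdf_ge0.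
  - by apply/measurable_EFinP; apply: measurable_funTS; exact: measurable_sigma_cdf1.
  rewrite [LHS]integral_mkcond; apply: eq_integral => s _.
  rewrite patchE mem_setE in_itv/= andbT /F /= (heaviside_gt0 t0) mul1r max_l ?ltW//.
  by rewrite /heaviside; case: (0 < s); rewrite ?mul1r ?mul0r -?EFinM.
rewrite -(@fubini_tonelli _ _ _ _ R mu mu (EFin \o F)); first last.
- by move=> z; rewrite lee_fin.
- exact/measurable_EFinP.
transitivity (\int[mu]_(s in D) ((a^-1)%:E * (expR (- (bernstein nu a * s)))%:E))%E.
  rewrite [RHS]integral_mkcond; apply: eq_integral => s _.
  rewrite patchE mem_setE in_itv/= andbT; case: (ltP 0 s) => s0; last first.
    by rewrite integral0_eq// => t _; rewrite /F /= (heaviside_le0 s0) mul0r.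
  rewrite -EFinM mulrC [bernstein nu a * s]mulrC -laplace_sigma_cdf ?ltW//.
  rewrite [RHS]integral_mkcond; apply: eq_integral => t _.
  rewrite patchE mem_setE in_itv/= andbT /F /= (heaviside_gt0 s0) mul1r.
  case: (ltP 0 t) => t0; last by rewrite heaviside_le0// mul0r.
  by rewrite heaviside_gt0// mul1r.
rewrite ge0_integralZl//.
- by rewrite integral_expRN// -EFinM invfM.
- by apply/measurable_EFinP; exact: measurable_expRN.
- by rewrite lee_fin invr_ge0 ltW.
Qed.

End subordinator.

(** * The law of the inverse subordinator *)
Section inverse.
Context {R : realType} (d : measure_display) (T : measurableType d).
Variables (P : probability T R) (nu : {measure set (measurableTypeR R) -> \bar R}).
Variable sigma : R -> T -> R.
Hypotheses (Hsigma : is_subordinator P nu sigma).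
Local Notation mu := (@lebesgue_measure R).
Local Notation D := (`]0%R, +oo[%classic : set R).
Local Notation E := (inverse_subordinator sigma).
Implicit Types (r s t : R) (w : T).

Let S t w := [set y | 0 < y /\ t < sigma y w].

Let S_lb t w : has_lbound (S t w).
Proof. by exists 0 => y [/ltW]. Qed.

Let inverse_empty t w : S t w = set0 -> E t w = 0.
Proof. by rewrite /inverse_subordinator -/(S t w) => ->; rewrite inf0. Qed.

Lemma inverse_ge0 t w : 0 <= E t w.
Proof.
have [S0|/set0P Sn] := eqVneq (S t w) set0; first by rewrite inverse_empty.
by apply: lb_le_inf => // y [/ltW].
Qed.

Lemma inverse_le r t w : 0 < r -> t < sigma r w -> E t w <= r.
Proof. by move=> r0 tr; apply: ge_inf; [exact: S_lb|split]. Qed.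

(** The condition [0 < E t w] excludes the paths that never exceed [t], at which the
  infimum is taken over the empty set and has the value [0]. *)
Lemma le_inverse r t w : 0 <= r -> sigma r w <= t -> 0 < E t w -> r <= E t w.
Proof.
move=> r0 rt E0; have [S0|/set0P Sn] := eqVneq (S t w) set0.
  by move: E0; rewrite inverse_empty// ltxx.
apply: lb_le_inf => // y [y0 ty]; rewrite leNgt; apply/negP => yr.
by move: (le_lt_trans rt ty); rewrite ltNge (sigma_nd Hsigma)// ltW.
Qed.

Lemma inverse_nondecreasing t1 t2 w : t1 <= t2 -> 0 < E t2 w -> E t1 w <= E t2 w.
Proof.
move=> t12 E0; have [S0|/set0P Sn] := eqVneq (S t2 w) set0.
  by move: E0; rewrite inverse_empty// ltxx.
apply: lb_le_inf => // y [y0 ty]; apply: inverse_le => //.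
exact: le_lt_trans ty.
Qed.

(** Only countably many of the variables [sigma s] occur on the right; its first
  factor excludes the paths that never exceed [t]. *)
Lemma inverse_gtE r t : 0 <= r -> [set w | r < E t w] =
  (\bigcup_n [set w | t < sigma n%:R w]) `&`
  (\bigcup_n [set w | sigma (r + n.+1%:R^-1) w <= t]).
Proof.
move=> r0; apply/seteqP; split => w /=.
  move=> rE; split.
    have [S0|/set0P[y [y0 ty]]] := eqVneq (S t w) set0.
      by move: rE; rewrite inverse_empty// ltNge r0.
    have /andP[_ h] := truncn_itv (ltW y0).
    exists (Num.truncn y).+1 => //=; apply: lt_le_trans ty _.
    by apply: (sigma_nd Hsigma); rewrite ltW.
  have d0 : 0 < E t w - r by rewrite subr_gt0.
  have d0' : 0 < (E t w - r)^-1 by rewrite invr_gt0.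
  have /andP[_ h] := truncn_itv (ltW d0').
  exists (Num.truncn (E t w - r)^-1) => //=.
  rewrite leNgt; apply/negP => /inverse_le.
  have r1 : 0 < r + (Num.truncn (E t w - r)^-1).+1%:R^-1.
    by apply: ltr_wpDl => //; rewrite invr_gt0.
  move=> /(_ r1); apply/negP; rewrite -ltNge -ltrBrDl.
  by rewrite invf_plt// posrE.
move=> [[n _ tn] [m _ mt]].
have r1 : r < r + m.+1%:R^-1 by rewrite ltrDl invr_gt0.
apply: lt_le_trans r1 _; apply: lb_le_inf.
  exists n%:R; split => //; rewrite lt_neqAle ler0n andbT; apply/negP => /eqP n0.
  move: tn mt; rewrite /= -n0 => tn mt.
  have h : sigma 0 w <= sigma (r + m.+1%:R^-1) w.
    by apply: (sigma_nd Hsigma) => //; rewrite addr_ge0.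
  by move: (lt_le_trans tn (le_trans h mt)); rewrite ltxx.
move=> y [y0 ty]; rewrite leNgt; apply/negP => yr.
by move: (le_lt_trans mt ty); rewrite ltNge (sigma_nd Hsigma)// ltW.
Qed.

Lemma measurable_inverse t : measurable_fun setT (E t).
Proof.
have m r : measurable [set w | r < E t w].
  have [r0|r0] := leP 0 r; last first.
    rewrite (_ : [set w | _] = setT)//; apply/seteqP; split => // w _ /=.
    exact: lt_le_trans (inverse_ge0 t w).
  rewrite inverse_gtE//; apply: measurableI; apply: bigcup_measurable => n _.
    rewrite (_ : [set w | _] = ~` [set w | sigma n%:R w <= t]).
      by apply: measurableC; exact: (measurable_sigma_le Hsigma).
    by apply/seteqP; split => w /=; [rewrite ltNge => /negP|move=> /negP; rewrite -ltNge].
  by apply: (measurable_sigma_le Hsigma); rewrite addr_ge0.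
apply: (@measurability _ _ _ _ _ _ (@RGenOInfty.G R)); first exact: RGenOInfty.measurableE.
move=> _ [_ [r ->] <-].
rewrite setTI (_ : _ @^-1` _ = [set w | r < E t w])//.
by apply/seteqP; split => w /=; rewrite in_itv/= andbT.
Qed.

End inverse.

Section density.
Context {R : realType} (d : measure_display) (T : measurableType d).
Variables (P : probability T R) (nu : {measure set (measurableTypeR R) -> \bar R}).
Variables (sigma : R -> T -> R) (f : R -> R -> R).
Hypotheses (Hsigma : is_subordinator P nu sigma).
Hypothesis Hf : is_inverse_density P sigma f.
Local Notation mu := (@lebesgue_measure R).
Local Notation D := (`]0%R, +oo[%classic : set R).
Local Notation E := (inverse_subordinator sigma).
Implicit Types (r s t : R) (w : T).

Let measurable_E_preimage t (B : set R) : measurable B -> measurable [set w | B (E t w)].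
Proof.
by move=> mB; rewrite -[X in measurable X]setTI; exact: (measurable_inverse Hsigma t measurableT mB).
Qed.

(** The law of the inverse is carried by the positive half-line, where it has a
  density. *)
Lemma inverse_le0_null t : 0 < t -> P [set w | E t w <= 0] = 0%E.
Proof.
move=> t0; have [_ _ h] := Hf t0.
have := h (`]-oo, 0]%classic) (measurable_itv _).
rewrite (_ : _ `&` _ = set0) ?integral_set0.
  by move=> <-; congr (P _); apply/seteqP; split => w /=; rewrite in_itv.
apply/seteqP; split => // s [] /=; rewrite !in_itv/= andbT => s0 /lt_le_trans h0.
by move: (h0 _ s0); rewrite ltxx.
Qed.

Lemma inverse_eq_null r t : 0 < t -> P [set w | E t w = r] = 0%E.
Proof.
move=> t0; have [_ _ h] := Hf t0.
rewrite (h [set r] (measurable_set1 _)).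
by apply: (@integral_Sset1 R _ _ r) => //; exact: subIsetl.
Qed.

(** The event [r < E t w] is contained in [sigma r w <= t]; they differ at most where
  [E t w] is [r] or [0], which are negligible events. *)
Lemma inverse_tail r t : 0 < t -> 0 < r -> P [set w | r < E t w] = (sigma_cdf P sigma r t)%:E.
Proof.
move=> t0 r0; rewrite (sigma_cdfE Hsigma) max_l ?ltW//.
have m1 : measurable [set w | r < E t w].
  rewrite (_ : [set w | _] = [set w | `]r, +oo[%classic (E t w)]).
    by apply: measurable_E_preimage; exact: measurable_itv.
  by apply/seteqP; split => w /=; rewrite in_itv/= andbT.
have m2 : measurable [set w | E t w = r].
  exact: (@measurable_E_preimage t [set r] (measurable_set1 _)).
have m3 : measurable [set w | E t w <= 0].
  rewrite (_ : [set w | _] = [set w | `]-oo, 0]%classic (E t w)]).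
    by apply: measurable_E_preimage; exact: measurable_itv.
  by apply/seteqP; split => w /=; rewrite in_itv.
have m4 := @measurable_sigma_le _ _ _ _ _ _ Hsigma r t (ltW r0).
apply/eqP; rewrite eq_le; apply/andP; split.
  apply: le_measure; rewrite ?inE// => w /= rE; rewrite leNgt; apply/negP.
  by move=> /(inverse_le r0); rewrite leNgt rE.
apply: (@le_trans _ _ (P ([set w | r < E t w] `|` [set w | E t w = r] `|` [set w | E t w <= 0]))).
  apply: le_measure; rewrite ?inE//.
    by apply: measurableU => //; exact: measurableU.
  move=> w /= rt; case: (ltP 0 (E t w)) => E0; last by right.
  left; move: (le_inverse Hsigma (ltW r0) rt E0); rewrite le_eqVlt => /predU1P[<-|]; [by right|by left].
apply: le_trans (measureU2 _ _ _) _ => //; first exact: measurableU.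
rewrite [X in (_ + X)%E]inverse_le0_null// adde0.
apply: le_trans (measureU2 _ _ _) _ => //.
by rewrite [X in (_ + X)%E]inverse_eq_null// adde0.
Qed.

(** The paths of the inverse are nondecreasing outside the negligible event that the
  inverse at the later time is [0]. *)
Lemma inverse_stochastic_monotone (B : set R) t1 t2 : measurable B ->
  (forall x y, x <= y -> B x -> B y) -> 0 < t2 -> t1 <= t2 ->
  (P [set w | B (E t1 w)] <= P [set w | B (E t2 w)])%E.
Proof.
move=> mB upB t20 t12.
have m3 : measurable [set w | E t2 w <= 0].
  rewrite (_ : [set w | _] = [set w | `]-oo, 0]%classic (E t2 w)]).
    by apply: measurable_E_preimage; exact: measurable_itv.
  by apply/seteqP; split => w /=; rewrite in_itv.
have mB1 := measurable_E_preimage t1 mB; have mB2 := measurable_E_preimage t2 mB.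
apply: (@le_trans _ _ (P ([set w | B (E t2 w)] `|` [set w | E t2 w <= 0]))).
  apply: le_measure; rewrite ?inE//; first exact: measurableU.
  move=> w /= BE; case: (ltP 0 (E t2 w)) => E0; last by right.
  by left; apply: upB BE; exact: inverse_nondecreasing.
apply: le_trans (measureU2 _ _ _) _ => //.
by rewrite [X in (_ + X)%E]inverse_le0_null// adde0.
Qed.

Section layer_cake.
Variable A : R -> R.
Hypotheses (mA : measurable_fun setT A).

Let F t (z : measurableTypeR R * measurableTypeR R) : R :=
  heaviside z.1 * (heaviside (A z.2 - z.1) * (f^~ t \_ D) z.2).

Let mD : measurable D. Proof. exact: measurable_itv. Qed.

Let mf t : 0 < t -> measurable_fun setT (f^~ t \_ D).
Proof. by move=> t0; have [h _ _] := Hf t0; apply/(measurable_restrictT _ mD). Qed.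

Let f0 t s : 0 < t -> 0 <= (f^~ t \_ D) s.
Proof.
move=> t0; have [_ h _] := Hf t0; rewrite patchE mem_setE in_itv/= andbT.
by case: ifP => // /h.
Qed.

Let mF t : 0 < t -> measurable_fun setT (F t).
Proof.
move=> t0; apply: measurable_funM.
  exact: (measurableT_comp measurable_heaviside measurable_fst).
apply: measurable_funM; last exact: (measurableT_comp (mf t0) measurable_snd).
apply: (measurableT_comp measurable_heaviside); apply: measurable_funB => //.
exact: (measurableT_comp mA measurable_snd).
Qed.

Let F0 t z : 0 < t -> 0 <= F t z.
Proof. by move=> t0; rewrite /F !mulr_ge0// ?heaviside_ge0// f0. Qed.

(** For [r > 0] this is the probability of [r < A (E t)], in a form whose
  measurability in [r] is given by Tonelli's theorem. *)
Definition tail_integrand t r : \bar R := (\int[mu]_s (F t (r, s))%:E)%E.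

Lemma measurable_tail_integrand t : 0 < t -> measurable_fun setT (tail_integrand t).
Proof.
move=> t0.
apply: (@measurable_fun_fubini_tonelli_F _ _ (measurableTypeR R) (measurableTypeR R) R mu (EFin \o F t)).
- by apply/measurable_EFinP; exact: mF.
- by move=> z; rewrite lee_fin F0.
Qed.

Let mup r : measurable [set s : R | r < A s].
Proof.
rewrite -[X in measurable X]setTI (_ : [set s | _] = A @^-1` `]r, +oo[).
  by apply: mA => //; exact: measurable_itv.
by apply/seteqP; split => s /=; rewrite in_itv/= andbT.
Qed.

Lemma tail_integrandE t r : 0 < t -> 0 < r -> tail_integrand t r = P [set w | r < A (E t w)].
Proof.
move=> t0 r0; have [_ _ h] := Hf t0.
rewrite (h [set s | r < A s] (mup r)) [RHS]integral_mkcond.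
apply: eq_integral => s _; rewrite /F /= heaviside_gt0// mul1r !patchE.
have -> : (s \in [set s | r < A s] `&` D) = (r < A s) && (s \in D).
  by rewrite in_setI; congr (_ && _); apply/idP/idP; rewrite inE.
rewrite /heaviside subr_gt0.
by case: (r < A s); case: (s \in D); rewrite /= ?mul1r ?mul0r ?mulr0.
Qed.

Lemma tail_integrand_le0 t r : r <= 0 -> tail_integrand t r = 0%E.
Proof.
by move=> r0; rewrite /tail_integrand integral0_eq// => s _; rewrite /F /= heaviside_le0// mul0r.
Qed.

Lemma layer_cake t : 0 < t -> (forall s, 0 < s -> 0 <= A s) ->
  (\int[mu]_(s in D) (A s * f s t)%:E = \int[mu]_r tail_integrand t r)%E.
Proof.
move=> t0 A0.
rewrite (@fubini_tonelli _ _ _ _ R mu mu (EFin \o F t)); first last.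
- by move=> z; rewrite lee_fin F0.
- by apply/measurable_EFinP; exact: mF.
rewrite integral_mkcond; apply: eq_integral => s _ /=.
rewrite patchE mem_setE in_itv/= andbT; case: (ltP 0 s) => s0; last first.
  rewrite integral0_eq// => r _; rewrite /F /= patchE mem_setE in_itv/= andbT.
  by rewrite ltNge s0 !mulr0.
have fs0 : 0 <= f s t by have [_ + _] := Hf t0; apply.
transitivity (\int[mu]_r ((f s t)%:E * (\1_(`]0%R, A s[%classic : set R) r)%:E))%E; last first.
  apply: eq_integral => r _; rewrite -EFinM /F /= patchE mem_setE in_itv/= s0/=.
  rewrite indicE mem_setE in_itv/= /heaviside subr_gt0; congr EFin.
  by case: (0 < r); case: (r < A s); rewrite /= ?mulr0 ?mul0r ?mulr1 ?mul1r.
rewrite ge0_integralZl//.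
- rewrite integral_indic//.
  have l : mu `]0%R, A s[%classic = (A s)%:E.
    rewrite lebesgue_measure_itv /= lte_fin; have := A0 s s0.
    by rewrite le_eqVlt => /predU1P[<-|As]; rewrite ?ltxx// As -EFinD subr0.
  by rewrite setIT [X in (_ * X)%E]l -EFinM mulrC.
- by apply/measurable_EFinP; apply: measurable_indic; exact: measurable_itv.
Qed.

End layer_cake.

Definition density_mean (A : R -> R) t : \bar R := (\int[mu]_(s in D) (A s * f s t)%:E)%E.

(** By the layer-cake formula the mean is the integral over [r > 0] of the
  probabilities of the up-sets [r < A]. *)
Lemma density_mean_nondecreasing (A : R -> R) t1 t2 : measurable_fun setT A ->
  {homo A : x y / x <= y} -> (forall s, 0 < s -> 0 <= A s) -> 0 < t1 -> t1 <= t2 ->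
  (density_mean A t1 <= density_mean A t2)%E.
Proof.
move=> mA ndA A0 t10 t12; have t20 := lt_le_trans t10 t12.
rewrite /density_mean !layer_cake//; apply: ge0_le_integral => //.
- move=> r _; have [r0|r0] := leP r 0; first by rewrite tail_integrand_le0.
  by rewrite tail_integrandE.
- exact: measurable_tail_integrand.
- exact: measurable_tail_integrand.
move=> r _; have [r0|r0] := leP r 0; first by rewrite !tail_integrand_le0.
rewrite !tail_integrandE//; apply: (@inverse_stochastic_monotone [set x | r < A x]) => //.
  rewrite -[X in measurable X]setTI (_ : [set s | _] = A @^-1` `]r, +oo[).
    by apply: mA => //; exact: measurable_itv.
  by apply/seteqP; split => s /=; rewrite in_itv/= andbT.
by move=> x y xy /= /lt_le_trans; apply; exact: ndA.
Qed.

Lemma density_mean_id t : 0 < t -> density_mean id t = mean_inverse P sigma t.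
Proof.
move=> t0; rewrite /density_mean layer_cake//; last by move=> s /ltW.
rewrite /mean_inverse [RHS]integral_mkcond; apply: eq_integral => r _.
rewrite patchE mem_setE in_itv/= andbT; case: (ltP 0 r) => r0.
  by rewrite tail_integrandE// inverse_tail.
by rewrite tail_integrand_le0.
Qed.

Lemma density_mean_cst t (c : R) : 0 < t -> 0 <= c -> density_mean (fun=> c) t = c%:E.
Proof.
move=> t0 c0; have [mf f0 h] := Hf t0.
have mDR : measurable D by exact: measurable_itv.
transitivity (\int[mu]_(s in D) (c%:E * (f s t)%:E))%E; first exact: eq_integral.
rewrite ge0_integralZl//.
- have := h setT measurableT; rewrite setTI => <-.
  by rewrite (_ : [set w | _] = setT)// probability_setT mule1.
- exact/measurable_EFinP.
- by move=> s; rewrite /= in_itv/= andbT => /f0; rewrite lee_fin.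
Qed.

End density.

(** * Sonine's relation for the mean of the inverse *)
Section monotone.
Context {R : realType}.
Local Notation mu := (@lebesgue_measure R).
Local Notation D := (`]0%R, +oo[%classic : set R).
Implicit Types (a s t : R).

(** If [g] were infinite at [t], it would be so beyond [t], and its Laplace
  transform would be infinite too. *)
Lemma nondecreasing_laplace_finite (g : R -> \bar R) a : 0 < a -> measurable_fun D g ->
  (forall t, (0 <= g t)%E) -> {homo g : s t / s <= t >-> (s <= t)%E} ->
  (\int[mu]_(t in D) ((expR (- (a * t)))%:E * g t) < +oo)%E -> forall t, (g t < +oo)%E.
Proof.
move=> a0 mg g0 ndg fin t.
apply: le_lt_trans (ndg t (Num.max t 0) _) _; first by rewrite le_max lexx.
have t0 : 0 <= Num.max t 0 by rewrite le_max lexx orbT.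
move: (Num.max t 0) t0 => {}t t0.
have mle : measurable_fun setT (fun s : R => (t <= s)%R%:R : R).
  rewrite (_ : (fun t => _) = \1_(`[t, +oo[%classic : set R)).
    by apply: measurable_indic; exact: measurable_itv.
  by apply/funext => s; rewrite indicE mem_setE in_itv/= andbT.
have h : (g t * (expR (- (a * t)) / a)%:E <= \int[mu]_(t in D) ((expR (- (a * t)))%:E * g t))%E.
  rewrite -integral_expRN_tail// -ge0_integralZl//; last first.
    apply/measurable_EFinP; apply: measurable_funM; last exact: measurable_funTS.
    exact: measurable_expRN.
  apply: ge0_le_integral => //.
  - by move=> s _; rewrite mule_ge0// lee_fin mulr_ge0// expR_ge0.
  - apply: measurable_funeM; apply/measurable_EFinP.
    by apply: measurable_funM; [exact: measurable_expRN|exact: measurable_funTS].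
  - by apply: emeasurable_funM => //; apply/measurable_EFinP; exact: measurable_expRN.
  move=> s _. case: (leP t s) => ts; rewrite /= ?mulr1 ?mulr0 ?mule0.
    by rewrite muleC; apply: lee_wpmul2l; [rewrite lee_fin expR_ge0|exact: ndg].
  by rewrite mule_ge0// lee_fin expR_ge0.
rewrite ltey; apply/eqP => e; move: h; rewrite e gt0_mulye ?lte_fin ?divr_gt0 ?expR_gt0//.
by rewrite leye_eq => /eqP e2; rewrite e2 in fin.
Qed.

Lemma ae_exists_itv (Q : R -> Prop) a b : {ae mu, forall t, Q t} -> a < b ->
  exists2 t, a < t < b & Q t.
Proof.
move=> [N [mN N0 QN]] ab; apply: contrapT => h.
have : (mu `]a, b[%classic <= mu N)%E.
  apply: le_measure; rewrite ?inE//.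
  move=> t /=; rewrite in_itv/= => tab; apply: QN => /= Qt; apply: h.
  by exists t.
by rewrite N0 lebesgue_measure_itv /= lte_fin ab -EFinD lee_fin subr_le0 leNgt ab.
Qed.

(** A set of full measure is dense, and a monotone function is squeezed by its values
  on a dense set. *)
Lemma nondecreasing_ae_id (c : R -> R) : {homo c : s t / s <= t} ->
  {ae mu, forall t, 0 < t -> c t = t} -> forall t, 0 < t -> c t = t.
Proof.
move=> ndc cid t t0; apply/eqP; rewrite eq_le; apply/andP; split; rewrite leNgt; apply/negP => h.
  have [s /andP[ts sc] /(_ (lt_trans t0 ts)) cs] := ae_exists_itv cid h.
  by move: (ndc _ _ (ltW ts)); rewrite cs leNgt sc.
have m0 : Num.max (c t) 0 < t by rewrite gt_max h.
have [s /andP[+ st] cs] := ae_exists_itv cid m0.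
rewrite gt_max => /andP[ct s0].
by move: (ndc _ _ (ltW st)); rewrite cs// leNgt ct.
Qed.

End monotone.

Section sonine.
Context {R : realType} (d : measure_display) (T : measurableType d).
Variables (P : probability T R) (nu : {measure set (measurableTypeR R) -> \bar R}).
Variables (sigma : R -> T -> R).
Hypotheses (Hnu : levy_measure nu) (Hsigma : is_subordinator P nu sigma).
Local Notation mu := (@lebesgue_measure R).
Local Notation D := (`]0%R, +oo[%classic : set R).
Implicit Types (a s t : R).

Lemma mean_inverse_lty t : (mean_inverse P sigma t < +oo)%E.
Proof.
apply: (nondecreasing_laplace_finite (g := mean_inverse P sigma) ltr01).
- exact: (measurable_mean_inverse Hsigma).
- exact: mean_inverse_ge0.
- by move=> s s'; exact: (mean_inverse_nondecreasing Hsigma).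
- by rewrite (laplace_mean_inverse Hnu Hsigma)// ltry.
Qed.

End sonine.

Section sonine_identity.
Context {R : realType} (d : measure_display) (T : measurableType d).
Variables (P : probability T R) (nu : {measure set (measurableTypeR R) -> \bar R}).
Variables (sigma : R -> T -> R).
Hypotheses (Hnu : levy_measure nu) (Hsigma : is_subordinator P nu sigma).
Local Notation mu := (@lebesgue_measure R).
Local Notation D := (`]0%R, +oo[%classic : set R).
Implicit Types (a s t : R).

Definition tail_kernel t : R := heaviside t * nu_bar nu t.
Definition mean_kernel t : R := heaviside t * fine (mean_inverse P sigma t).
Local Notation p := tail_kernel.
Local Notation qM := mean_kernel.

Lemma heaviside_mul_le0 (g : R -> R) t : t <= 0 -> heaviside t * g t = 0.
Proof. by move=> t0; rewrite heaviside_le0// mul0r. Qed.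

Lemma ge0_integral_heaviside (g : R -> R) :
  (\int[mu]_t (heaviside t * g t)%:E = \int[mu]_(t in D) (g t)%:E)%E.
Proof.
rewrite [RHS]integral_mkcond; apply: eq_integral => t _.
rewrite patchE mem_setE in_itv/= andbT /heaviside.
by case: (0 < t); rewrite ?mul1r ?mul0r.
Qed.

Lemma tail_kernel_ge0 t : 0 <= p t.
Proof. by rewrite mulr_ge0 ?heaviside_ge0 ?nu_bar_ge0. Qed.

Lemma measurable_tail_kernel : measurable_fun setT p.
Proof.
have mD : measurable D by exact: measurable_itv.
rewrite (_ : p = nu_bar nu \_ D).
  by apply/(measurable_restrictT _ mD); exact: measurable_nu_bar.
apply/funext => t; rewrite patchE mem_setE in_itv/= andbT /p /heaviside.
by case: (0 < t); rewrite ?mul1r ?mul0r.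
Qed.

Lemma mean_kernel_ge0 t : 0 <= qM t.
Proof. by rewrite mulr_ge0 ?heaviside_ge0// fine_ge0// mean_inverse_ge0. Qed.

Let mean_fin t : mean_inverse P sigma t \is a fin_num.
Proof.
by rewrite ge0_fin_numE ?mean_inverse_ge0// (mean_inverse_lty Hnu Hsigma).
Qed.

Lemma mean_kernel_nondecreasing : {homo qM : s t / s <= t}.
Proof.
move=> s t st; rewrite {1}/mean_kernel /heaviside; case: (ltP 0 s) => s0; last first.
  by rewrite mul0r mean_kernel_ge0.
rewrite /mean_kernel heaviside_gt0 ?(lt_le_trans s0 st)// !mul1r fine_le//.
exact: (mean_inverse_nondecreasing Hsigma).
Qed.

Lemma measurable_mean_kernel : measurable_fun setT qM.
Proof. by apply: nondecreasing_measurable => //; exact: mean_kernel_nondecreasing. Qed.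

Lemma laplace_tail_kernel a : 0 < a ->
  (\int[mu]_t (expR (- (a * t)) * p t)%:E = (bernstein nu a / a)%:E)%E.
Proof.
move=> a0; have mD : measurable D by exact: measurable_itv.
transitivity (\int[mu]_t (heaviside t * (expR (- (a * t)) * nu_bar nu t))%:E)%E.
  by apply: eq_integral => t _; rewrite mulrCA.
rewrite ge0_integral_heaviside -(RintegralE mD (integrable_nu_bar Hnu a0)).
by rewrite (bernstein_laplace Hnu)// mulrAC mulfV ?mul1r// gt_eqF.
Qed.

Lemma laplace_mean_kernel a : 0 < a ->
  (\int[mu]_t (expR (- (a * t)) * qM t)%:E = ((a * bernstein nu a)^-1)%:E)%E.
Proof.
move=> a0; rewrite -(laplace_mean_inverse Hnu Hsigma a0).
transitivity (\int[mu]_t (heaviside t * (expR (- (a * t)) * fine (mean_inverse P sigma t)))%:E)%E.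
  by apply: eq_integral => t _; rewrite mulrCA.
rewrite ge0_integral_heaviside; apply: eq_integral => t _.
by rewrite EFinM fineK.
Qed.

Let laplace_conv a : 0 < a ->
  (\int[mu]_t ((expR (- (a * t)))%:E * econvol p qM t) = ((a ^+ 2)^-1)%:E)%E.
Proof.
move=> a0; have b0 := bernstein_gt0 Hnu a0.
rewrite (laplace_econvol _ measurable_tail_kernel measurable_mean_kernel tail_kernel_ge0 mean_kernel_ge0).
rewrite laplace_tail_kernel// laplace_mean_kernel// -EFinM; congr EFin.
by field; rewrite !gt_eqF.
Qed.

(** [econvol_heaviside] makes this the Laplace transform of the identity. *)
Let laplace_id a : 0 < a ->
  (\int[mu]_t ((expR (- (a * t)))%:E * econvol (@heaviside R) (@heaviside R) t) = ((a ^+ 2)^-1)%:E)%E.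
Proof.
move=> a0.
rewrite (laplace_econvol _ (@measurable_heaviside R) (@measurable_heaviside R) (@heaviside_ge0 R) (@heaviside_ge0 R)).
have -> : (\int[mu]_t (expR (- (a * t)) * heaviside t)%:E = (a^-1)%:E)%E.
  rewrite -integral_expRN// -ge0_integral_heaviside.
  by apply: eq_integral => t _; rewrite mulrC.
by rewrite -EFinM -invfM -expr2.
Qed.

Let econvol_D (q1 q2 : R -> R) a : (forall t, t <= 0 -> q1 t = 0) -> (forall t, t <= 0 -> q2 t = 0) ->
  (\int[mu]_t ((expR (- (a * t)))%:E * econvol q1 q2 t) =
   \int[mu]_(t in D) ((expR (- (a * t)))%:E * econvol q1 q2 t))%E.
Proof.
move=> h1 h2; rewrite [RHS]integral_mkcond; apply: eq_integral => t _.
rewrite patchE mem_setE in_itv/= andbT; case: (ltP 0 t) => // t0.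
by rewrite econvol_eq0// mule0.
Qed.

Let p_le0 t : t <= 0 -> p t = 0. Proof. exact: heaviside_mul_le0. Qed.

Let qM_le0 t : t <= 0 -> qM t = 0.
Proof. by move=> t0; rewrite /mean_kernel heaviside_le0// mul0r. Qed.

Let mconv : measurable_fun setT (econvol p qM).
Proof.
exact: (measurable_econvol measurable_tail_kernel measurable_mean_kernel tail_kernel_ge0 mean_kernel_ge0).
Qed.

Let conv_ge0 t : (0 <= econvol p qM t)%E.
Proof. exact: (econvol_ge0 tail_kernel_ge0 mean_kernel_ge0). Qed.

Let conv_nd : {homo econvol p qM : s t / s <= t >-> (s <= t)%E}.
Proof.
exact: (econvol_nondecreasing measurable_tail_kernel measurable_mean_kernel
  tail_kernel_ge0 mean_kernel_ge0 mean_kernel_nondecreasing).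
Qed.

Let conv_fin t : econvol p qM t \is a fin_num.
Proof.
rewrite ge0_fin_numE//; apply: (nondecreasing_laplace_finite (g := econvol p qM) ltr01) => //.
  exact: measurable_funTS.
by rewrite -econvol_D// laplace_conv// ltry.
Qed.

(** The Laplace transforms of the two factors are [Phi a / a] and [1 / (a * Phi a)], so
  that their product is the transform of the identity.  Uniqueness gives the
  equality almost everywhere, and monotonicity gives it everywhere.  It is
  Sonine's relation, integrated once. *)
Lemma sonine_identity t : 0 < t -> econvol p qM t = t%:E.
Proof.
move=> t0; rewrite -[LHS]fineK//; congr EFin.
have mD : measurable D by exact: measurable_itv.
apply: (@nondecreasing_ae_id _ (fun t => fine (econvol p qM t))) => //.
  by move=> r s rs; rewrite fine_le// conv_nd.
have me a : measurable_fun setT (fun t : R => expR (- (a * t))) by exact: measurable_expRN.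
have mf : measurable_fun setT (fun t => fine (econvol p qM t)).
  exact: (measurableT_comp (@fine_measurable R setT measurableT) mconv).
have i1 a : 0 < a -> mu.-integrable D (EFin \o (fun t => expR (- (a * t)) * fine (econvol p qM t))).
  move=> a0; apply: ge0_Rintegrable.
  - by move=> s _; rewrite mulr_ge0// ?expR_ge0// fine_ge0.
  - by apply: measurable_funTS; exact: measurable_funM.
  - rewrite (_ : integral _ _ _ = ((a ^+ 2)^-1)%:E) ?ltry// -(laplace_conv a0) econvol_D//.
    by apply: eq_integral => s _; rewrite EFinM fineK.
have e1 a : 0 < a -> \int[mu]_(t in D) (expR (- (a * t)) * fine (econvol p qM t)) = (a ^+ 2)^-1.
  move=> a0; rewrite /Rintegral (_ : integral _ _ _ = ((a ^+ 2)^-1)%:E)// -(laplace_conv a0) econvol_D//.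
  by apply: eq_integral => s _; rewrite EFinM fineK.
have e2' a : 0 < a -> (\int[mu]_(t in D) (expR (- (a * t)) * t)%:E = ((a ^+ 2)^-1)%:E)%E.
  move=> a0; rewrite -(laplace_id a0) econvol_D; [|exact: heaviside_le0|exact: heaviside_le0].
  apply: eq_integral => s; rewrite mem_setE in_itv/= andbT => s0.
  by rewrite econvol_heaviside// EFinM.
have i2 a : 0 < a -> mu.-integrable D (EFin \o (fun t => expR (- (a * t)) * t)).
  move=> a0; apply: ge0_Rintegrable.
  - by move=> s; rewrite /= in_itv/= andbT => s0; rewrite mulr_ge0// ?expR_ge0// ltW.
  - by apply: measurable_funTS; apply: measurable_funM => //; exact: measurable_id.
  - by rewrite e2'// ltry.
have E a : (fun t => expR (- (a * t)) * (fine (econvol p qM t) - t)) =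
    (fun t => expR (- (a * t)) * fine (econvol p qM t) - expR (- (a * t)) * t).
  by apply/funext => s; rewrite mulrBr.
have h1 a : 0 < a -> mu.-integrable D (EFin \o (fun t => expR (- (a * t)) * (fine (econvol p qM t) - t))).
  by move=> a0; rewrite E; exact: (RintegrableB mD (i1 a a0) (i2 a a0)).
have h2 a : 0 < a -> \int[mu]_(t in D) (expR (- (a * t)) * (fine (econvol p qM t) - t)) = 0.
  move=> a0; rewrite E (RintegralB _ (i1 a a0) (i2 a a0))// e1//.
  by rewrite /Rintegral e2'// subrr.
have := laplace_unique h1 h2; apply: filterS; first exact: (ae_filter_ringOfSetsType mu).
by move=> s cs s0; apply/eqP; rewrite -subr_eq0; apply/eqP; exact: cs.
Qed.

Lemma mean_convol_integrable t :
  mu.-integrable setT (EFin \o (fun tau => p (t - tau) * qM tau)).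
Proof.
apply: econvol_integrable; [exact: measurable_tail_kernel|exact: measurable_mean_kernel|
  exact: tail_kernel_ge0|exact: mean_kernel_ge0|].
by have := conv_fin t; rewrite ge0_fin_numE.
Qed.

Lemma mean_convol t : 0 < t -> \int[mu]_tau (p (t - tau) * qM tau) = t.
Proof. by move=> t0; have := sonine_identity t0; rewrite /econvol /Rintegral => ->. Qed.

End sonine_identity.

(** * The non-local derivative of a subordinated Lipschitz function *)
Section subordinated.
Context {R : realType} (d : measure_display) (T : measurableType d).
Variables (P : probability T R) (nu : {measure set (measurableTypeR R) -> \bar R}).
Variables (sigma : R -> T -> R) (f : R -> R -> R).
Hypotheses (Hnu : levy_measure nu) (Hsigma : is_subordinator P nu sigma).
Hypothesis Hf : is_inverse_density P sigma f.
Variables (v : R -> R) (k : R).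
Hypotheses (k0 : 0 < k)
  (hv : forall s t, 0 <= s -> 0 <= t -> `|v s - v t| <= k * `|s - t|).
Local Notation mu := (@lebesgue_measure R).
Local Notation D := (`]0%R, +oo[%classic : set R).
Implicit Types (a s t : R).
Local Notation p := (tail_kernel nu).
Local Notation qM := (mean_kernel P sigma).

(** [S_Phi] at a fixed point of space. *)
Definition subordinate t : R := S_Phi f (fun _ => v) 0 t.
Local Notation u := subordinate.

(** As [v] is [k]-Lipschitz, adding [k * s] to its increments of either sign makes
  them nondecreasing and nonnegative; [Num.max s 0] only serves to have them
  monotone on the whole line. *)
Let Ap s := k * Num.max s 0 + (v (Num.max s 0) - v 0).
Let Am s := k * Num.max s 0 - (v (Num.max s 0) - v 0).

Let max0 s : 0 <= Num.max s 0. Proof. by rewrite le_max lexx orbT. Qed.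

Let maxnd s t : s <= t -> Num.max s 0 <= Num.max t 0.
Proof. by move=> st; rewrite ge_max !le_max st lexx /= orbT. Qed.

Let hv' s t : s <= t ->
  `|v (Num.max t 0) - v (Num.max s 0)| <= k * (Num.max t 0 - Num.max s 0).
Proof.
move=> /maxnd st; apply: le_trans (hv (max0 t) (max0 s)) _.
by rewrite ger0_norm// subr_ge0.
Qed.

Let Ap_nd : {homo Ap : s t / s <= t}.
Proof. by move=> s t /hv'; rewrite ler_norml /Ap => /andP[h1 h2]; lra. Qed.

Let Am_nd : {homo Am : s t / s <= t}.
Proof. by move=> s t /hv'; rewrite ler_norml /Am => /andP[h1 h2]; lra. Qed.

Let mAp : measurable_fun setT Ap. Proof. exact: nondecreasing_measurable. Qed.

Let mAm : measurable_fun setT Am. Proof. exact: nondecreasing_measurable. Qed.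

Let bv s : 0 < s -> `|v s - v 0| <= k * s.
Proof.
move=> s0; apply: le_trans (hv (ltW s0) (lexx 0)) _.
by rewrite subr0 ger0_norm// ltW.
Qed.

Let Ap_ge0 s : 0 < s -> 0 <= Ap s.
Proof.
move=> s0; rewrite /Ap max_l; last exact: ltW.
by have := bv s0; rewrite ler_norml => /andP[h1 h2]; lra.
Qed.

Let Am_ge0 s : 0 < s -> 0 <= Am s.
Proof.
move=> s0; rewrite /Am max_l; last exact: ltW.
by have := bv s0; rewrite ler_norml => /andP[h1 h2]; lra.
Qed.

Let mD : measurable D. Proof. exact: measurable_itv. Qed.

Let mv : measurable_fun D (fun s => v s - v 0).
Proof.
apply: (@eq_measurable_fun _ _ _ _ _ (fun s => 2^-1 * (Ap s - Am s))).
  move=> s; rewrite mem_setE in_itv/= andbT => s0.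
  by rewrite /Ap /Am max_l ?ltW//; field.
apply: measurable_funTS; apply: measurable_funM => //.
exact: measurable_funB.
Qed.

Section at_time.
Variable t : R.
Hypothesis t0 : 0 < t.
Local Notation M := (fine (mean_inverse P sigma t)).

Let mft : measurable_fun D (f^~ t). Proof. by have [] := Hf t0. Qed.

Let f0 s : 0 < s -> 0 <= f s t. Proof. by have [_ + _] := Hf t0; apply. Qed.

Let i_sf : mu.-integrable D (EFin \o (fun s => s * f s t)).
Proof.
apply: ge0_Rintegrable => //.
- by move=> s; rewrite /= in_itv/= andbT => s0; rewrite mulr_ge0 ?f0// ltW.
- by apply: measurable_funM.
- by have := density_mean_id Hsigma Hf t0; rewrite /density_mean => ->; exact: (mean_inverse_lty Hnu Hsigma).
Qed.

Let e_sf : \int[mu]_(s in D) (s * f s t) = M.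
Proof. by rewrite /Rintegral -(density_mean_id Hsigma Hf t0). Qed.

Let int_f : (\int[mu]_(s in D) (f s t)%:E = 1)%E.
Proof.
rewrite -[RHS](density_mean_cst Hf t0 ler01).
by apply: eq_integral => s _; rewrite mul1r.
Qed.

Let i_f : mu.-integrable D (EFin \o (fun s => f s t)).
Proof.
apply: ge0_Rintegrable => //; last by rewrite int_f ltry.
by move=> s; rewrite /= in_itv/= andbT => /f0.
Qed.

Let e_f : \int[mu]_(s in D) f s t = 1.
Proof. by rewrite /Rintegral int_f. Qed.

Let i_vf : mu.-integrable D (EFin \o (fun s => (v s - v 0) * f s t)).
Proof.
apply: (Rintegrable_le mD _ (RintegrableZ mD k i_sf)); first exact: measurable_funM.
move=> s; rewrite /= in_itv/= andbT => s0.
rewrite normrM [leRHS]ger0_norm ?mulrA; last by rewrite !mulr_ge0 ?f0// ltW.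
by rewrite [`|f s t|]ger0_norm ?f0// ler_wpM2r ?f0// bv.
Qed.

Let e_vf : \int[mu]_(s in D) ((v s - v 0) * f s t) = u t - v 0.
Proof.
rewrite /subordinate /S_Phi gt_eqF//.
have -> : v 0 = \int[mu]_(s in D) (v 0 * f s t) by rewrite RintegralZl// e_f mulr1.
rewrite -RintegralB//; last exact: RintegrableZ.
  by apply: eq_Rintegral => s _; rewrite RintegralZl// e_f mulr1 mulrBl.
have := RintegrableD mD i_vf (RintegrableZ mD (v 0) i_f).
by congr (_.-integrable _ (EFin \o _)); apply/funext => s; rewrite -mulrDl subrK.
Qed.

(** [M] is the mean of [s], and [u t] is the mean of [v s], under the law of the
  inverse. *)
Lemma density_meanp : density_mean f Ap t = (k * M + (u t - v 0))%:E.
Proof.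
rewrite -e_sf -e_vf -RintegralZl// -RintegralD//; last exact: RintegrableZ.
rewrite (RintegralE mD (RintegrableD mD (RintegrableZ mD k i_sf) i_vf)).
apply: eq_integral => s; rewrite mem_setE in_itv/= andbT => s0.
by rewrite /Ap max_l ?ltW//; congr EFin; ring.
Qed.

Lemma density_meanm : density_mean f Am t = (k * M - (u t - v 0))%:E.
Proof.
rewrite -e_sf -e_vf -RintegralZl// -RintegralB//; last exact: RintegrableZ.
rewrite (RintegralE mD (RintegrableB mD (RintegrableZ mD k i_sf) i_vf)).
apply: eq_integral => s; rewrite mem_setE in_itv/= andbT => s0.
by rewrite /Am max_l ?ltW//; congr EFin; ring.
Qed.

End at_time.

Definition increment_kernel t : R := heaviside t * (u t - v 0).
Local Notation qU := increment_kernel.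

(** On the positive half-line, the means of [Ap] and of [Am] under the law of the
  inverse. *)
Definition up_kernel t : R := k * qM t + qU t.
Definition down_kernel t : R := k * qM t - qU t.

Let up_le0 t : t <= 0 -> up_kernel t = 0.
Proof. by move=> t0; rewrite /up_kernel /mean_kernel /qU heaviside_le0// !mul0r mulr0 addr0. Qed.

Let down_le0 t : t <= 0 -> down_kernel t = 0.
Proof. by move=> t0; rewrite /down_kernel /mean_kernel /qU heaviside_le0// !mul0r mulr0 subr0. Qed.

Let upE t : 0 < t -> (up_kernel t)%:E = density_mean f Ap t.
Proof. by move=> t0; rewrite density_meanp// /up_kernel /mean_kernel /qU heaviside_gt0// !mul1r. Qed.

Let downE t : 0 < t -> (down_kernel t)%:E = density_mean f Am t.
Proof. by move=> t0; rewrite density_meanm// /down_kernel /mean_kernel /qU heaviside_gt0// !mul1r. Qed.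

Let density_mean_ge0 (A : R -> R) t : 0 < t -> (forall s, 0 < s -> 0 <= A s) ->
  (0 <= density_mean f A t)%E.
Proof.
move=> t0 A0; have [_ f0 _] := Hf t0; apply: integral_ge0 => s.
by rewrite /= in_itv/= andbT => s0; rewrite lee_fin mulr_ge0 ?A0 ?f0.
Qed.

Lemma up_kernel_ge0 t : 0 <= up_kernel t.
Proof.
have [t0|t0] := leP t 0; first by rewrite up_le0.
by rewrite -lee_fin upE// density_mean_ge0.
Qed.

Lemma down_kernel_ge0 t : 0 <= down_kernel t.
Proof.
have [t0|t0] := leP t 0; first by rewrite down_le0.
by rewrite -lee_fin downE// density_mean_ge0.
Qed.

Lemma up_kernel_nondecreasing : {homo up_kernel : s t / s <= t}.
Proof.
move=> s t st; have [s0|s0] := leP s 0; first by rewrite up_le0// up_kernel_ge0.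
rewrite -lee_fin !upE ?(lt_le_trans s0 st)//.
exact: (density_mean_nondecreasing Hsigma Hf).
Qed.

Lemma down_kernel_nondecreasing : {homo down_kernel : s t / s <= t}.
Proof.
move=> s t st; have [s0|s0] := leP s 0; first by rewrite down_le0// down_kernel_ge0.
rewrite -lee_fin !downE ?(lt_le_trans s0 st)//.
exact: (density_mean_nondecreasing Hsigma Hf).
Qed.

Lemma measurable_increment_kernel : measurable_fun setT qU.
Proof.
rewrite (_ : qU = fun t => 2^-1 * (up_kernel t - down_kernel t)).
  apply: measurable_funM => //; apply: measurable_funB.
    by apply: nondecreasing_measurable => //; exact: up_kernel_nondecreasing.
  by apply: nondecreasing_measurable => //; exact: down_kernel_nondecreasing.
by apply/funext => t; rewrite /up_kernel /down_kernel; field.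
Qed.

Lemma increment_kernel_le t : `|qU t| <= k * qM t.
Proof.
have := up_kernel_ge0 t; have := down_kernel_ge0 t.
by rewrite /up_kernel /down_kernel ler_norml => h1 h2; apply/andP; split; lra.
Qed.

Let mT : measurable (setT : set R). Proof. by []. Qed.

Let iM t := mean_convol_integrable Hnu Hsigma t.

Lemma increment_convol_integrable t :
  mu.-integrable setT (EFin \o (fun tau => p (t - tau) * qU tau)).
Proof.
apply: (Rintegrable_le mT _ (RintegrableZ mT k (iM t))).
  apply: measurable_funM; last exact: measurable_increment_kernel.
  by apply: (measurableT_comp (measurable_tail_kernel Hnu)); apply: measurable_funB.
move=> tau _; rewrite normrM [leRHS]ger0_norm; last first.
  apply: mulr_ge0; first exact: ltW.
  by apply: mulr_ge0; [exact: tail_kernel_ge0|exact: mean_kernel_ge0].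
rewrite [`|p _|]ger0_norm ?tail_kernel_ge0// mulrCA.
by rewrite ler_wpM2l ?tail_kernel_ge0 ?increment_kernel_le.
Qed.

Local Notation K := (convol p qU).

Lemma up_convol t : 0 < t -> econvol p up_kernel t = (k * t + K t)%:E.
Proof.
move=> t0; rewrite /convol -[X in k * X](mean_convol Hnu Hsigma t0) -RintegralZl//.
rewrite -RintegralD//; [|exact: RintegrableZ|exact: increment_convol_integrable].
rewrite (RintegralE mT (RintegrableD mT (RintegrableZ mT k (iM t)) (increment_convol_integrable t))).
by apply: eq_integral => tau _; rewrite /up_kernel; congr EFin; ring.
Qed.

Lemma down_convol t : 0 < t -> econvol p down_kernel t = (k * t - K t)%:E.
Proof.
move=> t0; rewrite /convol -[X in k * X](mean_convol Hnu Hsigma t0) -RintegralZl//.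
rewrite -RintegralB//; [|exact: RintegrableZ|exact: increment_convol_integrable].
rewrite (RintegralE mT (RintegrableB mT (RintegrableZ mT k (iM t)) (increment_convol_integrable t))).
by apply: eq_integral => tau _; rewrite /down_kernel; congr EFin; ring.
Qed.

Let p_le0 t : t <= 0 -> p t = 0. Proof. by move=> t0; rewrite /tail_kernel heaviside_le0// mul0r. Qed.

Let qU_le0 t : t <= 0 -> qU t = 0. Proof. by move=> t0; rewrite /qU heaviside_le0// mul0r. Qed.

Let K_le0 t : t <= 0 -> K t = 0. Proof. exact: convol_eq0. Qed.

Let K_up s t : 0 <= s -> s <= t -> k * s + K s <= k * t + K t.
Proof.
rewrite le_eqVlt => /predU1P[<- t0|s0 st].
  rewrite K_le0// mulr0 addr0; move: t0; rewrite le_eqVlt => /predU1P[<-|t0].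
    by rewrite K_le0// mulr0 addr0.
  rewrite -lee_fin -up_convol//; apply: econvol_ge0; [exact: tail_kernel_ge0|exact: up_kernel_ge0].
rewrite -lee_fin -!up_convol ?(lt_le_trans s0 st)//; apply: econvol_nondecreasing => //.
- exact: measurable_tail_kernel.
- by apply: nondecreasing_measurable => //; exact: up_kernel_nondecreasing.
- exact: tail_kernel_ge0.
- exact: up_kernel_ge0.
- exact: up_kernel_nondecreasing.
Qed.

Let K_down s t : 0 <= s -> s <= t -> k * s - K s <= k * t - K t.
Proof.
rewrite le_eqVlt => /predU1P[<- t0|s0 st].
  rewrite K_le0// mulr0 subr0; move: t0; rewrite le_eqVlt => /predU1P[<-|t0].
    by rewrite K_le0// mulr0 subr0.
  rewrite -lee_fin -down_convol//; apply: econvol_ge0; [exact: tail_kernel_ge0|exact: down_kernel_ge0].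
rewrite -lee_fin -!down_convol ?(lt_le_trans s0 st)//; apply: econvol_nondecreasing => //.
- exact: measurable_tail_kernel.
- by apply: nondecreasing_measurable => //; exact: down_kernel_nondecreasing.
- exact: tail_kernel_ge0.
- exact: down_kernel_ge0.
- exact: down_kernel_nondecreasing.
Qed.

(** [k * t + K t] and [k * t - K t] are the convolutions of [p] with the
  nondecreasing kernels [up_kernel] and [down_kernel], because [p] convolved with
  the mean of the inverse is [t]. *)
Lemma increment_convol_lipschitz s t : 0 <= s -> s <= t -> `|K t - K s| <= k * (t - s).
Proof.
move=> s0 st; have := K_up s0 st; have := K_down s0 st.
by rewrite ler_norml => h1 h2; apply/andP; split; lra.
Qed.

Lemma subordinate0 : u 0 = v 0.
Proof. by rewrite /subordinate /S_Phi eqxx. Qed.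

(** At the endpoints the two sides agree too: [nu_bar nu 0] has the default value [0],
  and the increment of [u] at [0] vanishes. *)
Let phi_kernelE t : phi_kernel nu u t \_ `[0, t] = (fun tau => p (t - tau) * qU tau).
Proof.
apply/funext => tau; rewrite patchE mem_setE in_itv/= /phi_kernel subordinate0.
have [t0|t0] := ltP 0 tau; last first.
  rewrite qU_le0// mulr0; case: ifP => // /andP[h _].
  have -> : tau = 0 by apply/eqP; rewrite eq_le t0.
  by rewrite subordinate0 subrr mulr0.
rewrite (ltW t0) /= /qU heaviside_gt0// mul1r /tail_kernel.
case: ifP => taut; last by rewrite heaviside_le0 ?mul0r// subr_le0 ltW// ltNge taut.
move: taut; rewrite le_eqVlt => /predU1P[->|taut].
  by rewrite subrr (nu_bar0 Hnu) !mulr0 !mul0r.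
by rewrite heaviside_gt0 ?subr_gt0// mul1r.
Qed.

Lemma phi_integralE : phi_integral nu u = K.
Proof. by apply/funext => t; rewrite /phi_integral Rintegral_mkcond phi_kernelE. Qed.

Lemma phi_kernel_integrable t : mu.-integrable `[0, t] (EFin \o phi_kernel nu u t).
Proof.
apply/(Rintegrable_mkcond (measurable_itv _)); rewrite phi_kernelE.
exact: increment_convol_integrable.
Qed.

End subordinated.

(** * The Laplace transform of the non-local derivative *)
Section laplace_density.
Local Open Scope complex_scope.
Local Notation Re := complex.Re.
Context {R : realType} (d : measure_display) (T : measurableType d).
Variables (P : probability T R) (nu : {measure set (measurableTypeR R) -> \bar R}).
Variables (sigma : R -> T -> R) (f : R -> R -> R).
Hypotheses (Hnu : levy_measure nu) (Hsigma : is_subordinator P nu sigma).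
Hypothesis Hf : is_inverse_density P sigma f.
Variables (v : R -> R) (k : R).
Hypotheses (k0 : 0 < k)
  (hv : forall s t, 0 <= s -> 0 <= t -> `|v s - v t| <= k * `|s - t|).
Local Notation mu := (@lebesgue_measure R).
Local Notation D := (`]0%R, +oo[%classic : set R).
Local Notation u := (subordinate f v).
Implicit Types (a s t : R).

Let mD : measurable D. Proof. exact: measurable_itv. Qed.

Variable g : R -> R.
Hypotheses (mg : measurable_fun setT g) (gk : forall t, `|g t| <= k).
Hypothesis Kg : forall t, 0 <= t ->
  convol (tail_kernel nu) (increment_kernel f v) t = \int[mu]_(s in `]0, t]) g s.

Lemma integrable_expRN_bounded a : 0 < a ->
  mu.-integrable D (EFin \o (fun t => expR (- (a * t)) * g t)).
Proof.
move=> a0; apply: (Rintegrable_le mD _ (RintegrableZ mD k (integrable_expRN a0))).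
  by apply: measurable_funM; [exact: measurable_expRN|exact: measurable_funTS].
move=> t _; rewrite !normrM mulrC ler_wpM2r//.
by rewrite (le_trans (gk t))// ler_norm.
Qed.

Lemma integrable_expRN_heaviside a : 0 < a ->
  mu.-integrable D (EFin \o (fun t => expR (- (a * t)) * heaviside t)).
Proof.
move=> a0; apply: eq_integrable (integrable_expRN a0) => // t.
by rewrite mem_setE in_itv/= andbT => t0; rewrite heaviside_gt0// mulr1.
Qed.

Lemma integrable_expRN_increment a : 0 < a ->
  mu.-integrable D (EFin \o (fun t => expR (- (a * t)) * increment_kernel f v t)).
Proof.
move=> a0.
have iM : mu.-integrable setT (EFin \o (fun t => expR (- (a * t)) * mean_kernel P sigma t)).
  apply: ge0_Rintegrable => //.
  - by move=> t _; rewrite mulr_ge0 ?expR_ge0// mean_kernel_ge0.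
  - apply: measurable_funM; first exact: measurable_expRN.
    exact: (measurable_mean_kernel Hnu Hsigma).
  - by rewrite (laplace_mean_kernel Hnu Hsigma)// ltry.
have iMD : mu.-integrable D (EFin \o (fun t => expR (- (a * t)) * mean_kernel P sigma t)).
  exact: integrableS iM.
apply: (Rintegrable_le mD _ (RintegrableZ mD k iMD)).
  apply: measurable_funM; first exact: measurable_expRN.
  apply: measurable_funTS.
  exact: (measurable_increment_kernel Hnu Hsigma Hf k0 hv).
move=> t _; rewrite [k * _]mulrCA normrM [leRHS]normrM ler_wpM2l// (le_trans _ (ler_norm _))//.
exact: (increment_kernel_le Hnu Hsigma Hf k0 hv).
Qed.

Let G t := heaviside t * g t.

Let kernelE t : (fun tau => heaviside (t - tau) * G tau) = g \_ `]0, t[.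
Proof.
apply/funext => tau; rewrite patchE mem_setE in_itv/= /G /heaviside subr_gt0.
by case: (0 < tau); case: (tau < t); rewrite /= ?mul1r ?mul0r ?mulr0.
Qed.

Let integrable_oo t : mu.-integrable `]0, t[ (EFin \o g).
Proof.
apply: (@integrableS _ _ _ mu `]0, t]); [exact: measurable_itv|exact: measurable_itv|exact: subset_itv_oo_oc|].
exact: bounded_integrable_itv gk.
Qed.

Let kernel_integrable t : mu.-integrable setT (EFin \o (fun tau => heaviside (t - tau) * G tau)).
Proof.
by rewrite kernelE; apply: (proj1 (Rintegrable_mkcond (measurable_itv _) _)).
Qed.

(** The primitive of [g] is the convolution of [g] with the Heaviside function. *)
Let K_convol : convol (tail_kernel nu) (increment_kernel f v) = convol (@heaviside R) G.
Proof.
apply/funext => t; have [t0|t0] := leP t 0.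
  rewrite !convol_eq0// => s s0; rewrite ?/G ?/tail_kernel ?/increment_kernel heaviside_le0// ?mul0r//.
rewrite Kg ?ltW// {1}/convol kernelE -Rintegral_mkcond.
by rewrite -Rintegral_itv_bndo_bndc.
Qed.

(** Write [K] for the convolution of [p], the tail of the Levy measure, with the
  increment [u - v 0].  As [K] is the primitive of [g], its transform is [L[g] / lam], and
  [lam * L[p] = Phi nu lam], so that
  [L[g] = lam * L[K] = lam * L[p] * L[u - v 0] = Phi nu lam * (L[u] - v 0 / lam)]. *)
Lemma laplace_derivative (lam : R[i]) : 0 < Re lam ->
  laplace g lam = Phi nu lam * laplace u lam - Phi nu lam / lam * (v 0)%:C.
Proof.
move=> a0.
have l0 : lam != 0 by apply/eqP => e; rewrite e ltxx in a0.
have h1 := @laplace_heaviside R lam a0.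
have H1 : laplace (@heaviside R) lam = lam^-1.
  by rewrite -[LHS](mulKf l0) h1 mulr1.
have Lg : laplace g lam = laplace G lam by apply: eq_laplace => t t0; rewrite /G heaviside_gt0// mul1r.
have Lp : laplace (nu_bar nu) lam = laplace (tail_kernel nu) lam.
  by apply: eq_laplace => t t0; rewrite /tail_kernel heaviside_gt0// mul1r.
have Lu : laplace u lam = laplace (increment_kernel f v) lam + (v 0)%:C * lam^-1.
  rewrite -H1 -laplaceZ; last exact: integrable_expRN_heaviside.
  rewrite -laplaceD; last 2 first.
  - exact: integrable_expRN_increment.
  - have := RintegrableZ mD (v 0) (integrable_expRN_heaviside a0).
    by congr (_.-integrable _ (EFin \o _)); apply/funext => t; rewrite mulrCA.
  apply: eq_laplace => t t0; rewrite /increment_kernel heaviside_gt0// mul1r mulr1.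
  by rewrite subrK.
have iG : mu.-integrable D (EFin \o (fun t => expR (- (Re lam * t)) * G t)).
  apply: eq_integrable (integrable_expRN_bounded a0) => // t.
  by rewrite mem_setE in_itv/= andbT => t0; rewrite /G heaviside_gt0// mul1r.
have ip : mu.-integrable D (EFin \o (fun t => expR (- (Re lam * t)) * tail_kernel nu t)).
  apply: eq_integrable (integrable_nu_bar Hnu a0) => // t.
  by rewrite mem_setE in_itv/= andbT => t0; rewrite /tail_kernel heaviside_gt0// mul1r.
have LK1 : laplace (convol (tail_kernel nu) (increment_kernel f v)) lam =
  laplace (tail_kernel nu) lam * laplace (increment_kernel f v) lam.
  move: (integrable_expRN_increment a0) ip; case: (lam) => a b /= iU ip'.
  apply: (@laplace_convol _ _ _ a) => //.
  - by move=> t t0; rewrite /tail_kernel heaviside_le0// mul0r.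
  - by move=> t t0; rewrite /increment_kernel heaviside_le0// mul0r.
  - exact: (increment_convol_integrable Hnu Hsigma Hf k0 hv).
have LK2 : laplace (convol (@heaviside R) G) lam = laplace (@heaviside R) lam * laplace G lam.
  move: (integrable_expRN_heaviside a0) iG; case: (lam) => a b /= iU ip'.
  apply: (@laplace_convol _ _ _ a) => //.
  - exact: heaviside_le0.
  - by move=> t t0; rewrite /G heaviside_le0// mul0r.
rewrite (Phi_laplace Hnu a0) Lp Lu Lg.
have -> : laplace G lam = lam * (laplace (tail_kernel nu) lam * laplace (increment_kernel f v) lam).
  by rewrite -LK1 K_convol LK2 H1 mulrA mulfV// mul1r.
by field.
Qed.

End laplace_density.

Section non_local_derivative.
Local Open Scope complex_scope.
Local Notation Re := complex.Re.
Context {R : realType} (d : measure_display) (T : measurableType d).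
Variables (P : probability T R) (nu : {measure set (measurableTypeR R) -> \bar R}).
Variables (sigma : R -> T -> R) (f : R -> R -> R).
Hypotheses (Hnu : levy_measure nu) (Hsigma : is_subordinator P nu sigma).
Hypothesis Hf : is_inverse_density P sigma f.
Local Notation mu := (@lebesgue_measure R).
Local Notation D := (`]0%R, +oo[%classic : set R).
Implicit Types (a s t : R).

Variables (v : R -> R) (k : R).
Hypotheses (k0 : 0 < k)
  (hv : forall s t, 0 <= s -> 0 <= t -> `|v s - v t| <= k * `|s - t|).
Local Notation u := (subordinate f v).

(** The integral in the definition of the non-local derivative is Lipschitz in time,
  hence it is the primitive of a bounded function [g]. *)
Lemma phi_derivative_subordinate : exists g : R -> R,
  [/\ forall a, 0 < a -> mu.-integrable D (EFin \o (fun t => expR (- (a * t)) * g t)),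
      forall lam : R[i], 0 < Re lam ->
        laplace g lam = Phi nu lam * laplace u lam - Phi nu lam / lam * (v 0)%:C,
      phi_derivative_defined nu u &
      {ae mu, forall t, 0 < t -> phi_derivative nu u t = g t}].
Proof.
pose K := convol (tail_kernel nu) (increment_kernel f v).
have K_le0 t : t <= 0 -> K t = 0.
  by apply: convol_eq0 => s s0; rewrite ?/tail_kernel ?/increment_kernel heaviside_le0// mul0r.
have [g [mg gk Kg]] := lipschitz_primitive k0 (K_le0 0 (lexx 0))
  (increment_convol_lipschitz Hnu Hsigma Hf k0 hv).
have phiE : phi_integral nu u = fun t => \int[mu]_(s in `]0, t]) g s.
  rewrite (phi_integralE f Hnu v); apply/funext => t.
  have [t0|t0] := leP t 0; last exact: Kg (ltW t0).
  by rewrite -/K K_le0// set_itv_ge ?Rintegral_set0// bnd_simp -leNgt.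
have ae_g := ae_primitive_derivable mg gk.
exists g; split.
- by move=> a; exact: integrable_expRN_bounded mg gk _.
- by move=> lam; exact: (laplace_derivative Hnu Hsigma Hf k0 hv mg gk Kg).
- split; first by move=> t _; exact: (phi_kernel_integrable Hnu Hsigma Hf k0 hv).
  by rewrite phiE; apply: (@filterS _ _ (ae_filter_ringOfSetsType mu) _ _ _ ae_g) => t h /h[].
- by rewrite /phi_derivative phiE; apply: (@filterS _ _ (ae_filter_ringOfSetsType mu) _ _ _ ae_g) => t h /h[].
Qed.

End non_local_derivative.

(** * Mild solutions are classical *)
Theorem theorem5p5 (R : realType)
  (nu : {measure set (measurableTypeR R) -> \bar R}) (Hnu : levy_measure nu)
  (d : measure_display) (T : measurableType d) (P : probability T R)
  (sigma : R -> T -> R) (Hsigma : is_subordinator P nu sigma)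
  (f : R -> R -> R) (Hf : is_inverse_density P sigma f)
  (H theta : R) (HH : 2^-1 < H < 1) (Htheta : 0 < theta)
  (c1 c2 : R) (Hc1 : c1 < 0) (Hc2 : 0 < c2) (Hc : - theta^-1 < c1 - c2)
  (Hinv : inverse_well_defined_on_line nu c2)
  (I : set R) (HI : is_interval I)
  (v : R -> R -> R)
  (Hv : Linfty_X I `[0, +oo[ (fun t x => v x t))
  (Hlip : forall x, I x -> exists k : R, k.-lipschitz_(`[0, +oo[ : set R) (v x))
  (Hab :
    (Lipschitz_X I `[0, +oo[ (fun t x => v x t) /\
     Lp_X I 1 setT
       ((fun y x => laplace (v x) (Complex c2 y)) : R -> R -> Rcomplex R))
    \/
    (Lp_X I 2 `[0, +oo[ (fun t x => v x t) /\
     Lp_X I 2 setT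
       ((fun y x => laplace (v x) (Complex c2 y)) : R -> R -> Rcomplex R)))
  (Hmild : mild_solution nu H theta c1 c2 I (S_Phi f v))
  (HC2 : forall t : R, 0 < t -> C2_in I (fun x => v x t))
  (Hbd : forall x, I x ->
    Linfty `]0, +oo[
      (fun t => derive1 (V2 H theta) t * deriv2_in I (fun y => v y t) x)) :
  classical_solution nu H theta c1 c2 I (S_Phi f v).
Proof.
have [utr udom ucont u2 ueq] := Hmild.
(* The bounded density [g] of the non-local derivative, doubled, has the symbol as
   its Laplace transform. *)
have key x : I x -> exists g : R -> R,
    [/\ is_inv_laplace (FP_symbol nu H theta c1 c2 I (S_Phi f v) x) (fun t => 2 * g t),
      phi_derivative_defined nu (S_Phi f v x) &
      {ae @lebesgue_measure R, forall t, 0 < t -> phi_derivative nu (S_Phi f v x) t = g t}].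
  move=> Ix; have [k0 vk0] := Hlip x Ix.
  (* The constant [k0] may be [0], while the rescalings below need [0 < k]. *)
  pose k := Num.max k0 1.
  have k_gt0 : 0 < k by rewrite lt_max ltr01 orbT.
  have vk s t : 0 <= s -> 0 <= t -> `|v x s - v x t| <= k * `|s - t|.
    move=> s0 t0; have := vk0 (s, t); rewrite /= !in_itv /= !andbT => /(_ (conj s0 t0)) h.
    by apply: le_trans h _; rewrite ler_wpM2r// le_max lexx.
  have [g [ig Lg du gae]] := phi_derivative_subordinate Hnu Hsigma Hf k_gt0 vk.
  exists g; split=> //; split=> lam lam0.
    apply: laplace_cintegrable.
    have := RintegrableZ _ 2 (ig _ lam0); move=> /(_ (measurable_itv _)).
    by congr (_.-integrable _ (EFin \o _)); apply/funext => t; rewrite mulrCA.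
  have l0 : lam != 0 by apply/eqP => e; rewrite e ltxx in lam0.
  rewrite (laplaceZ _ (ig _ lam0)).
  rewrite Lg// /FP_symbol.
  have := ueq x lam Ix lam0; rewrite {2}/S_Phi eqxx -/(subordinate f (v x)) => ->.
  by rewrite (_ : real_complex R 2 = 2) ?rmorph_nat//; field; rewrite l0.
have utwice x : I x -> exists g, is_inv_laplace (FP_symbol nu H theta c1 c2 I (S_Phi f v) x) g.
  by move=> /key[g [gP _ _]]; exists (fun t => 2 * g t).
split=> [|x /key[g []]//|x Ix]; first by split.
have [g [[tg Lg] _ gae]] := key x Ix.
have [tF LF] : is_inv_laplace (FP_symbol nu H theta c1 c2 I (S_Phi f v) x) (FP nu H theta c1 c2 I (S_Phi f v) x).
  exact: (xgetPex _ (utwice x Ix)).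
have FPg : {ae @lebesgue_measure R, forall t, 0 < t -> FP nu H theta c1 c2 I (S_Phi f v) x t = 2 * g t}.
  by apply: laplace_ae_unique => // lam lam0; rewrite LF// Lg.
apply: (@filterS2 _ _ (ae_filter_ringOfSetsType (@lebesgue_measure R)) _ _ _ _ gae FPg).
by move=> t e1 e2 t0; rewrite e1// e2// mulKf.
Qed.
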